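(* Let $f\colon B\to A$ and $g\colon C\to A$ be functors between quasi-categories. Then $g$ admits an absolute right lifting through $f$ in the 2-category $\mathrm{qCat}_2$ (i.e. there exist a functor $\ell\colon C\to B$ and a 2-cell $\lambda\colon f\ell\Rightarrow g$ displaying $\ell$ as an absolute right lifting of $g$ through $f$) if and only if for every object (vertex) $c$ of $C$ the quasi-category $f\downarrow gc\simeq f_{/gc}$ has a terminal object.
   Context: A quasi-category is a simplicial set with fillers for all inner horns $\Lambda^{n,k}\to\Delta^n$ ($n\ge 2$, $0<k<n$); a functor is a simplicial map between quasi-categories. If $A$ is a quasi-category and $X$ a simplicial set, the internal hom $A^X$ is a quasi-category. Let $h$ be the left adjoint of the nerve functor $\mathrm{Cat}\to\mathrm{sSet}$; for a quasi-category $A$, $hA$ is its homotopy category (objects: vertices; arrows: homotopy classes of 1-simplices relative to their boundary). $\mathrm{qCat}_2$ is the strict 2-category with objects quasi-categories and hom-categories $\hom'(A,B)=h(B^A)$; so 1-cells are functors and 2-cells are homotopy classes of 1-simplices of $B^A$. Absolute right lifting: a 2-cell $\lambda\colon f\ell\Rightarrow g$ (with $\ell\colon C\to B$) displays $\ell$ as an absolute right lifting of $g$ through $f$ if for all $b\colon X\to B$, $c\colon X\to C$ and every 2-cell $\chi\colon fb\Rightarrow gc$ there is a unique 2-cell $\zeta\colon b\Rightarrow \ell c$ with $\chi=\lambda c\cdot f\zeta$. Comma quasi-category: for $f\colon B\to A$ and a vertex $a\colon\Delta^0\to A$, $f\downarrow a$ is the pullback of $(\mathrm{cod},\mathrm{dom})\colon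 A^{\Delta^1}\to A\times A$ along $a\times f\colon \Delta^0\times B\to A\times A$; its vertices are pairs of a vertex $b\in B$ and a 1-simplex $fb\to a$. Slice: $f_{/a}$ is the pullback along $f$ of Joyal's slice $A_{/a}\to A$, where an $n$-simplex of $A_{/a}$ is an $(n+1)$-simplex of $A$ with last vertex $a$ and the projection restricts to the face on the first $n+1$ vertices. There is a canonical equivalence $f_{/a}\simeq f\downarrow a$ over $B$. Terminal object: a vertex $t$ of a quasi-category $Q$ such that $t\colon\Delta^0\to Q$ is right adjoint in $\mathrm{qCat}_2$ to $!\colon Q\to\Delta^0$; equivalently every sphere $\partial\Delta^n\to Q$ with $n\ge1$ and last vertex $t$ extends to $\Delta^n$. *)

(* Defs.v *)
(* MathComp, with the classical axioms of mathcomp.classical.boolp.           *)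
From HB Require Import structures.
From mathcomp Require Import all_boot.
From mathcomp Require Import generic_quotient boolp.

Set Implicit Arguments.
Unset Strict Implicit.
Unset Printing Implicit Defensive.

Local Open Scope quotient_scope.
Local Set Primitive Projections.

(* Arrows [m] -> [n] of the simplex category, [n] being {0 < ... < n}.        *)
Record mono (m n : nat) := Mono {
  mono_fun :> 'I_m.+1 -> 'I_n.+1;
  mono_homo : {homo mono_fun : i j / (i <= j)%N} }.

Lemma mono_eq m n (s t : mono m n) : mono_fun s = mono_fun t -> s = t.
Proof.
case: s t => [s hs] [t ht] /= e; case: _ / e ht => ht.
by rewrite (Prop_irrelevance hs ht).
Qed.

Definition mono_id n : mono n n := @Mono n n (fun i => i) (fun i j h => h).

Definition mono_comp l m n (s : mono m n) (t : mono l m) : mono l n :=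
  @Mono l n (fun i => s (t i)) (fun i j h => mono_homo s (mono_homo t h)).

Definition mono_const m n (i : 'I_n.+1) : mono m n :=
  @Mono m n (fun=> i) (fun _ _ _ => leqnn i).

Lemma lift_homo n (i : 'I_n.+2) :
  {homo (lift i : 'I_n.+1 -> 'I_n.+2) : j k / (j <= k)%N}.
Proof. by move=> j k; rewrite /= leq_bump2. Qed.

Definition coface n (i : 'I_n.+2) : mono n n.+1 := Mono (@lift_homo n i).

Record sSet := SSet {
  simp :> nat -> Type;
  act : forall m n, mono m n -> simp n -> simp m;
  act_id : forall n (x : simp n), act (mono_id n) x = x;
  act_comp : forall l m n (s : mono m n) (t : mono l m) (x : simp n),
    act t (act s x) = act (mono_comp s t) x }.

Definition face (X : sSet) n (i : 'I_n.+2) (x : X n.+1) : X n :=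
  act (coface i) x.

(* The totally degenerate m-simplex on a vertex.                              *)
Definition degen (X : sSet) m (x : X 0) : X m := act (mono_const m ord0) x.

(* Naturality sends an equation  act s x = y  to  act s (f x) = f y.  This is *)
(* equivalent to  act s (f x) = f (act s x),  but in this form (together with *)
(* primitive projections) composition of simplicial maps is associative and   *)
(* unital up to conversion, so no transports are needed between 2-cells below.*)
Record smap (X Y : sSet) := SMap {
  smap_fun :> forall n, X n -> Y n;
  smap_nat : forall m n (s : mono m n) (x : X n) (y : X m),
    act s x = y -> act s (smap_fun x) = smap_fun y }.

Definition sid (X : sSet) : smap X X := @SMap X X (fun _ x => x) (fun _ _ _ _ _ e => e).

Definition scomp (X Y Z : sSet) (g : smap Y Z) (f : smap X Y) : smap X Z :=
  @SMap X Z (fun _ x => g _ (f _ x))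
            (fun _ _ _ _ _ e => smap_nat g (smap_nat f e)).

Notation "g \c f" := (scomp g f) (at level 40, left associativity).

Definition Simplex (n : nat) : sSet :=
  @SSet (fun m => mono m n) (fun _ _ t s => mono_comp s t)
        (fun _ _ => erefl) (fun _ _ _ _ _ _ => erefl).

Definition vertex_map (X : sSet) (x : X 0) : smap (Simplex 0) X.
Proof.
exists (fun m (s : mono m 0) => act s x) => m n s t u <-.
exact: act_comp.
Defined.

Definition bang (X : sSet) : smap X (Simplex 0).
Proof.
exists (fun m _ => mono_const m ord0) => m n s x y _.
by apply: mono_eq; apply: funext.
Defined.

Definition sprod (X Y : sSet) : sSet.
Proof.
exists (fun n => (X n * Y n)%type) (fun m n s p => (act s p.1, act s p.2)).
- by move=> n [x y]; rewrite !act_id.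
- by move=> l m n s t [x y]; rewrite !act_comp.
Defined.

Definition spair (X Y Z : sSet) (f : smap Z X) (g : smap Z Y) :
  smap Z (sprod X Y).
Proof.
exists (fun n z => (f n z, g n z)) => m n s z w e /=.
by rewrite (smap_nat f e) (smap_nat g e).
Defined.

Definition sprod_map (X Y X' Y' : sSet) (f : smap X X') (g : smap Y Y') :
  smap (sprod X Y) (sprod X' Y').
Proof.
exists (fun n p => (f n p.1, g n p.2)) => m n s p q <- /=.
by rewrite (smap_nat f erefl) (smap_nat g erefl).
Defined.

Section Pullback.
Variables (X Y Z : sSet) (f : smap X Z) (g : smap Y Z).

Definition pullback_simp n := {p : X n * Y n | f n p.1 = g n p.2}.

Lemma pullback_stable m n (s : mono m n) (p : pullback_simp n) :
  f m (act s (sval p).1) = g m (act s (sval p).2).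
Proof. by rewrite -(smap_nat f erefl) (svalP p) (smap_nat g erefl). Qed.

Definition spullback : sSet.
Proof.
exists pullback_simp (fun m n s p =>
  exist _ (act s (sval p).1, act s (sval p).2) (pullback_stable s p)).
- by move=> n [[x y] e]; apply: eq_exist; rewrite /= !act_id.
- by move=> l m n s t [[x y] e]; apply: eq_exist; rewrite /= !act_comp.
Defined.

End Pullback.

(* The k-th horn: the simplices of Delta^n missing some vertex i != k.        *)
Definition in_horn n (k : 'I_n.+1) m (s : mono m n) : Prop :=
  exists2 i, i != k & forall j, s j != i.

Lemma in_horn_comp l m n (k : 'I_n.+1) (s : mono m n) (t : mono l m) :
  in_horn k s -> in_horn k (mono_comp s t).
Proof. by move=> [i ik si]; exists i => // j; apply: si. Qed.

Definition horn_simp n (k : 'I_n.+1) (m : nat) := {s : mono m n | in_horn k s}.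

Definition horn (n : nat) (k : 'I_n.+1) : sSet.
Proof.
exists (horn_simp k) (fun l m t s =>
  exist _ (mono_comp (sval s) t) (in_horn_comp t (svalP s))).
- by move=> m [s hs]; apply: eq_exist.
- by move=> l m p t u [s hs]; apply: eq_exist.
Defined.

Definition horn_incl n (k : 'I_n.+1) : smap (horn k) (Simplex n).
Proof. by exists (fun m (s : horn_simp k m) => sval s) => l m t s y <-. Defined.

Definition quasi_category (A : sSet) : Prop :=
  forall (n : nat) (k : 'I_n.+1), (2 <= n)%N -> (0 < k < n)%N ->
  forall u : smap (horn k) A,
  exists v : smap (Simplex n) A, v \c horn_incl k = u.

(* n-simplices of A^X: simplicial maps X x Delta^n -> A, in curried form.     *)
Record hom_simp (X A : sSet) (n : nat) := HomSimp {
  hom_simp_fun :> forall m, X m -> mono m n -> A m;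
  hom_simp_nat : forall l m (s : mono l m) x y (t : mono m n) (u : mono l n),
    act s x = y -> mono_comp t s = u ->
    act s (hom_simp_fun x t) = hom_simp_fun y u }.

Lemma hom_simp_eq (X A : sSet) n (p q : hom_simp X A n) :
  (forall m x t, p m x t = q m x t) -> p = q.
Proof.
case: p q => [p hp] [q hq] /= e.
have {}e : p = q by do 3![apply: functional_extensionality_dep => ?]; apply: e.
by case: _ / e hq => hq; rewrite (Prop_irrelevance hp hq).
Qed.

Definition ihom (X A : sSet) : sSet.
Proof.
exists (hom_simp X A)
  (fun k n (r : mono k n) (p : hom_simp X A n) =>
     @HomSimp X A k (fun m x t => p m x (mono_comp r t))
       (fun l m s x y t u e1 e2 =>
          @hom_simp_nat X A n p l m s x y (mono_comp r t) (mono_comp r u)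
            e1 (f_equal (mono_comp r) e2))).
- by move=> n p; apply: hom_simp_eq.
- by move=> k m n r s p; apply: hom_simp_eq.
Defined.

(* The vertex of A^X corresponding to a simplicial map X -> A.                *)
Definition name (X A : sSet) (f : smap X A) : ihom X A 0 :=
  @HomSimp X A 0 (fun m x _ => f m x) (fun _ _ _ _ _ _ _ e _ => smap_nat f e).

Definition ihom_post (X B A : sSet) (f : smap B A) : smap (ihom X B) (ihom X A).
Proof.
exists (fun n (p : hom_simp X B n) =>
  @HomSimp X A n (fun m x t => f m (p m x t))
    (fun _ _ _ _ _ _ _ e1 e2 => smap_nat f (hom_simp_nat p e1 e2))).
by move=> m n s p q <-; apply: hom_simp_eq.
Defined.

Definition ihom_pre (X C A : sSet) (c : smap X C) : smap (ihom C A) (ihom X A).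
Proof.
exists (fun n (p : hom_simp C A n) =>
  @HomSimp X A n (fun m x t => p m (c m x) t)
    (fun _ _ _ _ _ _ _ e1 e2 => hom_simp_nat p (smap_nat c e1) e2)).
by move=> m n s p q <-; apply: hom_simp_eq.
Defined.

(* Evaluation A^X -> A at a vertex of X.                                      *)
Definition ev_at (X A : sSet) (x : X 0) : smap (ihom X A) A.
Proof.
exists (fun n (p : hom_simp X A n) => p n (degen n x) (mono_id n)).
move=> m n s p q <- /=; apply: hom_simp_nat; last exact: mono_eq.
by rewrite /degen act_comp; congr act; apply: mono_eq.
Defined.

Record category := Category {
  obj :> Type;
  hom : obj -> obj -> Type;
  cid : forall x, hom x x;
  ccomp : forall x y z, hom y z -> hom x y -> hom x z;
  ccompA : forall x y z t (h : hom z t) (g : hom y z) (f : hom x y),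
    ccomp h (ccomp g f) = ccomp (ccomp h g) f;
  ccomp1l : forall x y (f : hom x y), ccomp (cid y) f = f;
  ccomp1r : forall x y (f : hom x y), ccomp f (cid x) = f }.

Arguments cid {c}.
Arguments ccomp {c x y z}.

Record functor (C D : category) := Functor {
  fobj :> C -> D;
  fhom : forall x y, hom x y -> hom (fobj x) (fobj y);
  fhom_id : forall x, fhom (cid x) = cid (fobj x);
  fhom_comp : forall x y z (g : hom y z) (f : hom x y),
    fhom (ccomp g f) = ccomp (fhom g) (fhom f) }.

(* The left adjoint h of the nerve, in its standard presentation: the         *)
(* category freely generated by the vertices and the 1-simplices of X, subject*)
(* to  s_0 x = id_x  and  d_1 w = d_0 w o d_2 w  for every 2-simplex w.       *)
(* (When X is a quasi-category its arrows are exactly the homotopy classes,   *)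
(* relative to the boundary, of 1-simplices of X.)                            *)
Section HomotopyCategory.
Variable X : sSet.

Definition src (e : X 1) : X 0 := face (inord 1) e.
Definition tgt (e : X 1) : X 0 := face ord0 e.
Definition edge (x y : X 0) := {e : X 1 | src e = x /\ tgt e = y}.

Inductive word : X 0 -> X 0 -> Type :=
| w_gen x y : edge x y -> word x y
| w_id x : word x x
| w_comp x y z : word y z -> word x y -> word x z.

Inductive wrel : forall x y, word x y -> word x y -> Prop :=
| wrel_refl x y (u : word x y) : wrel u u
| wrel_sym x y (u v : word x y) : wrel u v -> wrel v u
| wrel_trans x y (u v w : word x y) : wrel u v -> wrel v w -> wrel u w
| wrel_comp x y z (u u' : word y z) (v v' : word x y) :
    wrel u u' -> wrel v v' -> wrel (w_comp u v) (w_comp u' v')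
| wrel_assoc x y z t (u : word z t) (v : word y z) (w : word x y) :
    wrel (w_comp u (w_comp v w)) (w_comp (w_comp u v) w)
| wrel_idl x y (u : word x y) : wrel (w_comp (w_id y) u) u
| wrel_idr x y (u : word x y) : wrel (w_comp u (w_id x)) u
| wrel_degen x (e : edge x x) :
    sval e = degen 1 x -> wrel (w_gen e) (w_id x)
| wrel_simplex x y z (w : X 2) (f : edge x y) (g : edge y z) (h : edge x z) :
    face (inord 2) w = sval f -> face (inord 0) w = sval g ->
    face (inord 1) w = sval h ->
    wrel (w_comp (w_gen g) (w_gen f)) (w_gen h).

HB.instance Definition _ x y := gen_eqMixin (word x y).
HB.instance Definition _ x y := gen_choiceMixin (word x y).

Definition wrelb x y : rel (word x y) := fun u v => `[< wrel u v >].

Lemma wrelb_refl x y : reflexive (@wrelb x y).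
Proof. by move=> u; apply/asboolP/wrel_refl. Qed.

Lemma wrelb_sym x y : symmetric (@wrelb x y).
Proof. by move=> u v; apply/asboolP/asboolP; apply: wrel_sym. Qed.

Lemma wrelb_trans x y : transitive (@wrelb x y).
Proof.
by move=> v u w /asboolP uv /asboolP vw; apply/asboolP/(wrel_trans uv vw).
Qed.

Canonical wrelb_equiv x y :=
  EquivRel (@wrelb x y) (@wrelb_refl x y) (@wrelb_sym x y) (@wrelb_trans x y).

Definition harr x y : Type := {eq_quot (@wrelb x y)}.

Definition hclass x y (u : word x y) : harr x y := \pi_({eq_quot (@wrelb x y)}) u.

Definition hrepr x y (a : harr x y) : word x y :=
  repr (a : {eq_quot (@wrelb x y)}).

Lemma hreprK x y (a : harr x y) : hclass (hrepr a) = a.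
Proof. exact: reprK. Qed.

Lemma hclassP x y (u v : word x y) : hclass u = hclass v <-> wrel u v.
Proof.
apply: (iff_trans (rwP (eqmodP (wrelb_equiv x y) u v))).
exact (iff_sym (rwP (asboolP (wrel u v)))).
Qed.

Lemma hreprP x y (u : word x y) : wrel (hrepr (hclass u)) u.
Proof. by apply/hclassP/hreprK. Qed.

Definition hcomp x y z (b : harr y z) (a : harr x y) : harr x z :=
  hclass (w_comp (hrepr b) (hrepr a)).

Lemma hcompE x y z (u : word y z) (v : word x y) :
  hcomp (hclass u) (hclass v) = hclass (w_comp u v).
Proof. by apply/hclassP/wrel_comp; apply: hreprP. Qed.

Definition hcat : category.
Proof.
exists (X 0) harr (fun x => hclass (w_id x)) hcomp.
- move=> x y z t h g f.
  rewrite -[h]hreprK -[g]hreprK -[f]hreprK !hcompE.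
  exact/hclassP/wrel_assoc.
- by move=> x y f; rewrite -[f]hreprK hcompE; apply/hclassP/wrel_idl.
- by move=> x y f; rewrite -[f]hreprK hcompE; apply/hclassP/wrel_idr.
Defined.

Definition hedge x y (e : edge x y) : @hom hcat x y := hclass (w_gen e).

End HomotopyCategory.

(* hcat X has the universal property of the presented category: functors      *)
(* hcat X -> D are the compatible assignments on vertices and 1-simplices,    *)
(* that is, the simplicial maps from X to the (2-coskeletal) nerve of D.      *)
Section HcatUniversal.
Variables (X : sSet) (D : category) (F0 : X 0 -> D).
Variable F1 : forall x y, edge x y -> hom (F0 x) (F0 y).
Hypothesis F1_degen : forall x (e : edge x x),
  sval e = degen 1 x -> F1 e = cid (F0 x).
Hypothesis F1_simplex : forall x y z (w : X 2)
    (f : edge x y) (g : edge y z) (h : edge x z),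
  face (inord 2) w = sval f -> face (inord 0) w = sval g ->
  face (inord 1) w = sval h -> ccomp (F1 g) (F1 f) = F1 h.

Fixpoint word_lift x y (u : word x y) : hom (F0 x) (F0 y) :=
  match u with
  | w_gen _ _ e => F1 e
  | w_id x => cid (F0 x)
  | w_comp _ _ _ u v => ccomp (word_lift u) (word_lift v)
  end.

Lemma word_lift_wrel x y (u v : word x y) :
  wrel u v -> word_lift u = word_lift v.
Proof.
elim=> {x y u v} //=.
- by move=> x y u v w _ -> _ ->.
- by move=> x y z u u' v v' _ -> _ ->.
- by move=> *; apply: ccompA.
- by move=> *; apply: ccomp1l.
- by move=> *; apply: ccomp1r.
Qed.

Definition hcat_lift : functor (hcat X) D.
Proof.
exists F0 (fun x y (a : @hom (hcat X) x y) => word_lift (hrepr a)).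
- by move=> x; apply: (word_lift_wrel (hreprP (w_id x))).
- move=> x y z g f.
  exact: (word_lift_wrel (hreprP (w_comp (hrepr g) (hrepr f)))).
Defined.

Lemma hcat_lift_edge x y (e : edge x y) : fhom hcat_lift (hedge e) = F1 e.
Proof. exact: (word_lift_wrel (hreprP (w_gen e))). Qed.

Lemma hcat_lift_unique
    (G : forall x y, @hom (hcat X) x y -> hom (F0 x) (F0 y)) :
  (forall x, G x x (cid x) = cid (F0 x)) ->
  (forall x y z (g : @hom (hcat X) y z) (f : @hom (hcat X) x y),
     G x z (ccomp g f) = ccomp (G y z g) (G x y f)) ->
  (forall x y (e : edge x y), G x y (hedge e) = F1 e) ->
  forall x y (a : @hom (hcat X) x y), G x y a = fhom hcat_lift a.
Proof.
move=> G1 GM GE x y a; rewrite /= -[in LHS](hreprK a).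
elim: {a} (hrepr a) => {x y} [x y e|x|x y z u IHu v IHv] /=.
- exact: GE.
- exact: G1.
- by rewrite -IHu -IHv -GM /= hcompE.
Qed.

End HcatUniversal.

Lemma edge_map_proof (X Y : sSet) (F : smap X Y) x y (e : edge x y) :
  src (F 1 (sval e)) = F 0 x /\ tgt (F 1 (sval e)) = F 0 y.
Proof. by case: e => e [/= <- <-]; split; apply: smap_nat. Qed.

Definition edge_map (X Y : sSet) (F : smap X Y) x y (e : edge x y) :
  edge (F 0 x) (F 0 y) := exist _ (F 1 (sval e)) (edge_map_proof F e).

Definition hmap (X Y : sSet) (F : smap X Y) : functor (hcat X) (hcat Y).
Proof.
apply: (@hcat_lift X (hcat Y) (F 0) (fun x y e => hedge (edge_map F e))).
- move=> x e ee; apply/hclassP/wrel_degen => /=.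
  by rewrite ee /degen (smap_nat F erefl).
- move=> x y z w f g h e2 e0 e1.
  rewrite [LHS]hcompE; apply/hclassP/(@wrel_simplex _ _ _ _ (F 2 w)) => /=.
  + by rewrite -e2; apply: smap_nat.
  + by rewrite -e0; apply: smap_nat.
  + by rewrite -e1; apply: smap_nat.
Defined.

(* The hom-category from X to A is h(A^X); its objects are simplicial maps,   *)
(* via name.  The 2-cells below make sense for all simplicial sets, and qCat_2*)
(* is the full sub-2-category on the quasi-categories.                        *)
Definition cell (X A : sSet) (f g : smap X A) : Type :=
  @hom (hcat (ihom X A)) (name f) (name g).

Definition cell_id (X A : sSet) (f : smap X A) : cell f f :=
  @cid (hcat (ihom X A)) (name f).

Definition vcomp (X A : sSet) (f g k : smap X A) (b : cell g k) (a : cell f g) :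
  cell f k := ccomp b a.

Definition whisk_l (X B A : sSet) (f : smap B A) (b b' : smap X B)
  (z : cell b b') : cell (f \c b) (f \c b') := fhom (hmap (ihom_post X f)) z.

Definition whisk_r (X C A : sSet) (k g : smap C A) (l : cell k g)
  (c : smap X C) : cell (k \c c) (g \c c) := fhom (hmap (ihom_pre A c)) l.

Definition absolute_right_lifting (A B C : sSet) (f : smap B A) (g : smap C A)
    (l : smap C B) (lam : cell (f \c l) g) : Prop :=
  forall (X : sSet), quasi_category X ->
  forall (b : smap X B) (c : smap X C) (chi : cell (f \c b) (g \c c)),
  exists! zeta : cell b (l \c c), chi = vcomp (whisk_r lam c) (whisk_l f zeta).

(* f -| u, for f : B -> A and u : A -> B.                                     *)
Definition adjunction (A B : sSet) (f : smap B A) (u : smap A B) : Prop :=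
  exists (eta : cell (sid B) (u \c f)) (eps : cell (f \c u) (sid A)),
    vcomp (whisk_r eps f) (whisk_l f eta) = cell_id f /\
    vcomp (whisk_l u eps) (whisk_r eta u) = cell_id u.

Definition terminal (Q : sSet) (t : Q 0) : Prop :=
  adjunction (bang Q) (vertex_map t).

Definition dom_map (A : sSet) : smap (ihom (Simplex 1) A) A :=
  @ev_at (Simplex 1) A (mono_const 0 ord0).

Definition cod_map (A : sSet) : smap (ihom (Simplex 1) A) A :=
  @ev_at (Simplex 1) A (mono_const 0 ord_max).

Definition comma (A B : sSet) (f : smap B A) (a : A 0) : sSet :=
  spullback (spair (cod_map A) (dom_map A)) (sprod_map (vertex_map a) f).

(* Main.v *)
(* If (l, lam) is an absolute right lifting, apply it to the projection p from
   the comma quasi-category f | gc: this gives a 2-cell from p to the constant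
   map at lc, which together with the universal 2-cell of the comma lifts to a
   homotopy from the identity of f | gc to the constant map at the vertex
   t = (lc, lam c).  Correcting the two pieces by inner horn fillings relative
   to t makes the homotopy strictly constant on t, hence t is terminal.

   Conversely, a terminal vertex of a quasi-category in the 2-categorical sense
   admits fillers of spheres with last vertex t: the unit of the adjunction
   turns the sphere into an outer horn whose last edge has a left inverse, and
   such an edge can be traded for the identity through inner horns only.
   Filling the prisms Delta^n x Delta^1 down to their last shuffle by inner
   horns, this allows one to choose l and lam simplex by simplex on C.  The
   same extension over X x Delta^1 and X x Delta^2, whose new simplices all end
   at a terminal vertex, gives existence and uniqueness in the universal
   property.

   Partial maps are represented by their graphs, so that no default values are
   needed outside their domain. *)
Require Import Defs.
From mathcomp Require Import all_boot.
From mathcomp Require Import boolp zify.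
From mathcomp Require classical_sets.

Set Implicit Arguments.
Unset Strict Implicit.
Unset Printing Implicit Defensive.

(** The lifting property quantifies over all [X], but the forward direction applies it to two of
    them: existence over the comma produces the homotopy, uniqueness over [Simplex 0] controls it at
    [t]. The obstacle is that homotopy classes of maps into a comma are not detected by the two
    projections, so the triangle identity at [t] cannot be checked componentwise; the components are
    made strict at [t] instead, and horns in internal homs are therefore filled relative to
    prescribed values. In the converse, the datum over a simplex [c] is a prism in [A] whose top is
    [c], not a constant, so its boundary is not a sphere in any [comma f a]. Collapsing the top to
    the last vertex yields such a sphere, but the face opposite the last bottom vertex is no longer
    controlled; a second prism filling, over a cone, restores it. No slice or join is needed for
    this. Arrows of [hcat] are classes of words, so equalities of 2-cells have to be converted to
    2-simplices before any of this can start. *)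

Lemma mono_ext m n (s t : mono m n) : (forall i, s i = t i :> nat) -> s = t.
Proof. by move=> e; apply: mono_eq; apply: funext => i; apply: val_inj; apply: e. Qed.

Lemma mono_to0 m (s t : mono m 0) : s = t.
Proof. by apply: mono_ext => i; rewrite !ord1. Qed.

(** * Partial simplicial maps and the attaching of cells *)

Definition graph (Z W : sSet) := forall n, Z n -> W n -> Prop.

Record partial_map (Z W : sSet) (G : graph Z W) : Prop := PartialMap {
  partial_act : forall m n (s : mono m n) z w,
    G n z w -> G m (act s z) (act s w);
  partial_fun : forall n z w w', G n z w -> G n z w' -> w = w' }.

Definition gdom (Z W : sSet) (G : graph Z W) n (z : Z n) : Prop :=
  exists w, G n z w.

Definition gsub (Z W : sSet) (G H : graph Z W) : Prop :=
  forall n z w, G n z w -> H n z w.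

Lemma gdom_act (Z W : sSet) (G : graph Z W) m n (s : mono m n) z :
  partial_map G -> gdom G z -> gdom G (act s z).
Proof. by move=> pG [w Gw]; exists (act s w); apply: partial_act. Qed.

Lemma partial_total (Z W : sSet) (G : graph Z W) :
  partial_map G -> (forall n (z : Z n), gdom G z) ->
  exists h : smap Z W, forall n (z : Z n), G n z (h n z).
Proof.
move=> pG dG; pose h n (z : Z n) := sval (cid (dG n z)).
have hP n z : G n z (h n z) by rewrite /h; case: cid.
have nat m n (s : mono m n) z y : act s z = y -> act s (h n z) = h m y.
  by move=> <-; apply: (partial_fun pG) (hP _ _); apply: partial_act.
by exists (SMap nat).
Qed.

Section Adjoin.
Variables (Z W : sSet) (G : graph Z W) (k : nat) (z0 : Z k) (w0 : W k).
Arguments G : clear implicits.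

Definition adjoin : graph Z W := fun n z w =>
  G n z w \/ exists2 s : mono n k, z = act s z0 & w = act s w0.

Arguments adjoin : clear implicits.

Hypothesis pG : partial_map G.
Hypothesis w0P : forall m (s : mono m k),
  gdom G (act s z0) -> G m (act s z0) (act s w0).
Hypothesis z0P : forall m (s t : mono m k),
  act s z0 = act t z0 -> s = t \/ gdom G (act s z0).

(** By [z0P] the restrictions of [z0] outside the domain are pairwise distinct: a free cell is
    attached, and [w0] only has to agree with [G] on those restrictions that already lie in the
    domain. *)
Lemma partial_adjoin : partial_map adjoin.
Proof.
split=> [m n s z w [Gzw|[t -> ->]]|n z w w' [Gzw|[s ez ew]] [Gzw'|[t ez' ew']]].
- by left; apply: partial_act.
- by right; exists (mono_comp t s); rewrite act_comp.
- exact: (partial_fun pG) Gzw Gzw'.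
- by subst z w'; apply: (partial_fun pG Gzw); apply: w0P; exists w.
- by subst z w; apply: (partial_fun pG _ Gzw'); apply: w0P; exists w'.
- subst z w w'; have [<- //|dG] := z0P ez'.
  apply: (partial_fun pG (w0P dG)); rewrite ez'; apply: w0P; by rewrite -ez'.
Qed.

Lemma adjoin_sub : gsub G adjoin.
Proof. by move=> n z w; left. Qed.

Lemma adjoin_new : adjoin k z0 w0.
Proof. by right; exists (mono_id k); rewrite act_id. Qed.

End Adjoin.

Arguments adjoin {Z W} G {k} z0 w0 n z w.

(** * Nerves of finite posets *)

(** Stated as a property of [Z], so that it applies to simplices and to products of two simplices as
    they stand, without transport along an isomorphism. *)
Record is_nerve (T : finType) (le : rel T) (Z : sSet)
    (pos : forall m, Z m -> 'I_m.+1 -> T) : Prop := IsNerve {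
  pos_act : forall m n (s : mono m n) z i, pos m (act s z) i = pos n z (s i);
  pos_inj : forall m (z z' : Z m), pos m z =1 pos m z' -> z = z';
  pos_homo : forall m (z : Z m), {homo pos m z : i j / i <= j >-> le i j};
  pos_real : forall m (f : 'I_m.+1 -> T),
    {homo f : i j / i <= j >-> le i j} -> exists z, pos m z =1 f }.

Section Nerve.
Variables (T : finType) (le : rel T) (Z : sSet).
Variable pos : forall m, Z m -> 'I_m.+1 -> T.
Hypothesis le_refl : reflexive le.
Hypothesis le_anti : antisymmetric le.
Hypothesis le_trans : transitive le.
Hypothesis N : is_nerve le pos.

Definition verts m (z : Z m) : {set T} := [set pos z i | i in 'I_m.+1].

Definition chain (S : {set T}) : Prop := {in S &, total le}.

Lemma vertsP m (z : Z m) x : reflect (exists i, x = pos z i) (x \in verts z).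
Proof. by apply: (iffP imsetP) => [[i _ ->]|[i ->]]; exists i. Qed.

Lemma mem_verts m (z : Z m) i : pos z i \in verts z.
Proof. by apply/vertsP; exists i. Qed.

Lemma verts_chain m (z : Z m) : chain (verts z).
Proof.
move=> x y /vertsP[i ->] /vertsP[j ->].
case: (leqP i j) => [ij|/ltnW ji]; first by rewrite (pos_homo N z ij).
by rewrite (pos_homo N z ji) orbT.
Qed.

Lemma verts_neq0 m (z : Z m) : verts z != set0.
Proof. by apply/set0Pn; exists (pos z ord0); apply: mem_verts. Qed.

Lemma verts_act m n (s : mono m n) z : verts (act s z) \subset verts z.
Proof. by apply/subsetP=> x /vertsP[i ->]; rewrite (pos_act N) mem_verts. Qed.

Lemma chain_sub (S S' : {set T}) : S \subset S' -> chain S' -> chain S.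
Proof. by move=> /subsetP sS c x y /sS xS /sS yS; apply: c. Qed.

Lemma act_of_verts_sub m n (z : Z m) (z' : Z n) :
  verts z' \subset verts z -> exists s, z' = act s z.
Proof.
move=> /subsetP sub.
have ex j : exists i, pos z i == pos z' j.
  by have /vertsP[i e] := sub _ (mem_verts z' j); exists i; rewrite e.
(* The least preimage is taken because [z] may repeat vertices, and an arbitrary choice of preimages
   need not be monotone. *)
pose s j : 'I_m.+1 := [arg min_(i < xchoose (ex j) | pos z i == pos z' j) val i].
have sP j : pos z (s j) = pos z' j /\
    forall i, pos z i = pos z' j -> s j <= i.
  rewrite /s; case: arg_minnP => [|i /eqP -> h]; first exact: (xchooseP (ex j)).
  by split=> // i' e; apply: h; apply/eqP.
have hs : {homo s : i j / i <= j}.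
  move=> i j ij; rewrite leqNgt; apply/negP=> lt.
  have [ei mi] := sP i; have [ej mj] := sP j.
  have le1 := pos_homo N z (ltnW lt); have le2 := pos_homo N z' ij.
  rewrite ej ei in le1.
  have e := le_anti (introT andP (conj le1 le2)).
  by have := mi (s j); rewrite ej e => /(_ erefl); rewrite leqNgt lt.
exists (Mono hs); apply: (pos_inj N) => j.
by rewrite (pos_act N) /=; case: (sP j) => ->.
Qed.

Lemma realize_chain (S : {set T}) : chain S -> S != set0 ->
  exists k (z : Z k), [/\ injective (pos z), verts z = S & #|S| = k.+1].
Proof.
move=> cS S0; have [x0 x0S] := set0Pn _ S0.
pose s := sort le (enum S).
have so : sorted le s.
  apply: (@sort_sorted_in _ (mem S)) => //.
  by apply/allP=> x; rewrite mem_enum.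
have us : uniq s by rewrite sort_uniq enum_uniq.
have zs : size s = #|S| by rewrite size_sort -cardE.
case Ek: #|S| => [|k]; first by move: S0; rewrite -cards_eq0 Ek.
have ls (i : 'I_k.+1) : i < size s by rewrite zs Ek.
have hs : {homo (fun i : 'I_k.+1 => nth x0 s i) : i j / i <= j >-> le i j}.
  by move=> i j; apply: (sorted_leq_nth le_trans le_refl x0 so); rewrite inE.
have [z zP] := pos_real N hs.
exists k, z; split=> //.
  move=> i j; rewrite !zP => /eqP; rewrite nth_uniq // => /eqP; exact: val_inj.
apply/setP=> x; apply/vertsP/idP => [[i ->]|xS].
  by rewrite zP -mem_enum -(mem_sort le) mem_nth.
have xs : x \in s by rewrite mem_sort mem_enum.
have xk : index x s < k.+1 by rewrite -Ek -zs index_mem.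
by exists (Ordinal xk); rewrite zP /= nth_index.
Qed.

Lemma chain_max (S : {set T}) (L : pred T) q : chain S -> q \in S -> L q ->
  exists p, [/\ p \in S, L p & forall x, x \in S -> L x -> le x p].
Proof.
move=> cS qS Lq.
(* [h] is a rank: since [S] is a chain, an element of [S] in [L] that maximises it is the largest
   one. *)
pose h (x : T) := #|[set y in S | L y && le y x]|.
case: (@arg_maxnP _ q (fun x => (x \in S) && L x) h); first by rewrite qS.
move=> p /andP[pS Lp] mx; exists p; split=> // x xS Lx.
have /orP[//|px] := cS x p xS pS.
have sub : [set y in S | L y && le y p] \subset [set y in S | L y && le y x].
  apply/subsetP=> y; rewrite !inE => /and3P[-> -> yp] /=; exact: le_trans px.
have /eqP e : [set y in S | L y && le y p] == [set y in S | L y && le y x].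
  by rewrite eqEcard sub; apply: mx; rewrite xS.
have : x \in [set y in S | L y && le y x] by rewrite inE xS Lx le_refl.
by rewrite -e inE => /and3P[].
Qed.

End Nerve.

Arguments verts_chain {T le Z pos} N {m} z.

Lemma fill_horn (A : sSet) n (k : 'I_n.+1) (U : graph (Simplex n) A) :
  quasi_category A -> 0 < k < n -> partial_map U ->
  (forall m (s : mono m n), in_horn k s -> gdom U s) ->
  exists w : A n, forall m (s : mono m n) x, in_horn k s -> U m s x -> x = act s w.
Proof.
move=> qA kn pU dU.
pose u m (s : horn k m) : A m := sval (cid (dU m (sval s) (svalP s))).
have uP m (s : horn k m) : U m (sval s) (u m s) by rewrite /u; case: cid.
have nat m l (t : mono m l) (s : horn k l) y : act t s = y -> act t (u l s) = u m y.
  move=> <-; apply: (partial_fun pU) (uP _ _).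
  exact: (partial_act pU t (uP _ s)).
have n2 : 2 <= n by lia.
have [v vP] := qA n k n2 kn (SMap nat).
exists (v n (mono_id n)) => m s x hs Ux.
have -> : act s (v n (mono_id n)) = v m s by apply: smap_nat; apply: mono_eq.
have -> : v m s = (v \c horn_incl k) m (exist _ s hs) by [].
by rewrite vP; apply: (partial_fun pU) Ux _; apply: (uP _ (exist _ s hs)).
Qed.

(** * Inner anodyne extensions by matching *)

(* A chain S is matched with S with r p added or removed, where p is the
   largest element of S in the down-set L; since r p lies strictly between p
   and a further element of S, only inner horns are filled. *)
Section Matching.
Variables (T : finType) (le : rel T) (Z : sSet).
Variable pos : forall m, Z m -> 'I_m.+1 -> T.
Hypothesis le_refl : reflexive le.
Hypothesis le_anti : antisymmetric le.
Hypothesis le_trans : transitive le.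
Hypothesis N : is_nerve le pos.

Local Notation verts z := (verts pos z).
Local Notation chain := (chain le).

Variables (A : sSet) (qA : quasi_category A).
Variables (L : pred T) (r : T -> T) (Zp : {set T} -> Prop).
Hypothesis L_down : forall x y, L x -> le y x -> L y.
Hypothesis r_notL : forall p, L p -> ~~ L (r p).
Hypothesis r_above : forall p, L p -> le p (r p).
Hypothesis r_least : forall p x, L p -> ~~ L x -> le p x -> le (r p) x.
Hypothesis Zp_sub : forall S S' : {set T}, S' \subset S -> Zp S -> Zp S'.

Definition pivot (S : {set T}) p :=
  [/\ p \in S, L p & forall x, x \in S -> L x -> le x p].

(** Whether a simplex lies in the domain of a partial map depends only on its vertex set; the domain
    can thus be handled as a family of finite sets. *)
Definition vdom (G : graph Z A) (S : {set T}) :=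
  exists m (z : Z m), verts z \subset S /\ S \subset verts z /\ gdom G z.

(** [Zp] is the sieve of chains to be reached. Both partners of a missing chain must be available:
    adding [r p] stays inside [Zp], removing it leaves the chain missing. The further vertex outside
    [L] lies above [r p] and makes the horn inner. *)
Definition matched (G : graph Z A) := forall S, chain S -> S != set0 -> Zp S ->
  ~ vdom G S -> exists p, [/\ pivot S p, Zp (r p |: S), ~ vdom G (S :\ r p) &
     exists2 x, x \in S & ~~ L x && (x != r p)].

Lemma pivot_uniq S p q : pivot S p -> pivot S q -> p = q.
Proof. by move=> [pS Lp mp] [qS Lq mq]; apply: le_anti; rewrite mq ?mp. Qed.

(** [r_above] puts the elements of [S] in [L] below [r p], and [r_least] puts the remaining ones
    above it. *)
Lemma pivot_chain S p : chain S -> pivot S p -> chain (r p |: S).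
Proof.
move=> cS [pS Lp mp].
have h x : x \in S -> le x (r p) || le (r p) x.
  move=> xS; have [Lx|Lx] := boolP (L x).
    by rewrite (le_trans (mp x xS Lx) (r_above Lp)).
  have /orP[px|xp] := cS p x pS xS; first by rewrite (r_least Lp Lx px) orbT.
  by case/negP: Lx; apply: L_down xp.
move=> x y; rewrite !inE => /orP[/eqP->|xS] /orP[/eqP->|yS]; last exact: cS.
- by rewrite le_refl.
- by rewrite orbC h.
- exact: h.
Qed.

Lemma pivot_transfer (S S' : {set T}) p : L p -> pivot S p -> p \in S' ->
  (forall x, L x -> x \in S' -> x \in S) -> pivot S' p.
Proof. by move=> Lp [pS _ mp] pS' sub; split=> // x xS' Lx; apply: mp => //; apply: sub. Qed.

Lemma vdom_gdom G m (z : Z m) : partial_map G -> gdom G z <-> vdom G (verts z).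
Proof.
move=> pG; split=> [d|[n [z' [s1 [s2 d]]]]]; first by exists m, z.
by have [s ->] := act_of_verts_sub le_anti N s2; apply: gdom_act.
Qed.

Lemma vdom_sub G (S S' : {set T}) : partial_map G -> chain S -> S' != set0 ->
  S' \subset S -> vdom G S -> vdom G S'.
Proof.
move=> pG cS S0 sub [m [z [s1 [s2 d]]]].
have cS' := chain_sub sub cS.
have [k [z' [_ e _]]] := realize_chain le_refl le_trans N cS' S0.
subst S'; have [s es] := act_of_verts_sub le_anti N (subset_trans sub s2).
by exists k, z'; do 2!split=> //; rewrite es; apply: gdom_act.
Qed.

(** Deleting a vertex other than the pivot lowers the cardinality. Deleting the pivot may be
    compensated by [r q] for the new pivot [q]; the second summand then drops, because [r q] is not
    in [L]. *)
Definition wt (S : {set T}) := #|S| + #|[set x in S | L x]|.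

(* All facets of S other than S :\ r p are then in the domain, because the
   partner of a missing one would have smaller weight. *)
Lemma matched_minimal G : partial_map G -> matched G ->
  (exists S, [/\ chain S, S != set0, Zp S & ~ vdom G S]) ->
  exists S p, [/\ [/\ chain S, Zp S, pivot S p & r p \in S],
    ~ vdom G S, ~ vdom G (S :\ r p),
    exists2 x, x \in S & ~~ L x && (x != r p) &
    forall x, x \in S -> x != r p -> vdom G (S :\ x)].
Proof.
move=> pG mG exS.
pose good (S : {set T}) := `[< [/\ chain S, Zp S & ~ vdom G S] /\
   exists2 p, pivot S p & r p \in S >].
have complete (S : {set T}) : chain S -> S != set0 -> Zp S -> ~ vdom G S ->
    exists p, [/\ pivot S p & good (r p |: S)].
  move=> cS S0 ZS dS; have [p [pp Zr _ _]] := mG S cS S0 ZS dS.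
  have [pS Lp mp] := pp; exists p; split=> //; apply/asboolP; split; last first.
    exists p; last by rewrite setU11.
    apply: (pivot_transfer Lp pp); first by rewrite !inE pS orbT.
    by move=> x Lx; rewrite !inE => /orP[/eqP ex|//]; case/negP: (r_notL Lp); rewrite -ex.
  split=> //; first exact: pivot_chain.
  by move=> d; apply: dS; apply: vdom_sub d => //; [apply: pivot_chain|apply: subsetUr].
have [S0 [cS0 S00 ZS0 dS0]] := exS.
have [p0 [_ gS1]] := complete _ cS0 S00 ZS0 dS0.
case: (@arg_minnP _ (r p0 |: S0) good wt gS1) => S /asboolP[[cS ZS dS] [p pp rS]] mS.
have Sn0 : S != set0 by apply/set0Pn; exists (r p).
have [p' [pp' _ dSr ex]] := mG S cS Sn0 ZS dS.
have e := pivot_uniq pp' pp; subst p'.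
exists S, p; split=> // x xS xr; apply: contrapT => dx.
have [pS Lp mp] := pp.
have x0 : S :\ x != set0 by apply/set0Pn; exists (r p); rewrite !inE eq_sym xr.
have cx : chain (S :\ x) := chain_sub (subD1set S x) cS.
have Zx : Zp (S :\ x) := Zp_sub (subD1set S x) ZS.
have [q [pq gq]] := complete _ cx x0 Zx dx.
have := mS _ gq; apply/negP; rewrite -ltnNge /wt.
have [qSx Lq mq] := pq.
have card_x : #|S :\ x|.+1 = #|S| by rewrite (cardsD1 x S) xS.
have sub1 : [set y in r q |: S :\ x | L y] \subset [set y in S | L y].
  apply/subsetP=> y; rewrite !inE => /andP[/orP[/eqP ey|/andP[_ ->]] Ly //].
  by case/negP: (r_notL Lq); rewrite -ey.
have le1 := subset_leq_card sub1.
have [exp|nxp] := eqVneq x p.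
  have lt1 : #|[set y in r q |: S :\ x | L y]| < #|[set y in S | L y]|.
    apply: proper_card; apply/properP; split=> //; exists p; rewrite !inE ?pS //.
    rewrite -exp eqxx /= orbF; apply/negP=> /andP[/eqP ey Ly].
    by case/negP: (r_notL Lq); rewrite -ey.
  rewrite -addnS leq_add // cardsU1 -card_x.
  by case: (r q \notin _); rewrite ?add1n ?add0n.
have e : q = p.
  apply: (pivot_uniq pq); apply: (pivot_transfer Lp pp).
    by rewrite !inE pS eq_sym nxp.
  by move=> y _; rewrite !inE => /andP[].
subst q; have -> : r p |: S :\ x = S :\ x.
  by apply/setP=> y; rewrite !inE; case: eqP => // ->; rewrite eq_sym xr rS.
rewrite -addSn leq_add ?card_x //; apply: subset_leq_card; apply/subsetP=> y.
by rewrite !inE => /andP[/andP[_ ->] ->].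
Qed.

Lemma matched_step G S p : partial_map G ->
  chain S -> pivot S p -> r p \in S -> ~ vdom G S -> ~ vdom G (S :\ r p) ->
  (exists2 x, x \in S & ~~ L x && (x != r p)) ->
  (forall x, x \in S -> x != r p -> vdom G (S :\ x)) ->
  exists G', [/\ partial_map G', gsub G G' &
    forall S', vdom G' S' <-> vdom G S' \/ S' = S \/ S' = S :\ r p].
Proof.
move=> pG cS pp rS dS dSr [x xS /andP[Lx xr]] dface.
have [pS Lp mp] := pp.
have S0 : S != set0 by apply/set0Pn; exists p.
have [n [z [zinj ez zn]]] := realize_chain le_refl le_trans N cS S0.
have [k ek] : exists k, r p = pos z k by apply/vertsP; rewrite ez.
have lt a b : pos z a != pos z b -> le (pos z a) (pos z b) -> a < b.
  move=> ne ab; rewrite ltnNge; apply/negP=> ba; case/eqP: ne.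
  by apply: le_anti; rewrite ab (pos_homo N z ba).
have kn : 0 < k < n.
  have [i ei] : exists i, p = pos z i by apply/vertsP; rewrite ez.
  have [j ej] : exists j, x = pos z j by apply/vertsP; rewrite ez.
  have ik : i < k.
    apply: lt; rewrite -?ei -?ek; last exact: r_above.
    by apply/negP=> /eqP e; case/negP: (r_notL Lp); rewrite -e.
  have kj : k < j.
    apply: lt; rewrite -?ej -?ek; first by rewrite eq_sym.
    apply: r_least => //; have /orP[//|xp] := cS p x pS xS.
    by case/negP: Lx; apply: L_down xp.
  have := ltn_ord j; lia.
have missP m (s : mono m n) (i : 'I_n.+1) :
    (forall j, s j != i) -> verts (act s z) \subset S :\ pos z i.
  move=> si; apply/subsetP=> y /vertsP[j ->]; rewrite (pos_act N) !inE -ez mem_verts andbT.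
  by apply: contra (si j) => /eqP/zinj ->.
have dhorn m (s : mono m n) : in_horn k s -> gdom G (act s z).
  move=> [i ik si]; apply/vdom_gdom => //.
  have iS : pos z i \in S by rewrite -ez mem_verts.
  have ir : pos z i != r p by rewrite ek; apply: contra ik => /eqP/zinj ->.
  have := dface _ iS ir; apply: vdom_sub => //; last exact: missP.
  - exact: chain_sub (subD1set _ _) cS.
  - exact: verts_neq0.
have hornd m (s : mono m n) : gdom G (act s z) -> in_horn k s.
  move=> d; apply: contrapT => nh.
  have hit i : i != k -> exists j, s j = i.
    move=> ik; apply: contrapT => nj; apply: nh; exists i => // j.
    by apply/eqP=> e; apply: nj; exists j.
  have sub : S :\ r p \subset verts (act s z).
    apply/subsetP=> y; rewrite !inE => /andP[yr].
    rewrite -ez => /vertsP[i ei]; subst y.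
    have [j ej] : exists j, s j = i by apply: hit; apply: contra yr => /eqP->; rewrite ek.
    by rewrite -ej -(pos_act N) mem_verts.
  have S1 : S :\ r p != set0 by apply/set0Pn; exists x; rewrite !inE xr.
  apply: dSr; apply: (vdom_sub pG (verts_chain N (act s z)) S1 sub).
  exact/vdom_gdom.
pose U : graph (Simplex n) A := fun m s a => G m (act s z) a.
have pU : partial_map U.
  split=> [l m t s a Ga|m s a b]; last exact: (partial_fun pG).
  by rewrite /U /= -act_comp; apply: partial_act.
have [w wP] := fill_horn qA kn pU dhorn.
pose G' := adjoin G z w.
have w0P m (s : mono m n) : gdom G (act s z) -> G m (act s z) (act s w).
  by move=> d; have [a Ga] := d; rewrite -(wP m s a (hornd _ _ d) Ga).
have z0P m (s t : mono m n) : act s z = act t z -> s = t \/ gdom G (act s z).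
  move=> e; left; apply: mono_eq; apply: funext => i; apply: zinj.
  by rewrite -!(pos_act N) e.
have pG' := partial_adjoin pG w0P z0P.
exists G'; split=> //; first exact: adjoin_sub.
have dz : gdom G' z by exists w; apply: adjoin_new.
move=> S'; split.
  move=> [m [z' [s1 [s2 [a [Ga|[s e1 e2]]]]]]].
    by left; exists m, z'; do 2!split=> //; exists a.
  have e : S' = verts z' by apply/eqP; rewrite eqEsubset s1 s2.
  have sS : verts (act s z) \subset S by rewrite -ez (verts_act N).
  subst S' z'; have [h|nh] := EM (in_horn k s).
    by left; apply/vdom_gdom => //; apply: dhorn.
  have sub : S :\ r p \subset verts (act s z).
    apply/subsetP=> y; rewrite !inE => /andP[yr].
    rewrite -{1}ez => /vertsP[i ei]; subst y; apply: contrapT => ny; apply: nh.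
    exists i; first by apply: contra yr => /eqP->; rewrite ek.
    move=> j; apply/negP=> /eqP ej; apply: ny; by rewrite -ej -(pos_act N) mem_verts.
  right; have [rv|rv] := boolP (r p \in verts (act s z)); [left|right].
    apply/eqP; rewrite eqEsubset sS; apply/subsetP=> y yS.
    by have [->//|yr] := eqVneq y (r p); apply: (subsetP sub); rewrite !inE yr.
  apply/eqP; rewrite eqEsubset sub andbT; apply/subsetP=> y yv; rewrite !inE (subsetP sS) // andbT.
  by apply: contraNneq rv => <-.
move=> [[m [z' [s1 [s2 [a Ga]]]]]|].
  by exists m, z'; do 2!split=> //; exists a; left.
have dS' : vdom G' S by rewrite -ez; apply/vdom_gdom.
case=> ->//; apply: (vdom_sub pG' cS _ (subD1set _ _)) => //.
by apply/set0Pn; exists x; rewrite !inE xr.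
Qed.

(** Induction on the number of missing chains in [Zp]. A step preserves [matched] because it adds
    two chains that are partners of each other: a missing chain whose partner has just been added
    would itself be one of the two. *)
Theorem extend_matched G : partial_map G -> matched G ->
  exists G', [/\ partial_map G', gsub G G' &
    forall m (z : Z m), Zp (verts z) -> gdom G' z].
Proof.
move=> pG mG.
pose bad H := [set S : {set T} | `[< [/\ chain S, S != set0, Zp S & ~ vdom H S] >]].
move: {2}(#|bad G|) (leqnn #|bad G|) => n; elim: n G pG mG => [|n IHn] G pG mG bn.
  exists G; split=> // m z Zz; apply: contrapT => dz.
  suff : verts z \in bad G by move: bn; rewrite leqn0 cards_eq0 => /eqP->; rewrite inE.
  rewrite inE; apply/asboolP; split=> //; [exact: (verts_chain N)|exact: verts_neq0|].
  by move/(vdom_gdom z pG).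
have [exS|nex] := EM (exists S, [/\ chain S, S != set0, Zp S & ~ vdom G S]); last first.
  exists G; split=> // m z Zz; apply: contrapT => dz; apply: nex; exists (verts z).
  split=> //; [exact: (verts_chain N)|exact: verts_neq0|by move/(vdom_gdom z pG)].
have [S [p [[cS ZS pp rS] dS dSr ex df]]] := matched_minimal pG mG exS.
have [G' [pG' sG dG']] := matched_step pG cS pp rS dS dSr ex df.
have [pS Lp mp] := pp.
have mG' : matched G'.
  move=> S' cS' S0' ZS' dS'.
  have nd : ~ vdom G S' by move=> d; apply: dS'; apply/dG'; left.
  have [q [pq Zq dq exq]] := mG S' cS' S0' ZS' nd.
  have [qS' Lq mq] := pq.
  exists q; split=> // /dG'[//|].
  have rq x : L x -> (x \in S' :\ r q) = (x \in S').
    move=> Lx; rewrite !inE; case: eqP => // e; case/negP: (r_notL Lq); by rewrite -e.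
  have rp x : L x -> (x \in S :\ r p) = (x \in S).
    move=> Lx; rewrite !inE; case: eqP => // e; case/negP: (r_notL Lp); by rewrite -e.
  have same : (forall x, L x -> (x \in S') = (x \in S)) -> q = p.
    move=> h; apply: (pivot_uniq pq); apply: (pivot_transfer Lp pp); first by rewrite h.
    by move=> x Lx; rewrite h.
  move=> [e|e].
    have eqp : q = p by apply: same => x Lx; rewrite -rq // e.
    by move: rS; rewrite -e eqp !inE eqxx.
  have eqp : q = p by apply: same => x Lx; rewrite -rq // e rp.
  apply: dS'; apply/dG'; right; subst q.
  have [rS'|rS'] := boolP (r p \in S'); [left|right].
    by rewrite -(setD1K rS') e setD1K.
  rewrite -e; apply/setP=> y; rewrite !inE; case: eqP => // ->.
  exact: negbTE.
have lt : #|bad G'| < #|bad G|.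
  apply: proper_card; apply/properP; split.
    apply/subsetP=> S'; rewrite !inE => /asboolP[c1 c2 c3 c4]; apply/asboolP; split=> //.
    by move=> d; apply: c4; apply/dG'; left.
  exists S; rewrite !inE; first by apply/asboolP; split=> //; apply/set0Pn; exists p.
  by apply/asboolP=> -[_ _ _ []]; apply/dG'; right; left.
have [|H [pH sH dH]] := IHn G' pG' mG'; first by lia.
by exists H; split=> // l z w Gw; apply: sH; apply: sG.
Qed.

Corollary extend_sieve (G : graph Z A) (Y : {set T} -> Prop) : partial_map G ->
  (forall m (z : Z m), gdom G z <-> Y (verts z)) ->
  (forall S, chain S -> S != set0 -> Zp S -> ~ Y S ->
     (exists2 q, q \in S & L q) /\
     forall p, pivot S p -> [/\ Zp (r p |: S), ~ Y (S :\ r p) &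
       exists2 x, x \in S & ~~ L x && (x != r p)]) ->
  exists G', [/\ partial_map G', gsub G G' &
    forall m (z : Z m), Zp (verts z) -> gdom G' z].
Proof.
move=> pG YE cond; apply: extend_matched => // S cS S0 ZS dS.
have vE S' : chain S' -> S' != set0 -> vdom G S' <-> Y S'.
  move=> cS' S0'; have [k [z [_ <- _]]] := realize_chain le_refl le_trans N cS' S0'.
  by rewrite -(vdom_gdom z pG).
have nY : ~ Y S by move/(vE S cS S0).
have [[q qS Lq] c] := cond S cS S0 ZS nY.
have [p pp] := chain_max le_refl le_trans cS qS Lq.
have [c1 c2 c3] := c p pp; exists p; split=> // d; apply: c2; move: d.
rewrite vE //; first by apply: chain_sub cS; apply: subD1set.
have [pS Lp _] := pp; apply/set0Pn; exists p; rewrite !inE pS andbT.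
by apply/eqP=> e; case/negP: (r_notL Lp); rewrite -e.
Qed.

End Matching.

(** * Products of two simplices and prisms *)

Notation grid d n := (sprod (Simplex d) (Simplex n)).

Section Grid.
Variables d n : nat.
Local Notation T := ('I_d.+1 * 'I_n.+1)%type.

Definition gle : rel T := fun p q => (p.1 <= q.1) && (p.2 <= q.2).
Definition gpos m (z : grid d n m) (i : 'I_m.+1) : T := (z.1 i, z.2 i).

Lemma gle_refl : reflexive gle.
Proof. by move=> p; rewrite /gle !leqnn. Qed.

Lemma gle_anti : antisymmetric gle.
Proof.
move=> [a b] [c e] /andP[/andP[/= h1 h2] /andP[/= h3 h4]].
by congr pair; apply: val_inj => /=; lia.
Qed.

Lemma gle_trans : transitive gle.
Proof.
move=> [a b] [c e] [g h] /andP[/= h1 h2] /andP[/= h3 h4].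
by apply/andP; split => /=; lia.
Qed.

Lemma grid_nerve : is_nerve gle (Z := grid d n) gpos.
Proof.
split=> //.
- move=> m [s t] [s' t'] e; congr pair; apply: mono_eq; apply: funext => i.
    by case: (e i).
  by case: (e i).
- by move=> m [s t] i j ij; rewrite /gle /= !mono_homo.
- move=> m f hf.
  have h1 : {homo (fun i => (f i).1) : i j / i <= j} by move=> i j /hf/andP[].
  have h2 : {homo (fun i => (f i).2) : i j / i <= j} by move=> i j /hf/andP[].
  by exists (Mono h1, Mono h2) => i; rewrite /gpos /=; case: (f i).
Qed.

End Grid.

Definition proper m n (s : mono m n) : Prop := exists i, forall j, s j != i.

Lemma proper_comp l m n (s : mono m n) (t : mono l m) :
  proper s -> proper (mono_comp s t).
Proof. by move=> [i h]; exists i => j; apply: h. Qed.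

(** The pushout-product of a boundary inclusion with an inner horn inclusion is inner anodyne. A
    missing chain meets every first coordinate and every second coordinate except possibly [k]:
    [k.-1] supplies a pivot, [k.+1] a vertex above [r p]. Removing [r p] uncovers nothing, as [p]
    has the same first coordinate and [k] need not be met. *)
Lemma extend_horn_prism (A : sSet) d n (k : 'I_n.+1) (G : graph (grid d n) A) :
  quasi_category A -> 0 < k < n -> partial_map G ->
  (forall m (z : grid d n m), gdom G z <-> proper z.1 \/ in_horn k z.2) ->
  exists G', [/\ partial_map G', gsub G G' & forall m (z : grid d n m), gdom G' z].
Proof.
move=> qA kn pG dG.
pose L (x : 'I_d.+1 * 'I_n.+1) := x.2 < k.
pose r (x : 'I_d.+1 * 'I_n.+1) := (x.1, k).
pose Y (S : {set 'I_d.+1 * 'I_n.+1}) :=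
  (exists i, forall x, x \in S -> x.1 != i) \/
  (exists2 j, j != k & forall x, x \in S -> x.2 != j).
have [|||||m z|S cS S0 _ nY|G' [pG' sG dG']] := @extend_sieve _ _ _ _
  (@gle_refl d n) (@gle_anti d n) (@gle_trans d n) (@grid_nerve d n)
  A qA L r (fun _ => True) _ _ _ _ _ G Y pG.
- by move=> [a b] [c e]; rewrite /L /gle /= => h1 /andP[_ h2]; lia.
- by move=> [a b]; rewrite /L /= ltnn.
- by move=> [a b]; rewrite /L /gle /= => h; rewrite leqnn ltnW.
- by move=> [a b] [c e]; rewrite /L /gle /= -leqNgt => _ -> /andP[-> _].
- by [].
- rewrite dG; split=> [[[i h]|[j jk h]]|[[i h]|[j jk h]]].
  + by left; exists i => x /vertsP[a ->]; apply: h.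
  + by right; exists j => // x /vertsP[a ->]; apply: h.
  + by left; exists i => a; apply: (h (gpos z a)); apply: mem_verts.
  + by right; exists j => // a; apply: (h (gpos z a)); apply: mem_verts.
- have hit1 i : exists2 x, x \in S & x.1 = i.
    apply: contrapT => h; apply: nY; left; exists i => x xS.
    by apply/eqP=> e; apply: h; exists x.
  have hit2 j : j != k -> exists2 x, x \in S & x.2 = j.
    move=> jk; apply: contrapT => h; apply: nY; right; exists j => // x xS.
    by apply/eqP=> e; apply: h; exists x.
  have [k0 kl] := andP kn.
  split.
    have lt : k.-1 < n.+1 by lia.
    have [|x xS ex] := hit2 (Ordinal lt); first by rewrite -val_eqE /=; lia.
    by exists x => //; rewrite /L ex /=; lia.
  move=> p [pS Lp mp]; split=> //.
    move=> [[i h]|[j jk h]].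
      have [x xS ex] := hit1 i; have [e|ne] := eqVneq x (r p).
        have pr : p \in S :\ r p.
          by rewrite !inE pS andbT; apply/eqP=> ep; move: Lp; rewrite /L ep /r /= ltnn.
        by have := h p pr; rewrite -ex e /r /= eqxx.
      by have := h x; rewrite !inE ne xS ex eqxx => /(_ isT).
    have [x xS ex] := hit2 j jk.
    have := h x; rewrite !inE xS ex eqxx andbT => h'.
    suff /h' : x != r p by [].
    by apply: contra jk => /eqP e; rewrite -ex e.
  have lt : k.+1 < n.+1 by lia.
  have nk : Ordinal lt != k by rewrite -val_eqE /=; lia.
  have [x xS ex] := hit2 _ nk; exists x => //.
  rewrite /L ex -leqNgt leqnSn /=; apply: contra nk => /eqP e.
  by rewrite -ex e.
- by exists G'; split=> // m z; apply: dG'.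
Qed.

(** Each bottom vertex [(i,0)] is paired with [(i,1)]. The vertex [(n,0)] must be avoided: its
    partner [(n,1)] is the greatest vertex of the prism, and the corresponding horn would be
    outer. *)
Lemma extend_prism (A : sSet) n (G : graph (grid n 1) A) :
  quasi_category A -> partial_map G ->
  (forall m (z : grid n 1 m),
     gdom G z <-> proper z.1 \/ (forall j, z.2 j != ord0)) ->
  exists G', [/\ partial_map G', gsub G G' &
    forall m (z : grid n 1 m),
      (forall j, z.2 j = ord0 -> z.1 j != ord_max) -> gdom G' z].
Proof.
move=> qA pG dG.
pose L (x : 'I_n.+1 * 'I_2) := x.2 == ord0.
pose r (x : 'I_n.+1 * 'I_2) : 'I_n.+1 * 'I_2 := (x.1, ord_max).
pose Y (S : {set 'I_n.+1 * 'I_2}) :=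
  (exists i, forall x, x \in S -> x.1 != i) \/
  (forall x, x \in S -> x.2 != ord0).
pose Zp (S : {set 'I_n.+1 * 'I_2}) := forall x, x \in S -> x.2 = ord0 -> x.1 != ord_max.
have top (i : 'I_2) : i != ord0 -> i = ord_max.
  by rewrite -val_eqE /= => h; apply: val_inj => /=; have := ltn_ord i; lia.
have [|||||m z|S cS S0 ZS nY|G' [pG' sG dG']] := @extend_sieve _ _ _ _
  (@gle_refl n 1) (@gle_anti n 1) (@gle_trans n 1) (@grid_nerve n 1)
  A qA L r Zp _ _ _ _ _ G Y pG.
- move=> [a b] [c e]; rewrite /L /gle -!val_eqE /= => h1 /andP[_ h2]; lia.
- by move=> [a b].
- by move=> [a b] _; rewrite /gle /= leqnn /= -ltnS ltn_ord.
- by move=> [a b] [c e]; rewrite /L /gle /= => _ /top -> /andP[-> _] /=.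
- by move=> S S' /subsetP sub h x /sub; apply: h.
- rewrite dG; split=> [[[i h]|h]|[[i h]|h]].
  + by left; exists i => x /vertsP[a ->]; apply: h.
  + by right=> x /vertsP[a ->]; apply: h.
  + by left; exists i => a; apply: (h (gpos z a)); apply: mem_verts.
  + by right=> a; apply: (h (gpos z a)); apply: mem_verts.
- have hit1 i : exists2 x, x \in S & x.1 = i.
    apply: contrapT => h; apply: nY; left; exists i => x xS.
    by apply/eqP=> e; apply: h; exists x.
  split.
    apply: contrapT => h; apply: nY; right=> x xS; apply/eqP=> e; apply: h.
    by exists x => //; apply/eqP.
  move=> p [pS Lp mp]; split.
  + by move=> x; rewrite !inE => /orP[/eqP-> //|]; apply: ZS.
  + have pr : p \in S :\ r p.
      by rewrite !inE pS andbT; apply/eqP=> ep; move: Lp; rewrite /L ep.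
    move=> [[i h]|h]; last by have := h p pr; rewrite (eqP Lp) eqxx.
    have [x xS ex] := hit1 i; have [e|ne] := eqVneq x (r p).
      by have := h p pr; rewrite -ex e /r /= eqxx.
    by have := h x; rewrite !inE ne xS ex eqxx => /(_ isT).
  + have [x xS ex] := hit1 ord_max; exists x => //.
    apply/andP; split; first by apply/negP=> /eqP h; have := ZS x xS h; rewrite ex eqxx.
    apply: contra (ZS p pS (eqP Lp)) => /eqP e.
    by rewrite -ex e.
- exists G'; split=> // m z h; apply: dG' => x /vertsP[a ->]; exact: h.
Qed.

Lemma ord_eqE n (i j : 'I_n) : (i == j) = (i == j :> nat).
Proof. by rewrite -val_eqE. Qed.

Lemma coface_compE m n (i : 'I_n.+2) (e : mono m n) j :
  mono_comp (coface i) e j = bump i (e j) :> nat.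
Proof. by []. Qed.

Lemma mono_of_proof m n (h : nat -> nat) :
  {in [pred i | i <= m], forall i, h i <= n} ->
  {homo h : i j / i <= j} ->
  {homo (fun i : 'I_m.+1 => inord (h i) : 'I_n.+1) : i j / i <= j}.
Proof.
move=> hb hh i j ij; rewrite !inordK ?ltnS; first exact: hh.
- by apply: hb; rewrite inE -ltnS.
- by apply: hb; rewrite inE -ltnS.
Qed.

Definition mono_of m n (h : nat -> nat)
    (hb : {in [pred i | i <= m], forall i, h i <= n})
    (hh : {homo h : i j / i <= j}) : mono m n := Mono (mono_of_proof hb hh).

Lemma mono_ofE m n h hb hh (i : 'I_m.+1) : @mono_of m n h hb hh i = h i :> nat.
Proof. by rewrite /= inordK // ltnS; apply: hb; rewrite inE -ltnS. Qed.

Definition spos n m (s : Simplex n m) : 'I_m.+1 -> 'I_n.+1 := mono_fun s.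

Lemma simplex_nerve n : is_nerve (fun i j : 'I_n.+1 => i <= j) (@spos n).
Proof.
split=> //.
- by move=> m s t e; apply: mono_eq; apply: funext.
- by move=> m s i j; apply: mono_homo.
- by move=> m f hf; exists (Mono hf).
Qed.

(** * Spheres joined to a prism by an edge with a left inverse *)

Section Reversal.
Variables (Q : sSet) (qQ : quasi_category Q) (n : nat).
Hypothesis n_gt0 : 0 < n.

Definition trunc_low : mono n.+2 n.
Proof. by apply: (@mono_of _ _ (minn^~ n)) => i j; lia. Defined.
Definition trunc_high : mono n.+2 2.
Proof. by apply: (@mono_of _ _ (subn^~ n)) => [i|i j]; rewrite ?inE; lia. Defined.
Definition collapse2 : mono 2 1.
Proof. by apply: (@mono_of _ _ (minn^~ 1)) => i j; lia. Defined.

Lemma trunc_lowE i : trunc_low i = minn i n :> nat. Proof. exact: mono_ofE. Qed.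
Lemma trunc_highE i : trunc_high i = i - n :> nat. Proof. exact: mono_ofE. Qed.
Lemma collapse2E i : collapse2 i = minn i 1 :> nat. Proof. exact: mono_ofE. Qed.

Definition low m (z : mono m n.+2) := mono_comp trunc_low z.
Definition high m (z : mono m n.+2) := mono_comp trunc_high z.

Lemma lowE m (z : mono m n.+2) j : low z j = minn (z j) n :> nat.
Proof. exact: trunc_lowE. Qed.
Lemma highE m (z : mono m n.+2) j : high z j = z j - n :> nat.
Proof. exact: trunc_highE. Qed.
Lemma collapseE m (z : mono m 2) j : mono_comp collapse2 z j = minn (z j) 1 :> nat.
Proof. exact: collapse2E. Qed.

(** The map from the [n.+2]-simplex to the prism that sends [i <= n] to [(i,0)] and both [n.+1] and
    [n.+2] to [(n,1)]. *)
Definition midlow m (z : mono m n.+2) : grid n 1 m := (low z, mono_comp collapse2 (high z)).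

Variables (U : graph (Simplex n) Q) (V : graph (grid n 1) Q) (a : Q 2) (t : Q 0).
Hypothesis pU : partial_map U.
Hypothesis pV : partial_map V.
Hypothesis Udom : forall m (s : mono m n), gdom U s <-> proper s.
Hypothesis UV : forall m (s : mono m n) x, U s x -> V (s, mono_const m ord0) x.
Hypothesis Vdom : forall m (z : grid n 1 m), proper z.1 -> gdom V z.
Hypothesis Vdom' : forall m (z : grid n 1 m),
  (forall j, z.2 j = ord0 -> z.1 j != ord_max) -> gdom V z.
Hypothesis Ut : U (mono_const 0 ord_max) t.
Hypothesis a1 : face (inord 1) a = degen 1 t.
Hypothesis a2 : V (mono_const 1 ord_max, mono_id 1) (face (inord 2) a).

Let misses m (z : mono m n.+2) k := forall j, z j != k :> nat.
Let small m (z : mono m n.+2) := exists2 i, i < n & misses z i.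

(* The vertices n, n+1, n+2 of Delta^(n+2) lie over t, t' and t, the edges
   between them forming the 2-simplex a. *)
Let reversal_bdry : graph (Simplex n.+2) Q := fun m (z : mono m n.+2) x => small z /\
  [\/ misses z n.+2 /\ V (midlow z) x, misses z n.+1 /\ U (low z) x |
      (forall j, n <= z j) /\ x = act (high z) a].

Let small_comp l m (z : mono m n.+2) (s : mono l m) : small z -> small (mono_comp z s).
Proof. by move=> [i h1 h2]; exists i => // j; apply: h2. Qed.

Let low_proper m (z : mono m n.+2) : small z -> proper (low z).
Proof.
move=> [i h1 h2]; have lt : i < n.+1 by lia.
exists (Ordinal lt) => j; rewrite ord_eqE lowE /=; move: (h2 j); lia.
Qed.

(** The three pieces agree on overlaps because the sphere is the bottom of [V], the edge of [a] in
    [a2] is the edge of the prism from [(n,0)] to [(n,1)], and the edge in [a1] is degenerate at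
    [t]. *)
Lemma partial_reversal_bdry : partial_map reversal_bdry.
Proof.
split=> [l m s z x [sz h]|].
  split; first exact: small_comp.
  case: h => [[h1 h2]|[h1 h2]|[h1 h2]].
  - by apply: Or31; split=> [j|]; [apply: h1|exact: (partial_act pV s h2)].
  - by apply: Or32; split=> [j|]; [apply: h1|exact: (partial_act pU s h2)].
  - by apply: Or33; split=> [j|]; [apply: h1|rewrite h2 act_comp].
have VU m (z : mono m n.+2) x y : misses z n.+2 -> V (midlow z) x ->
    misses z n.+1 -> U (low z) y -> x = y.
  move=> z2 Vx z1 Uy; apply: (partial_fun pV Vx).
  have -> : midlow z = (low z, mono_const m ord0); last exact: UV.
  congr pair; apply: mono_ext => j; rewrite collapseE highE /=.
  move: (z1 j) (z2 j) (ltn_ord (z j)); lia.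
have Va m (z : mono m n.+2) x : misses z n.+2 -> V (midlow z) x ->
    (forall j, n <= z j) -> x = act (high z) a.
  move=> z2 Vx zn; apply: (partial_fun pV Vx).
  have := partial_act pV (mono_comp collapse2 (high z)) a2; rewrite /face act_comp.
  set u := act _ _; set v := act _ _.
  have -> : u = midlow z.
    congr pair; apply: mono_ext => j; rewrite ?lowE //=.
    by move: (zn j); lia.
  have -> // : v = act (high z) a.
  congr act; apply: mono_ext => j.
  rewrite coface_compE /bump inordK // collapseE highE.
  move: (z2 j) (ltn_ord (z j)); lia.
have Ua m (z : mono m n.+2) x : misses z n.+1 -> U (low z) x ->
    (forall j, n <= z j) -> x = act (high z) a.
  move=> z1 Ux zn; apply: (partial_fun pU Ux).
  pose e := mono_comp collapse2 (high z).
  have -> : high z = mono_comp (coface (inord 1)) e.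
    apply: mono_ext => j; rewrite coface_compE /bump inordK // collapseE highE.
    move: (z1 j) (ltn_ord (z j)); lia.
  rewrite -act_comp -/(face _ _) a1 /degen act_comp.
  have := partial_act pU (mono_const m ord0) Ut.
  have -> // : act (mono_const m ord0) (mono_const 0 ord_max : Simplex n 0) = low z.
  apply: mono_ext => j; rewrite lowE /=; move: (zn j); lia.
move=> m z x y [_ h] [_ h']; case: h => [[h1 h2]|[h1 h2]|[h1 h2]];
  case: h' => [[h1' h2']|[h1' h2']|[h1' h2']].
- exact: (partial_fun pV h2).
- exact: VU h1' h2'.
- by rewrite h2'; exact: (Va _ z).
- by symmetry; exact: VU h1 h2.
- exact: (partial_fun pU h2).
- by rewrite h2'; exact: (Ua _ z).
- by rewrite h2; symmetry; exact: (Va _ z).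
- by rewrite h2; symmetry; exact: (Ua _ z).
- by rewrite h2 h2'.
Qed.

Lemma reversal_bdry_dom m (z : mono m n.+2) : gdom reversal_bdry z <->
  small z /\ [\/ misses z n.+2, misses z n.+1 | forall j, n <= z j].
Proof.
split=> [[x [sz h]]|[sz h]].
  by split=> //; case: h => [[h _]|[h _]|[h _]]; [apply: Or31|apply: Or32|apply: Or33].
case: h => h.
- by have [x Vx] := Vdom (z := midlow z) (low_proper sz); exists x; split=> //; apply: Or31.
- have [x Ux] := (Udom (low z)).2 (low_proper sz); by exists x; split=> //; apply: Or32.
- by exists (act (high z) a); split=> //; apply: Or33.
Qed.

(** The vertex [n] is inserted or removed. A missing chain contains [n.+1], [n.+2] and some vertex
    below [n], so the horns are inner; smallness is unaffected, since the omitted vertex lies below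
    [n]. *)
Lemma extend_reversal_bdry : exists G', [/\ partial_map G', gsub reversal_bdry G' &
  forall m (z : mono m n.+2), small z -> gdom G' z].
Proof.
pose T := 'I_n.+3.
have nn : n < n.+3 by lia.
pose L (x : T) := x < n; pose r (x : T) : T := Ordinal nn.
pose Zp (S : {set T}) := exists2 i, i < n & forall x : T, x \in S -> x != i :> nat.
pose Y (S : {set T}) := Zp S /\
  [\/ forall x : T, x \in S -> x != n.+2 :> nat,
      forall x : T, x \in S -> x != n.+1 :> nat |
      forall x : T, x \in S -> n <= x].
have [||||||||m z|S cS S0 ZS nY|G' [pG' sG dG']] := @extend_sieve T (fun i j : T => i <= j)
  (Simplex n.+2) (@spos n.+2) _ _ _ (@simplex_nerve n.+2)
  Q qQ L r Zp _ _ _ _ _ reversal_bdry Y partial_reversal_bdry.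
- by move=> i; apply: leqnn.
- by move=> i j; rewrite -eqn_leq => /eqP; apply: val_inj.
- by move=> j i k; apply: leq_trans.
- by move=> x y; rewrite /L; lia.
- by move=> p; rewrite /L /= ltnn.
- by move=> p; rewrite /L /=; apply: ltnW.
- by move=> p x _; rewrite /L -leqNgt.
- by move=> S S' /subsetP sub [i h1 h2]; exists i => // x /sub; apply: h2.
- have F (P : T -> Prop) :
      (forall x : T, x \in verts (@spos n.+2) z -> P x) <-> (forall j, P (z j)).
    split=> [h j|h x /vertsP[j ->]]; last exact: h.
    by apply: h; apply: (mem_verts (@spos n.+2) z).
  rewrite reversal_bdry_dom /Y /Zp /small.
  split=> -[[i h1 h2] h].
    split; first by exists i => //; apply/(F (fun x => x != i :> nat)).
    by case: h => h; [apply: Or31; apply/(F (fun x => x != n.+2 :> nat))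
      |apply: Or32; apply/(F (fun x => x != n.+1 :> nat))|apply: Or33; apply/(F (fun x => n <= x))].
  split; first by exists i => //; apply/(F (fun x => x != i :> nat)).
  by case: h => h; [apply: Or31; apply/(F (fun x => x != n.+2 :> nat))
    |apply: Or32; apply/(F (fun x => x != n.+1 :> nat))|apply: Or33; apply/(F (fun x => n <= x))].
- have hit k : ~ (forall x : T, x \in S -> x != k :> nat) -> exists2 x : T, x \in S & x = k :> nat.
    move=> h; apply: contrapT => h'; apply: h => x xS; apply/eqP=> e; apply: h'.
    by exists x.
  have [x2 x2S e2] : exists2 x : T, x \in S & x = n.+2 :> nat.
    by apply: hit => h; apply: nY; split=> //; apply: Or31.
  have [x1 x1S e1] : exists2 x : T, x \in S & x = n.+1 :> nat.
    by apply: hit => h; apply: nY; split=> //; apply: Or32.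
  split.
    apply: contrapT => h; apply: nY; split=> //; apply: Or33 => x xS.
    rewrite leqNgt; apply/negP=> xn; by apply: h; exists x.
  move=> p [pS Lp mp]; split.
  + have [i h1 h2] := ZS; exists i => // x; rewrite !inE => /orP[/eqP->/=|]; first by lia.
    exact: h2.
  + have ne k (x : T) : x \in S -> x = k :> nat -> k != n -> x \in S :\ r p.
      by move=> xS e kn; rewrite !inE xS ord_eqE /= e kn.
    move=> [_ [h|h|h]].
    * by have := h x2 (ne _ _ x2S e2 _); rewrite e2; lia.
    * by have := h x1 (ne _ _ x1S e1 _); rewrite e1; lia.
    * have := h p (ne p p pS erefl _); move: Lp; rewrite /L; lia.
  + exists x1 => //; rewrite /L e1 ord_eqE /= e1; lia.
exists G'; split=> // m z [i h1 h2]; apply: dG'; exists i => // x /vertsP[j ->]; exact: h2.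
Qed.

(* An edge t -> t' with a left inverse lets one trade the last vertex t' back
   for t; only horns that are inner occur, because every simplex involved has
   a vertex below t. *)
Lemma fill_reversal : exists w : Q n, forall m (s : mono m n) x, U s x -> x = act s w.
Proof.
have [G' [pG' sG dG']] := extend_reversal_bdry.
have nn : n < n.+2 by lia.
pose k : 'I_n.+2 := Ordinal nn.
have nn3 : n < n.+3 by lia.
(* [D] is the face opposite [n], with vertices [0, ..., n-1, n+1, n+2]. In it [n+1] has position
   [n], so the horn there is inner; the face it lacks has vertices [0, ..., n-1, n+2] and fills the
   sphere. *)
pose D m (z : mono m n.+1) : mono m n.+2 := mono_comp (coface (Ordinal nn3 : 'I_n.+3)) z.
have DE m (z : mono m n.+1) j : D m z j = (n <= z j) + z j :> nat by [].
pose W : graph (Simplex n.+1) Q := fun m (z : mono m n.+1) x =>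
  small (D m z) /\ G' m (D m z) x \/ (forall j, z j <= n) /\ V (midlow (D m z)) x.
have GV m (z : mono m n.+1) x y : small (D m z) -> G' m (D m z) x ->
    (forall j, z j <= n) -> V (midlow (D m z)) y -> x = y.
  move=> sz Gx zn Vy; apply: (partial_fun pG' Gx); apply: sG; split=> //; apply: Or31.
  split=> // j; rewrite DE; move: (zn j); lia.
have pW : partial_map W.
  split=> [l m s z x [[sz Gx]|[h Vx]]|m z x y [[sz Gx]|[h Vx]] [[sz' Gx']|[h' Vx']]].
  - left; split; first exact: (small_comp s sz).
    exact: (partial_act pG' s Gx).
  - by right; split=> [j|]; [apply: h|exact: (partial_act pV s Vx)].
  - exact: (partial_fun pG' Gx).
  - exact: GV h' Vx'.
  - by symmetry; exact: GV h Vx.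
  - exact: (partial_fun pV Vx).
have kn : 0 < k < n.+1 by rewrite /=; lia.
have smallD m (z : mono m n.+1) (i : nat) : i < n -> (forall j, z j != i :> nat) -> small (D m z).
  by move=> lt h; exists i => // j; rewrite DE; move: (h j); lia.
have dW m (z : mono m n.+1) : in_horn k z -> gdom W z.
  move=> [i ik zi]; have [ilt|ige] := ltnP i n.
    have sz : small (D m z) by apply: (smallD _ _ i) => // j; exact: zi.
    by have [x Gx] := dG' m _ sz; exists x; left.
  have zn j : z j <= n.
    move: (ltn_ord (z j)) (ltn_ord i) (zi j) ik; rewrite !ord_eqE /=; lia.
  have [|x Vx] := Vdom' (z := midlow (D m z)); last by exists x; right.
  move=> j /(congr1 (@nat_of_ord _)); rewrite ord_eqE collapseE highE lowE DE /=.
  lia.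
have [w wP] := fill_horn qQ kn pW dW.
exists (act (coface k) w) => m s x Ux.
rewrite act_comp; set z := mono_comp _ s.
have zE j : z j = (n <= s j) + s j :> nat by [].
have [i si] := (Udom s).1 (ex_intro _ x Ux).
have hz : in_horn k z.
  have [ilt|ige] := ltnP i n.
    have lt2 : i < n.+2 by lia.
    exists (Ordinal lt2); first by rewrite ord_eqE /=; lia.
    move=> j; rewrite ord_eqE zE /=; move: (si j); rewrite ord_eqE /=; lia.
  exists ord_max; first by rewrite ord_eqE /=; lia.
  move=> j; rewrite ord_eqE zE /=; move: (si j) (ltn_ord i) (ltn_ord (s j)).
  rewrite ord_eqE /=; lia.
apply: wP => //.
have [ilt|ige] := ltnP i n.
  left; have sz : small (D m z).
    apply: (smallD _ _ i) => // j; rewrite zE; move: (si j); rewrite ord_eqE /=; lia.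
  split=> //; apply: sG; split=> //; apply: Or32; split.
    by move=> j; rewrite DE zE; move: (ltn_ord (s j)); lia.
  have -> // : low (D m z) = s.
  apply: mono_ext => j; rewrite lowE DE zE; move: (ltn_ord (s j)).
  lia.
have sn j : s j < n.
  move: (si j) (ltn_ord i) (ltn_ord (s j)); rewrite ord_eqE /=; lia.
right; split; first by move=> j; rewrite zE; move: (sn j); lia.
have -> : midlow (D m z) = (s, mono_const m ord0); last exact: UV.
congr pair; apply: mono_ext => j; rewrite ?collapseE ?highE ?lowE DE zE /=;
  move: (sn j); lia.
Qed.

End Reversal.

(** * Surjections in the simplex category *)

Lemma not_proper m n (s : mono m n) : ~ proper s -> forall i, exists j, s j = i.
Proof.
move=> ns i; apply: contrapT => nj; apply: ns; exists i => j.
by apply/eqP=> e; apply: nj; exists j.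
Qed.

Lemma proper_factor m n (s : mono m n.+1) (i : 'I_n.+2) :
  (forall j, s j != i) -> exists t, s = mono_comp (coface i) t.
Proof.
move=> si.
have h : {homo (fun j => inord (unbump i (s j)) : 'I_n.+1) : j k / j <= k}.
  have b j : unbump i (s j) < n.+1.
    move: (si j) (ltn_ord (s j)) (ltn_ord i); rewrite ord_eqE /unbump; lia.
  move=> j k jk; rewrite !inordK //; move: (mono_homo s jk); rewrite /unbump; lia.
exists (Mono h); apply: mono_ext => j; rewrite coface_compE /= inordK.
  by rewrite unbumpK // !inE -ord_eqE.
by move: (si j) (ltn_ord (s j)) (ltn_ord i); rewrite ord_eqE /unbump; lia.
Qed.

Lemma mono_endo_id n (e : mono n n) : ~ proper e -> e = mono_id n.
Proof.
move=> /not_proper surj.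
have inj : injective e.
  apply/injectiveP; rewrite /dinjectiveb; apply/card_uniqP.
  rewrite size_map -cardE; apply: eq_card => i; rewrite !inE.
  by have [j <-] := surj i; apply/imageP; exists j.
have st (i j : 'I_n.+1) : i < j -> e i < e j.
  move=> ij; have := mono_homo e (ltnW ij); rewrite leq_eqVlt => /orP[|//].
  by rewrite -ord_eqE => /eqP/inj e0; rewrite e0 ltnn in ij.
have up (k : nat) (i : 'I_n.+1) : i = k :> nat -> k <= e i.
  elim: k i => [//|k IH] i ei.
  have lt : k < n.+1 by move: (ltn_ord i); lia.
  by have := IH (Ordinal lt) erefl; have := st (Ordinal lt) i; rewrite /= ei; lia.
have dn (k : nat) (i : 'I_n.+1) : i + k = n -> e i + k <= n.
  elim: k i => [i _|k IH i ei]; first by move: (ltn_ord (e i)); lia.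
  have lt : i.+1 < n.+1 by lia.
  by have := IH (Ordinal lt); have := st i (Ordinal lt); rewrite /=; lia.
apply: mono_ext => i /=; move: (up i i erefl) (dn (n - i) i) (ltn_ord i); lia.
Qed.

(** Any choice of preimages under a monotone surjection is monotone, so the section may be
    prescribed at one point. *)
Lemma section_through m n (s : mono m n) j : ~ proper s ->
  exists d : mono n m, mono_comp s d = mono_id n /\ d (s j) = j.
Proof.
move=> /not_proper surj.
pose d i : 'I_m.+1 := if i == s j then j else sval (cid (surj i)).
have sd i : s (d i) = i by rewrite /d; case: eqP => [->//|_]; case: cid.
have h : {homo d : i k / i <= k}.
  move=> i k; rewrite leq_eqVlt => /orP[|ik]; first by rewrite -ord_eqE => /eqP->.
  rewrite leqNgt; apply/negP=> /ltnW dk; have := mono_homo s dk; rewrite !sd; lia.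
exists (Mono h); split; last by rewrite /= /d eqxx.
by apply: mono_eq; apply: funext => i; apply: sd.
Qed.

(** * Skeletal extension *)

Section Skeletal.
Variables (Z W : sSet) (R G0 : graph Z W).
Arguments R : clear implicits.
Arguments G0 : clear implicits.
Hypothesis R_act : forall m n (s : mono m n) z w, R n z w -> R m (act s z) (act s w).
Hypothesis pG0 : partial_map G0.
Hypothesis G0R : gsub G0 R.

(** [R] constrains the values of the lift and [G0] prescribes some of them; a sphere has to respect
    both. *)
Definition sphere_over n (z : Z n) (U : graph (Simplex n) W) : Prop :=
  [/\ partial_map U, forall m (s : mono m n), gdom U s <-> proper s,
      forall m s w, U m s w -> R m (act s z) w &
      forall m s w, proper s -> G0 m (act s z) w -> U m s w].

Hypothesis fill : forall n (z : Z n) U, ~ gdom G0 z -> sphere_over z U ->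
  exists2 w, R n z w & forall m (s : mono m n) x, U m s x -> x = act s w.

Definition partial_lift (G : graph Z W) := [/\ partial_map G, gsub G0 G & gsub G R].

Lemma maximal_lift : exists2 G, partial_lift G &
  forall H, partial_lift H -> gsub G H -> gsub H G.
Proof.
pose T := {G | partial_lift G}.
pose rT (G H : T) := `[< gsub (sval G) (sval H) >].
have L0 : partial_lift G0 by split=> // n z w.
have [|||G mG] := @classical_sets.ZL_preorder T (exist _ G0 L0) rT.
- by move=> G; apply/asboolP.
- by move=> H G K /asboolP h1 /asboolP h2; apply/asboolP=> n z w /h1/h2.
- move=> A tot.
  pose G n z w := G0 n z w \/ exists2 H : T, A H & sval H n z w.
  have LG : partial_lift G.
    split=> [||n z w]; last 1 first.
    - by move=> [/G0R//|[H _]]; have [_ _ h] := svalP H; apply: h.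
    - split=> [m n s z w|n z w w'].
        move=> [h|[H AH h]]; first by left; apply: (partial_act pG0).
        by right; exists H => //; have [pH _ _] := svalP H; apply: (partial_act pH).
      move=> [h|[H AH h]] [h'|[H' AH' h']].
      + exact: (partial_fun pG0 h).
      + have [pH sH _] := svalP H'; exact: (partial_fun pH (sH _ _ _ h)).
      + have [pH sH _] := svalP H; exact: (partial_fun pH h (sH _ _ _ h')).
      + have [pH _ _] := svalP H; have [pH' _ _] := svalP H'.
        have [/asboolP HH|/asboolP HH] := tot H H' AH AH'.
          exact: (partial_fun pH' (HH _ _ _ h)).
        exact: (partial_fun pH h (HH _ _ _ h')).
    - by move=> n z w; left.
  by exists (exist _ G LG) => H AH; apply/asboolP=> n z w h; right; exists H.
exists (sval G); first exact: svalP.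
move=> H LH GH; have := mG (exist _ H LH); rewrite /rT /= => h.
by apply/asboolP; apply: h; apply/asboolP.
Qed.

(** A maximal partial lift is total: a simplex of least dimension outside its domain has all its
    proper faces in the domain, so it can be filled and adjoined, against maximality. *)
Theorem skeletal_extension :
  exists h : smap Z W, (forall n z, R n z (h n z)) /\ (forall n z w, G0 n z w -> h n z = w).
Proof.
have [G [pG sG GR] mG] := maximal_lift.
suff dG n (z : Z n) : gdom G z.
  have [h hP] := partial_total pG dG; exists h; split=> [n z|n z w /sG Gw].
    by apply: GR; apply: hP.
  exact: (partial_fun pG) (hP _ _) Gw.
elim/ltn_ind: n z => n IH z; apply: contrapT => nz.
have dprop m (s : mono m n) : proper s -> gdom G (act s z).
  move=> [i si]; case: n => [|n] in IH z nz s i si *.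
    by have := si ord0; rewrite !ord1.
  have [t ->] := proper_factor si; rewrite -act_comp.
  by apply: gdom_act => //; apply: IH.
pose U : graph (Simplex n) W := fun m (s : mono m n) w => proper s /\ G m (act s z) w.
have SU : sphere_over z U.
  split.
  - split=> [l m t s w [ps Gw]|m s w w' [_ Gw] [_ Gw']]; last exact: (partial_fun pG Gw).
    by split; [exact: proper_comp|rewrite /= -act_comp; exact: (partial_act pG)].
  - move=> m s; split=> [[w []//]|ps]; have [w Gw] := dprop m s ps; by exists w.
  - by move=> m s w [_ /GR].
  - by move=> m s w ps /sG.
have [|w Rw wU] := fill _ SU.
  by move=> [w /sG Gw]; apply: nz; exists w.
have w0P m (s : mono m n) : gdom G (act s z) -> G m (act s z) (act s w).
  move=> dz; have [ps|ns] := EM (proper s).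
    by have [x Gx] := dz; rewrite -(wU m s x).
  have [d [sd _]] := section_through ord0 ns; case: nz.
  by have := gdom_act d pG dz; rewrite act_comp sd act_id.
(* An Eilenberg-Zilber argument. With [d] a section of [s] through [j], [z] is its own restriction
   along the endomorphism [t d]; this is not proper, or [z] would be in the domain, hence it is the
   identity, and [t] agrees with [s] at [j]. *)
have z0P m (s t : mono m n) : act s z = act t z -> s = t \/ gdom G (act s z).
  move=> e; have [ps|ns] := EM (proper s); first by right; apply: dprop.
  left; apply: mono_eq; apply: funext => j.
  have [d [sd dj]] := section_through j ns.
  have ez : z = act (mono_comp t d) z by rewrite -act_comp -e act_comp sd act_id.
  have [p|np] := EM (proper (mono_comp t d)).
    by case: nz; rewrite ez; apply: dprop.
  have := congr1 (fun f : mono n n => f (s j)) (mono_endo_id np).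
  by rewrite /= dj.
apply: nz; exists w; apply: (mG (adjoin G z w)) (adjoin_new G z w); last exact: adjoin_sub.
split.
- exact: partial_adjoin.
- by move=> m x y /sG; left.
- by move=> m x y [/GR//|[s -> ->]]; apply: R_act.
Qed.

End Skeletal.

(** * Horns in internal homs *)

Lemma smap_eq (X Y : sSet) (f g : smap X Y) : (forall n x, f n x = g n x) -> f = g.
Proof.
case: f g => [f hf] [g hg] /= e.
have {}e : f = g by do 2![apply: functional_extensionality_dep => ?]; apply: e.
by case: _ / e hg => hg; rewrite (Prop_irrelevance hf hg).
Qed.

Lemma smap_act (X Y : sSet) (F : smap X Y) m n (s : mono m n) x :
  F m (act s x) = act s (F n x).
Proof. by rewrite (smap_nat F erefl). Qed.

Lemma hom_simp_proof (X A : sSet) n (p : forall m, X m -> mono m n -> A m) :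
  (forall l m (s : mono l m) x t, act s (p m x t) = p l (act s x) (mono_comp t s)) ->
  forall l m (s : mono l m) x y (t : mono m n) (u : mono l n),
    act s x = y -> mono_comp t s = u -> act s (p m x t) = p l y u.
Proof. by move=> h l m s x y t u <- <-. Qed.

Definition hom_of (X A : sSet) n (p : forall m, X m -> mono m n -> A m)
    (hp : forall l m (s : mono l m) x t, act s (p m x t) = p l (act s x) (mono_comp t s)) :
  ihom X A n := HomSimp (hom_simp_proof hp).

Section HornExtension.
Variables (X A : sSet) (qA : quasi_category A) (n : nat) (k : 'I_n.+1).
Hypothesis kn : 0 < k < n.
Variable u : smap (horn k) (ihom X A).
Variable G0 : graph X (ihom (Simplex n) A).

(** Transposed, [u] sends a simplex of [X] to a family of maps from the horn to [A]; [w] is required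
    to extend this family over the whole simplex. *)
Definition horn_over : graph X (ihom (Simplex n) A) := fun m x (w : hom_simp (Simplex n) A m) =>
  forall l (t : horn k l) (s : mono l m),
    w l (sval t) s = u l t l (act s x) (mono_id l).

Hypothesis pG0 : partial_map G0.
Hypothesis G0_over : gsub G0 horn_over.

Lemma fill_horn_over d (x : X d) (U : graph (Simplex d) (ihom (Simplex n) A)) :
  sphere_over horn_over G0 x U ->
  exists2 w : ihom (Simplex n) A d, horn_over x w &
    forall m (s : mono m d) y, U m s y -> y = act s w.
Proof.
move=> [pU dU Uover _].
pose G : graph (grid d n) A := fun l z a =>
  (exists2 w, U l z.1 w & a = w l z.2 (mono_id l)) \/
  (exists h : in_horn k z.2, a = u l (exist _ z.2 h) l (act z.1 x) (mono_id l)).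
have pG : partial_map G.
  split=> [l m r [s t] a [[w Uw ->]|[h ->]]|l [s t] a b [[w Uw ->]|[h ->]] [[w' Uw' ->]|[h' ->]]].
  - left; exists (act r w); first exact: (partial_act pU r Uw).
    exact: hom_simp_nat.
  - pose th : horn k m := exist _ t h.
    right; exists (in_horn_comp r (svalP th)); have e := smap_nat u (erefl (act r th)).
    apply: etrans (congr1 (fun w : hom_simp X A l => w l (act (mono_comp s r) x) (mono_id l)) e).
    by apply: hom_simp_nat => //; rewrite act_comp.
  - by rewrite (partial_fun pU Uw Uw').
  - by have := Uover _ _ _ Uw _ (exist _ t h') (mono_id l); rewrite act_id /= => ->.
  - by have := Uover _ _ _ Uw' _ (exist _ t h) (mono_id l); rewrite act_id /= => ->.
  - by rewrite (Prop_irrelevance h h').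
have dG l (z : grid d n l) : gdom G z <-> proper z.1 \/ in_horn k z.2.
  split=> [[a [[w Uw _]|[h _]]]|[h|h]].
  - by left; apply/dU; exists w.
  - by right.
  - by have [w Uw] := (dU _ z.1).2 h; exists (w l z.2 (mono_id l)); left; exists w.
  - by eexists; right; exists h.
have [G' [pG' sG dG']] := extend_horn_prism qA kn pG dG.
have [h hP] := partial_total pG' dG'.
have hw l m (s : mono l m) (t : Simplex n m) (r : mono m d) :
    act s (h m (r, t)) = h l (mono_comp r s, act s t) by apply: smap_nat.
pose w := hom_of hw.
exists w.
  move=> l t s; apply: (partial_fun pG' (hP _ _)); apply: sG; right.
  by case: t => t ht; exists ht.
move=> m s y Uy; apply: hom_simp_eq => l t r.
apply: (partial_fun pG' _ (hP _ _)); apply: sG; left; exists (act r y).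
  exact: (partial_act pU r Uy).
by [].
Qed.

Theorem extend_horn : exists v : smap (Simplex n) (ihom X A),
  v \c horn_incl k = u /\
  forall m x w, G0 x w -> forall l (t : mono l n) (s : mono l m),
    v l t l (act s x) (mono_id l) = w l t s.
Proof.
have hR l m (s : mono l m) x w : horn_over x w -> horn_over (act s x) (act s w).
  by move=> h p t r; rewrite act_comp -h.
have [h [h1 h2]] := skeletal_extension hR pG0 G0_over
  (fun d x U _ => @fill_horn_over d x U).
have hv l (t : mono l n) p m (s : mono p m) x (r : mono m l) :
    act s (h m x m (mono_comp t r) (mono_id m)) =
    h p (act s x) p (mono_comp t (mono_comp r s)) (mono_id p).
  by rewrite -(smap_nat h erefl); apply: hom_simp_nat.
pose v l (t : mono l n) : ihom X A l := hom_of (hv l t).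
have vact m l (s : mono m l) (t : mono l n) t' : mono_comp t s = t' -> act s (v l t) = v m t'.
  by move=> <-; apply: hom_simp_eq.
exists (@SMap (Simplex n) (ihom X A) v vact); split.
  apply: smap_eq => l t; apply: hom_simp_eq => m x s /=.
  have := h1 m x m (act s t) (mono_id m); rewrite act_id /= => ->.
  by rewrite -(smap_nat u (erefl (act s t))).
move=> m x w Gw l t s /=; have -> : mono_comp t (mono_id l) = t by [].
by rewrite -(smap_nat h (erefl (act s x))) (h2 _ _ _ Gw).
Qed.

End HornExtension.

Corollary ihom_quasi_category (X A : sSet) : quasi_category A -> quasi_category (ihom X A).
Proof.
move=> qA n k _ kn u.
pose G0 : graph X (ihom (Simplex n) A) := fun _ _ _ => False.
have [|//|v [vu _]] := @extend_horn X A qA n k kn u G0; first by split.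
by exists v.
Qed.

(** * Horns given by their faces *)

Lemma coface_square l n (i j : 'I_n.+3) (s t : mono l n.+1) : i < j ->
  mono_comp (coface i) s = mono_comp (coface j) t ->
  exists r : mono l n, s = mono_comp (coface (inord j.-1)) r /\
                       t = mono_comp (coface (inord i)) r.
Proof.
move=> ij e.
have ex x : bump i (s x) = bump j (t x).
  by have := congr1 (fun f : mono l n.+2 => f x : nat) e.
have jj : (inord j.-1 : 'I_n.+2) = j.-1 :> nat by rewrite inordK //; move: (ltn_ord j); lia.
have ii : (inord i : 'I_n.+2) = i :> nat by rewrite inordK //; move: (ltn_ord j); lia.
have [x|r er] := @proper_factor _ _ s (inord j.-1).
  by move: (ex x); rewrite ord_eqE jj /bump; lia.
exists r; split=> //; apply: mono_ext => x; move: (ex x).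
by rewrite er !coface_compE ii jj /bump; lia.
Qed.

Section HornOfFaces.
Variables (Y : sSet) (n : nat) (k : 'I_n.+3) (y : 'I_n.+3 -> Y n.+1).
Hypothesis compat : forall i j, i != k -> j != k -> i < j ->
  face (inord j.-1) (y i) = face (inord i) (y j).

Let compat_gen l i j (s t : mono l n.+1) : i != k -> j != k ->
  mono_comp (coface i) s = mono_comp (coface j) t -> act s (y i) = act t (y j).
Proof.
move=> ik jk; case: (ltngtP i j) => ij e.
- have [r [-> ->]] := coface_square ij e; by rewrite -!act_comp -!/(face _ _) compat.
- have [r [-> ->]] := coface_square ij (esym e); by rewrite -!act_comp -!/(face _ _) compat.
- have ei : i = j by apply: val_inj.
  subst j; congr act; apply: mono_ext => x.
  have := congr1 (fun f : mono l n.+2 => f x : nat) e; rewrite !coface_compE /bump; lia.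
Qed.

(** Two faces of a simplex meet in a face of codimension two by [coface_square], so the identities
    in [compat] already force agreement on all overlaps. *)
Lemma horn_of_faces : exists u : smap (horn k) Y,
  forall m (s : horn k m) i t, i != k -> sval s = mono_comp (coface i) t ->
    u m s = act t (y i).
Proof.
pose U l (s : horn k l) (x : Y l) := exists i, exists2 t : mono l n.+1,
  i != k /\ sval s = mono_comp (coface i) t & x = act t (y i).
have Uex l (s : horn k l) : exists x, U l s x.
  case: s => s [i ik si]; have [t e] := proper_factor si.
  by exists (act t (y i)), i, t.
have Uuniq l (s : horn k l) x x' : U l s x -> U l s x' -> x = x'.
  move=> [i [t [ik e] ->]] [j [t' [jk e'] ->]].
  by apply: compat_gen => //; rewrite -e -e'.
pose u l (s : horn k l) := sval (cid (Uex l s)).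
have uP l (s : horn k l) : U l s (u l s) by rewrite /u; case: cid.
have nat m l (t : mono m l) (s : horn k l) z : act t s = z -> act t (u l s) = u m z.
  move=> <-; apply: Uuniq (uP _ _).
  have [i [r [ik e] ->]] := uP l s; exists i, (mono_comp r t); last exact: act_comp.
  by split=> //=; rewrite e.
exists (SMap nat) => m s i t ik e; apply: Uuniq (uP _ _) _.
by exists i, t.
Qed.

End HornOfFaces.

Lemma face_of_filler (Y : sSet) n (k i : 'I_n.+2) (u : smap (horn k) Y)
    (v : smap (Simplex n.+1) Y) y : i != k -> v \c horn_incl k = u ->
  (forall m (s : horn k m) t, sval s = mono_comp (coface i) t -> u m s = act t y) ->
  face i (v n.+1 (mono_id n.+1)) = y.
Proof.
move=> ik <- uE.
have hi : in_horn k (coface i).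
  by exists i => // j; rewrite ord_eqE eq_sym neq_bump.
rewrite /face (smap_nat v erefl).
by have /= := uE n (exist _ _ hi) (mono_id n) erefl; rewrite act_id.
Qed.

Lemma fill_faces (Y : sSet) n (k : 'I_n.+3) (y : 'I_n.+3 -> Y n.+1) :
  quasi_category Y -> 0 < k < n.+2 ->
  (forall i j : 'I_n.+3, i != k -> j != k -> i < j ->
     face (inord j.-1) (y i) = face (inord i) (y j)) ->
  exists w : Y n.+2, forall i, i != k -> face i w = y i.
Proof.
move=> qY kn c; have [u uE] := horn_of_faces c.
have [v vu] := qY _ k isT kn u.
exists (v _ (mono_id _)) => i ik; apply: (face_of_filler ik vu) => m s t e.
exact: uE.
Qed.

Lemma inord0 n : inord 0 = ord0 :> 'I_n.+1.
Proof. by apply: val_inj; rewrite /= inordK. Qed.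

Lemma face_face (Y : sSet) n (i j : 'I_n.+3) (w : Y n.+2) : i < j ->
  face (inord j.-1) (face i w) = face (inord i) (face j w).
Proof.
move=> ij; rewrite /face !act_comp; congr act; apply: mono_ext => x.
rewrite !coface_compE /= !inordK; move: (ltn_ord j); rewrite /bump; lia.
Qed.

(** * Homotopy categories of quasi-categories *)

Definition codegen n (k : 'I_n.+1) : mono n.+1 n.
Proof.
apply: (@mono_of _ _ (fun i => i - (k < i))) => [i|i j]; rewrite ?inE;
  move: (ltn_ord k); lia.
Defined.

Lemma codegenE n (k : 'I_n.+1) i : codegen k i = i - (k < i) :> nat.
Proof. exact: mono_ofE. Qed.

Lemma codegen_compE l n (k : 'I_n.+1) (s : mono l n.+1) i :
  mono_comp (codegen k) s i = s i - (k < s i) :> nat.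
Proof. exact: codegenE. Qed.

Definition degen_at (Y : sSet) n (k : 'I_n.+1) (x : Y n) : Y n.+1 := act (codegen k) x.

Lemma face_degen_low (Y : sSet) n (k : 'I_n.+1) (i : 'I_n.+2) (x : Y n) :
  i = k :> nat -> face i (degen_at k x) = x.
Proof.
move=> e; rewrite /face /degen_at act_comp -[RHS]act_id; congr act; apply: mono_ext => j.
rewrite codegen_compE /= /bump; lia.
Qed.

Lemma face_degen_high (Y : sSet) n (k : 'I_n.+1) (i : 'I_n.+2) (x : Y n) :
  i = k.+1 :> nat -> face i (degen_at k x) = x.
Proof.
move=> e; rewrite /face /degen_at act_comp -[RHS]act_id; congr act; apply: mono_ext => j.
rewrite codegen_compE /= /bump; lia.
Qed.

Lemma act_degen (Y : sSet) m n (s : mono m n) (x : Y 0) : act s (degen n x) = degen m x.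
Proof. by rewrite /degen act_comp; congr act; apply: mono_to0. Qed.

Lemma degen0 (Y : sSet) (x : Y 0) : degen 0 x = x.
Proof. by rewrite /degen -[RHS]act_id; congr act; apply: mono_to0. Qed.

Lemma smap_degen (X Y : sSet) (f : smap X Y) m (x : X 0) : f m (degen m x) = degen m (f 0 x).
Proof. by rewrite /degen (smap_nat f erefl). Qed.

Section HomotopyRelation.
Variables (Y : sSet) (qY : quasi_category Y).

(** It expresses that [h] is a composite of [f] followed by [g]. *)
Definition tri (f g h : Y 1) : Prop :=
  exists w : Y 2, [/\ face (inord 2) w = f, face (inord 0) w = g & face (inord 1) w = h].

Lemma tri_ends f g h : tri f g h -> [/\ tgt f = src g, src h = src f & tgt h = tgt g].
Proof.
move=> [w [<- <- <-]]; rewrite /src /tgt -!inord0.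
have e (i j : 'I_3) (ij : i < j) := @face_face Y 0 i j w ij.
split.
- by have := e (inord 0) (inord 2); rewrite !inordK // => ->.
- by have := e (inord 1) (inord 2); rewrite !inordK // => ->.
- by have := e (inord 0) (inord 1); rewrite !inordK // => ->.
Qed.

Lemma tri_exists f g : tgt f = src g -> exists h, tri f g h.
Proof.
move=> e; have [||w wE] := @fill_faces Y 0 (inord 1) (fun i => if i == 0 :> nat then g else f) qY.
- by rewrite inordK.
- move=> [[|[|[|i]]] // li] [[|[|[|j]]] // lj] /=; rewrite ?ord_eqE ?inordK //= => _ _ _.
  by rewrite inord0 -/(tgt f) e.
exists (face (inord 1) w), w; split=> //; rewrite wE ?inordK //; by rewrite ord_eqE !inordK.
Qed.

(** A filler of the 3-dimensional horn at vertex 1; its left counterpart fills the horn at vertex 2.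
    The entry of [y] at the horn's own index is a dummy. *)
Lemma tri_assoc_right f g h a b c : tri f g a -> tri g h b -> tri f b c -> tri a h c.
Proof.
move=> [w3 [e32 e30 e31]] [w0 [e02 e00 e01]] [w2 [e22 e20 e21]].
pose y (i : 'I_4) := nth w0 [:: w0; w0; w2; w3] i.
have [||w wE] := @fill_faces Y 1 (inord 1) y qY.
- by rewrite inordK.
- move=> [[|[|[|[|i]]]] // li] [[|[|[|[|j]]]] // lj]; rewrite ?ord_eqE ?inordK //= => _ _ _;
  by rewrite /y /=; congruence.
exists (face (inord 1) w).
have F (i j : 'I_4) (ij : i < j) := face_face w ij.
have w0E : face (inord 0) w = w0 by rewrite wE ?ord_eqE ?inordK // /y inordK.
have w2E : face (inord 2) w = w2 by rewrite wE ?ord_eqE ?inordK // /y inordK.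
have w3E : face (inord 3) w = w3 by rewrite wE ?ord_eqE ?inordK // /y inordK.
have := F (inord 0) (inord 1); have := F (inord 1) (inord 2); have := F (inord 1) (inord 3).
rewrite !inordK //= w0E w2E w3E => -> // -> // <- //; split=> //.
Qed.

Lemma tri_assoc_left f g h a b c : tri f g a -> tri g h b -> tri a h c -> tri f b c.
Proof.
move=> [w3 [e32 e30 e31]] [w0 [e02 e00 e01]] [w1 [e12 e10 e11]].
pose y (i : 'I_4) := nth w0 [:: w0; w1; w1; w3] i.
have [||w wE] := @fill_faces Y 1 (inord 2) y qY.
- by rewrite inordK.
- move=> [[|[|[|[|i]]]] // li] [[|[|[|[|j]]]] // lj]; rewrite ?ord_eqE ?inordK //= => _ _ _;
  by rewrite /y /=; congruence.
exists (face (inord 2) w).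
have F (i j : 'I_4) (ij : i < j) := face_face w ij.
have w0E : face (inord 0) w = w0 by rewrite wE ?ord_eqE ?inordK // /y inordK.
have w1E : face (inord 1) w = w1 by rewrite wE ?ord_eqE ?inordK // /y inordK.
have w3E : face (inord 3) w = w3 by rewrite wE ?ord_eqE ?inordK // /y inordK.
have := F (inord 0) (inord 2); have := F (inord 1) (inord 2); have := F (inord 2) (inord 3).
rewrite !inordK //= w0E w1E w3E => -> // <- // <- //; split=> //.
Qed.

Lemma src_degen x : src (degen 1 x : Y 1) = x.
Proof. by rewrite /src /face act_degen degen0. Qed.

Lemma tgt_degen x : tgt (degen 1 x : Y 1) = x.
Proof. by rewrite /tgt /face act_degen degen0. Qed.

Lemma tri_idr f : tri f (degen 1 (tgt f)) f.
Proof.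
exists (degen_at (inord 1) f); split.
- by rewrite face_degen_high ?inordK.
- rewrite /degen /tgt /face /degen_at !act_comp; congr act; apply: mono_ext => j.
  by rewrite codegen_compE /= !inordK //= /bump /=; case: j => [[|[|]]].
- by rewrite face_degen_low ?inordK.
Qed.

Lemma tri_idl f : tri (degen 1 (src f)) f f.
Proof.
exists (degen_at (inord 0) f); split.
- rewrite /degen /src /face /degen_at !act_comp; congr act; apply: mono_ext => j.
  by rewrite codegen_compE /= !inordK //= /bump /=; case: j => [[|[|]]].
- by rewrite face_degen_low ?inordK.
- by rewrite face_degen_high ?inordK.
Qed.

Definition homotopic (e e' : Y 1) : Prop := tri e (degen 1 (tgt e)) e'.

Lemma homotopic_ends e e' : homotopic e e' -> src e' = src e /\ tgt e' = tgt e.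
Proof. by move=> /tri_ends[_ -> ->]; rewrite tgt_degen. Qed.

Lemma homotopic_refl e : homotopic e e. Proof. exact: tri_idr. Qed.

Lemma homotopic_euclid e e' e'' : homotopic e e' -> homotopic e e'' -> homotopic e' e''.
Proof.
move=> h h'; rewrite /homotopic (homotopic_ends h).2.
have idd : tri (degen 1 (tgt e)) (degen 1 (tgt e)) (degen 1 (tgt e) : Y 1).
  by have := tri_idr (degen 1 (tgt e)); rewrite tgt_degen.
exact: tri_assoc_right h idd h'.
Qed.

Lemma homotopic_sym e e' : homotopic e e' -> homotopic e' e.
Proof. by move=> h; apply: homotopic_euclid h (homotopic_refl e). Qed.

Lemma homotopic_trans e e' e'' : homotopic e e' -> homotopic e' e'' -> homotopic e e''.
Proof. by move=> /homotopic_sym; apply: homotopic_euclid. Qed.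

Lemma tri_homotopic f g h h' : tri f g h -> homotopic h h' -> tri f g h'.
Proof.
move=> t hh; have [_ _ e] := tri_ends t; rewrite /homotopic e in hh.
exact: tri_assoc_left t (tri_idr g) hh.
Qed.

Lemma tri_uniq f g h h' : tri f g h -> tri f g h' -> homotopic h h'.
Proof.
move=> t t'; have [_ _ e] := tri_ends t; rewrite /homotopic e.
exact: tri_assoc_right t (tri_idr g) t'.
Qed.

Lemma tri_homotopic_left f f' g h : homotopic f f' -> tri f g h -> tri f' g h.
Proof.
move=> hf t; have [e _ _] := tri_ends t; rewrite /homotopic e in hf.
exact: tri_assoc_right hf (tri_idl g) t.
Qed.

Lemma tri_homotopic_right f g g' h : homotopic g g' -> tri f g h -> tri f g' h.
Proof.
move=> hg t; apply: (tri_assoc_left t hg); have [_ _ <-] := tri_ends t.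
exact: homotopic_refl.
Qed.

(** Interprets a word by the edges that are composites of its letters. Invariance of this set under
    [wrel] is what recovers an actual 2-simplex from an equality in the presented category. *)
Fixpoint represents x y (u : word x y) : Y 1 -> Prop :=
  match u with
  | w_gen _ _ e => homotopic (sval e)
  | w_id x => homotopic (degen 1 x)
  | w_comp _ _ _ u v => fun h => exists f g, [/\ represents v f, represents u g & tri f g h]
  end.

Lemma represents_ends x y (u : word x y) h : represents u h -> src h = x /\ tgt h = y.
Proof.
elim: u h => {x y} [x y [e [/= <- <-]]|x|x y z u IHu v IHv] h /=.
- by move/homotopic_ends.
- by move/homotopic_ends; rewrite src_degen tgt_degen.
- move=> [f [g [/IHv[e1 _] /IHu[_ e2] /tri_ends[_ -> ->]]]]; by rewrite e1 e2.
Qed.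

Lemma represents_homotopic x y (u : word x y) h h' :
  represents u h -> homotopic h h' -> represents u h'.
Proof.
elim: u h h' => {x y} [x y e|x|x y z u IHu v IHv] h h' /=; try exact: homotopic_trans.
move=> [f [g [h1 h2 t]]] hh; exists f, g; split=> //; exact: tri_homotopic hh.
Qed.

Lemma represents_wrel x y (u v : word x y) : wrel u v ->
  forall h, represents u h <-> represents v h.
Proof.
elim=> {x y u v} [x y u|x y u v _ IH|x y u v w _ IH1 _ IH2|x y z u u' v v' _ IHu _ IHv
    |x y z t u v w|x y u|x y u|x e he|x y z w f g h e2 e0 e1] k.
- by [].
- by rewrite IH.
- by rewrite IH1.
- by split=> -[f [g [h1 h2 tr]]]; exists f, g; split=> //; apply/IHu || apply/IHv.
- split=> /= [[f [g [[f' [g' [h1 h2 t1]]] h3 t2]]]|[f [g [h1 [f' [g' [h2 h3 t1]]] t2]]]].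
    have [|b tb] := @tri_exists g' g.
      by rewrite (represents_ends h2).2 (represents_ends h3).1.
    exists f', b; split=> //; first by exists g', g.
    exact: tri_assoc_left t1 tb t2.
  have [|a ta] := @tri_exists f f'.
    by rewrite (represents_ends h1).2 (represents_ends h2).1.
  exists a, g'; split=> //; first by exists f, f'.
  exact: tri_assoc_right ta t1 t2.
- split=> /= [[f [g [h1 h2 t]]]|h1].
    apply: represents_homotopic h1 _; rewrite /homotopic.
    have [-> _ _] := tri_ends t; rewrite (homotopic_ends h2).1 src_degen.
    by apply: tri_homotopic_right (homotopic_sym h2) t.
  exists k, (degen 1 y); split=> //; first exact: homotopic_refl.
  by rewrite -(represents_ends h1).2; apply: tri_idr.
- split=> /= [[f [g [h1 h2 t]]]|h1].
    apply: represents_homotopic h2 _; apply: tri_uniq (tri_idl g) _.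
    have [e _ _] := tri_ends t; apply: tri_homotopic_left t.
    apply: homotopic_sym; rewrite -e (homotopic_ends h1).2 tgt_degen; exact: h1.
  exists (degen 1 x), k; split=> //; first exact: homotopic_refl.
  by rewrite -(represents_ends h1).1; apply: tri_idl.
- by rewrite /= he.
- have t : tri (sval f) (sval g) (sval h) by exists w.
  split=> /= [[f' [g' [h1 h2 t']]]|hk].
    apply: tri_uniq t _; apply: tri_homotopic_left (homotopic_sym h1) _.
    exact: tri_homotopic_right (homotopic_sym h2) t'.
  exists (sval f), (sval g); split; try exact: homotopic_refl.
  exact: tri_homotopic hk.
Qed.

(** For the direct implication, [sval h] represents the one-letter word and hence the equal
    two-letter word, which unfolds to a triangle on edges homotopic to [f] and [g]. *)
Lemma hedge_tri x y z (f : edge x y) (g : edge y z) (h : edge x z) :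
  ccomp (hedge g) (hedge f) = hedge h <-> tri (sval f) (sval g) (sval h).
Proof.
rewrite [LHS]/= hcompE; split=> [/hclassP/represents_wrel/(_ (sval h)) [_ /=]|[w [e2 e0 e1]]].
  move=> /(_ (homotopic_refl _))[f' [g' [hf hg t]]].
  apply: tri_homotopic_left (homotopic_sym hf) _.
  exact: tri_homotopic_right (homotopic_sym hg) t.
by apply/hclassP; apply: (wrel_simplex e2 e0 e1).
Qed.

Definition degen_edge x : edge x x := exist _ (degen 1 x) (conj (src_degen x) (tgt_degen x)).

Lemma hedge_degen x : Defs.cid x = hedge (degen_edge x) :> @hom (hcat Y) x x.
Proof. by apply/hclassP/wrel_sym/wrel_degen. Qed.

Lemma hedge_surj x y (a : @hom (hcat Y) x y) : exists e : edge x y, a = hedge e.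
Proof.
rewrite -(hreprK a); elim: (hrepr a) => {x y a} [x y e|x|x y z u [e eu] v [e' ev]].
- by exists e.
- by exists (degen_edge x); apply: hedge_degen.
- have [|h t] := @tri_exists (sval e') (sval e); first by rewrite (svalP e').2 (svalP e).1.
  have [_ h1 h2] := tri_ends t.
  have hP : src h = x /\ tgt h = z by rewrite h1 h2 (svalP e').1 (svalP e).2.
  exists (exist _ h hP); rewrite -hcompE eu ev; exact/(hedge_tri e' e (exist _ h hP)).
Qed.

Lemma hedge_homotopic x y (e e' : edge x y) :
  hedge e = hedge e' <-> homotopic (sval e) (sval e').
Proof.
have -> : homotopic (sval e) (sval e') <-> tri (sval e) (sval (degen_edge y)) (sval e').
  by rewrite /homotopic (svalP e).2.
by rewrite -hedge_tri -hedge_degen ccomp1l.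
Qed.

End HomotopyRelation.

(** * Comma quasi-categories *)

Section Comma.
Variables (A B : sSet) (f : smap B A) (a : A 0).
Local Notation Q := (comma f a).

Definition comma_base : smap Q B.
Proof. by exists (fun n q => (sval q).2.2) => m n s q _ <-. Defined.

Definition comma_path : smap Q (ihom (Simplex 1) A).
Proof. by exists (fun n q => (sval q).1) => m n s q _ <-. Defined.

Lemma comma_dom n (q : Q n) m (s : mono m n) :
  comma_path n q m (mono_const m ord0) s = act s (f n (comma_base n q)).
Proof.
case: q => [[h [o b]] e]; have /= <- := congr1 snd e.
by symmetry; apply: hom_simp_nat.
Qed.

Lemma comma_cod n (q : Q n) m (s : mono m n) :
  comma_path n q m (mono_const m ord_max) s = degen m a.
Proof.
case: q => [[h [o b]] e]; have /= ea := congr1 fst e.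
have -> : degen m a = act s (act o a) by rewrite act_comp; congr act; apply: mono_to0.
by rewrite -ea; symmetry; apply: hom_simp_nat.
Qed.

Lemma comma_eq n (q q' : Q n) : comma_base n q = comma_base n q' ->
  (forall m t s, comma_path n q m t s = comma_path n q' m t s) -> q = q'.
Proof.
case: q q' => [[h [o b]] e] [[h' [o' b']] e'] /= eb eh; apply: eq_exist => /=.
congr pair; first exact: hom_simp_eq.
by congr pair => //; apply: mono_to0.
Qed.

Lemma mk_comma_proof n (h : ihom (Simplex 1) A n) (b : B n) :
  h n (mono_const n ord0) (mono_id n) = f n b ->
  h n (mono_const n ord_max) (mono_id n) = degen n a ->
  spair (cod_map A) (dom_map A) n h = sprod_map (vertex_map a) f n (mono_const n ord0, b).
Proof. by move=> hd hc; exact: (f_equal2 pair hc hd). Qed.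

Definition mk_comma n h b hd hc : Q n :=
  exist _ (h, (mono_const n ord0, b)) (@mk_comma_proof n h b hd hc).

(** The base is filled in [B] first. The path component is then a horn in [ihom (Simplex 1) A],
    filled relative to both ends of [Simplex 1], where the values must be [f] of the chosen filler
    and the constant [a]. *)
Lemma comma_quasi_category : quasi_category A -> quasi_category B -> quasi_category Q.
Proof.
move=> qA qB n k n2 kn u.
have [vB vBu] := qB n k n2 kn (comma_base \c u).
have vBE m (t : horn k m) : vB m (sval t) = comma_base m (u m t).
  by have := congr1 (fun w : smap (horn k) B => w m t) vBu.
have hd m l p (s : mono l p) (t : Simplex n p) (r : mono p m) :
    act s (f p (vB p t)) = f l (vB l (act s t)) by rewrite !(smap_nat _ erefl).
have hc m l p (s : mono l p) (t : Simplex n p) (r : mono p m) :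
    act s (degen p a) = degen l a by exact: act_degen.
pose G0 : graph (Simplex 1) (ihom (Simplex n) A) := fun m x w =>
  (x = mono_const m ord0 /\ w = hom_of (hd m)) \/
  (x = mono_const m ord_max /\ w = hom_of (hc m)).
have pG0 : partial_map G0.
  split=> [l m s x w [[-> ->]|[-> ->]]|m x w w' [[-> ->]|[-> ->]] [[e ->]|[e ->]] //].
  - by left; split=> //; apply: hom_simp_eq.
  - by right; split=> //; apply: hom_simp_eq.
  - by have := congr1 (fun s : mono m 1 => s ord0 : nat) e.
  - by have := congr1 (fun s : mono m 1 => s ord0 : nat) e.
have G0R : gsub G0 (horn_over (comma_path \c u)).
  move=> m x w [[-> ->]|[-> ->]] l t s /=.
    have e := comma_dom (u l t) (mono_id l); rewrite act_id -vBE in e.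
    exact: esym e.
  exact: esym (comma_cod (u l t) (mono_id l)).
have [v [vu vE]] := extend_horn qA kn pG0 G0R.
have cd m t : v m t m (mono_const m ord0) (mono_id m) = f m (vB m t).
  have h : G0 m (mono_const m ord0) (hom_of (hd m)) by left.
  by have /= := vE _ _ _ h m t (mono_id m).
have cc m t : v m t m (mono_const m ord_max) (mono_id m) = degen m a.
  have h : G0 m (mono_const m ord_max) (hom_of (hc m)) by right.
  by have /= := vE _ _ _ h m t (mono_id m).
pose V m t := mk_comma (cd m t) (cc m t).
have nat m l (s : mono m l) t t' : act s t = t' -> act s (V l t) = V m t'.
  move=> <-; apply: comma_eq => [|p r q]; first exact: (smap_nat vB erefl).
  by rewrite /= -(smap_nat v (erefl (act s t))).
exists (@SMap (Simplex n) Q V nat); apply: smap_eq => m t; apply: comma_eq => [|p r q].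
  exact: vBE.
by have /= <- := congr1 (fun w : smap (horn k) (ihom (Simplex 1) A) => w m t p r q) vu.
Qed.

End Comma.

(** * Constant families and fillers with a prescribed value *)

Definition csimp (X Y : sSet) n (y : Y n) : ihom X Y n.
Proof.
apply: (@hom_of X Y n (fun m _ t => act t y)) => l m s x t; exact: act_comp.
Defined.

Definition csimp_map (X Y : sSet) : smap Y (ihom X Y).
Proof.
exists (csimp X (Y := Y)) => m n s y _ <-; apply: hom_simp_eq => l x t /=.
by rewrite act_comp.
Defined.

(** [y] read as a diagram of shape [Simplex n], totally degenerate in the direction of [m]; [csimp]
    is instead an [n]-simplex of diagrams that are constant on [X]. *)
Definition pcsimp (Y : sSet) n m (y : Y n) : ihom (Simplex n) Y m.
Proof.
apply: (@hom_of (Simplex n) Y m (fun l t _ => act t y)) => p l s t r; exact: act_comp.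
Defined.

Lemma hom_at_degen (X Y : sSet) n (w : ihom X Y n) (x : X 0) m (t : mono m n) :
  w m (degen m x) t = act t (ev_at Y x n w).
Proof. by symmetry; apply: hom_simp_nat => //; apply: act_degen. Qed.

(** Fixing the value [b] at [x] in advance is what allows a homotopy to be corrected elsewhere while
    becoming strictly degenerate at [x]. *)
Lemma extend_faces (X A : sSet) n (k : 'I_n.+3) (y : 'I_n.+3 -> ihom X A n.+1)
    (x : X 0) (b : A n.+2) : quasi_category A -> 0 < k < n.+2 ->
  (forall i j : 'I_n.+3, i != k -> j != k -> i < j ->
     face (inord j.-1) (y i) = face (inord i) (y j)) ->
  (forall i, i != k -> ev_at A x _ (y i) = face i b) ->
  exists w : ihom X A n.+2, (forall i, i != k -> face i w = y i) /\ ev_at A x _ w = b.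
Proof.
move=> qA kn compat yx; have [u uE] := horn_of_faces compat.
pose G0 : graph X (ihom (Simplex n.+2) A) := fun m z w =>
  z = degen m x /\ w = pcsimp m b.
have pG0 : partial_map G0.
  split=> [l m s z w [-> ->]|m z w w' [_ ->] [_ ->] //].
  by split; [apply: act_degen|apply: hom_simp_eq].
have G0R : gsub G0 (horn_over u).
  move=> m z w [-> ->] l t s; have [i ik ti] := svalP t.
  have [r er] := proper_factor ti; rewrite (uE l t i r ik er) act_degen /=.
  by rewrite er -act_comp -/(face _ _) -yx // hom_at_degen.
have [v [vu vE]] := extend_horn qA kn pG0 G0R.
exists (v _ (mono_id _)); split=> [i ik|].
  by apply: (face_of_filler ik vu) => m s t e; apply: uE.
have h : G0 n.+2 (degen n.+2 x) (pcsimp n.+2 b) by [].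
by have /= := vE _ _ _ h n.+2 (mono_id _) (mono_id _); rewrite !act_id => ->.
Qed.

Lemma smap_tri (X Y : sSet) (F : smap X Y) f g h : tri f g h -> tri (F 1 f) (F 1 g) (F 1 h).
Proof.
move=> [w [<- <- <-]]; exists (F 2 w); split; exact: smap_nat.
Qed.

Lemma smap_homotopic (X Y : sSet) (F : smap X Y) f g :
  homotopic f g -> homotopic (F 1 f) (F 1 g).
Proof.
move=> /(smap_tri F); rewrite /homotopic smap_degen.
by have -> : tgt (F 1 f) = F 0 (tgt f) by apply: smap_nat.
Qed.

(** * Homotopies as edges of internal homs *)

Section HomEdges.
Variables (X Y : sSet).

Lemma coface1_const m (s : mono m 0) :
  mono_comp (coface (inord 1 : 'I_2)) s = mono_const m ord0.
Proof. by apply: mono_ext => j; rewrite coface_compE inordK //= ord1. Qed.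

Lemma coface0_const m (s : mono m 0) :
  mono_comp (coface (ord0 : 'I_2)) s = mono_const m ord_max.
Proof. by apply: mono_ext => j; rewrite coface_compE /= ord1. Qed.

Lemma hom_srcP (w : ihom X Y 1) (F : smap X Y) :
  src w = name F <-> forall m x, w m x (mono_const m ord0) = F m x.
Proof.
split=> [e m x|h].
  have /= := congr1 (fun v : hom_simp X Y 0 => v m x (mono_const m ord0)) e.
  by rewrite coface1_const.
by apply: hom_simp_eq => m x s; rewrite /= coface1_const.
Qed.

Lemma hom_tgtP (w : ihom X Y 1) (F : smap X Y) :
  tgt w = name F <-> forall m x, w m x (mono_const m ord_max) = F m x.
Proof.
split=> [e m x|h].
  have /= := congr1 (fun v : hom_simp X Y 0 => v m x (mono_const m ord0)) e.
  by rewrite coface0_const.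
by apply: hom_simp_eq => m x s; rewrite /= coface0_const.
Qed.

Definition hom_edge (F G : smap X Y) (w : ihom X Y 1)
    (h0 : forall m x, w m x (mono_const m ord0) = F m x)
    (h1 : forall m x, w m x (mono_const m ord_max) = G m x) : edge (name F) (name G) :=
  exist _ w (conj ((hom_srcP w F).2 h0) ((hom_tgtP w G).2 h1)).

Lemma hom_edge_src (F G : smap X Y) (e : edge (name F) (name G)) m x :
  (sval e : ihom X Y 1) m x (mono_const m ord0) = F m x.
Proof. exact: (hom_srcP _ _).1 (svalP e).1 m x. Qed.

Lemma hom_edge_tgt (F G : smap X Y) (e : edge (name F) (name G)) m x :
  (sval e : ihom X Y 1) m x (mono_const m ord_max) = G m x.
Proof. exact: (hom_tgtP _ _).1 (svalP e).2 m x. Qed.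

End HomEdges.

Lemma whisk_l_edge (X B A : sSet) (f : smap B A) (b b' : smap X B)
    (e : edge (name b) (name b')) :
  whisk_l f (hedge e) = hedge (edge_map (ihom_post X f) e).
Proof. exact: hcat_lift_edge. Qed.

Lemma whisk_r_edge (X C A : sSet) (k g : smap C A) (e : edge (name k) (name g)) (c : smap X C) :
  whisk_r (hedge e) c = hedge (edge_map (ihom_pre A c) e).
Proof. exact: hcat_lift_edge. Qed.

Lemma simplex0_quasi_category : quasi_category (Simplex 0).
Proof.
move=> n k _ _ u; exists (bang (Simplex n)); apply: smap_eq => m x; exact: mono_to0.
Qed.

Lemma cell_simplex0 (X : sSet) (F G : smap X (Simplex 0)) (a b : cell F G) : a = b.
Proof.
have qX := ihom_quasi_category (X := X) simplex0_quasi_category.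
have [e ->] := hedge_surj qX a; have [e' ->] := hedge_surj qX b.
have -> // : e = e'.
case: e e' => [e he] [e' he']; apply: eq_exist; apply: hom_simp_eq => m x t.
exact: mono_to0.
Qed.

(** * A lifting gives terminal objects *)

(* A homotopy from the identity to the constant map t that is strictly
   constant on t already exhibits t as terminal. *)
Lemma terminal_of_homotopy (Q : sSet) (t : Q 0) (H : ihom Q Q 1) : quasi_category Q ->
  (forall m x, H m x (mono_const m ord0) = x) ->
  (forall m x, H m x (mono_const m ord_max) = degen m t) ->
  (forall m s, H m (degen m t) s = degen m t) -> terminal t.
Proof.
move=> qQ H0 H1 Ht.
have H1' m x : H m x (mono_const m ord_max) = (vertex_map t \c bang Q) m x by exact: H1.
have H0' m x : H m x (mono_const m ord0) = sid Q m x by exact: H0.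
pose eta : cell (sid Q) (vertex_map t \c bang Q) := hedge (hom_edge H0' H1').
have he l m (s : mono l m) (x : Simplex 0 m) (r : mono m 1) :
    act s (mono_const m ord0 : Simplex 0 m) = (mono_const l ord0 : Simplex 0 l) by [].
have he0 m (x : Simplex 0 m) : (hom_of he) m x (mono_const m ord0) =
    (bang Q \c vertex_map t) m x by exact: mono_to0.
have he1 m (x : Simplex 0 m) : (hom_of he) m x (mono_const m ord_max) =
    sid (Simplex 0) m x by exact: mono_to0.
pose eps : cell (bang Q \c vertex_map t) (sid (Simplex 0)) := hedge (hom_edge he0 he1).
exists eta, eps; split; first exact: cell_simplex0.
have qI := ihom_quasi_category (X := Simplex 0) qQ.
rewrite /vcomp /eta /eps whisk_l_edge whisk_r_edge /cell_id hedge_degen.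
apply/(hedge_tri qI).
pose v : ihom (Simplex 0) Q 0 := name (vertex_map t).
have idv : tri (degen 1 v) (degen 1 v) (degen 1 v : ihom (Simplex 0) Q 1).
  by have := tri_idr (degen 1 v); rewrite tgt_degen.
suff : tri (ihom_pre Q (vertex_map t) 1 H)
    (ihom_post (Simplex 0) (vertex_map t) 1 (hom_of he)) (degen 1 v) by [].
have -> : ihom_pre Q (vertex_map t) 1 H = degen 1 v.
  apply: hom_simp_eq => m x s /=.
  have -> : act x t = degen m t by congr act; apply: mono_to0.
  exact: Ht.
have -> : ihom_post (Simplex 0) (vertex_map t) 1 (hom_of he) = degen 1 v.
  by apply: hom_simp_eq => m x s /=; congr act; apply: mono_to0.
exact: idv.
Qed.

Lemma square_homo m (s r : mono m 1) :
  {homo (fun i => inord (maxn (s i) (2 * r i)) : 'I_3) : i j / i <= j}.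
Proof.
have b (i : 'I_2) : i <= 1 by rewrite -ltnS.
move=> i j ij; rewrite !inordK; move: (mono_homo s ij) (mono_homo r ij);
  move: (b (s i)) (b (s j)) (b (r i)) (b (r j)); lia.
Qed.

(* The square [1] x [1] -> [2] sending (0,0), (1,0) and the whole second edge
   to 0, 1 and 2. *)
Definition square m (s r : mono m 1) : mono m 2 := Mono (@square_homo m s r).

Lemma squareE m (s r : mono m 1) i : square s r i = maxn (s i) (2 * r i) :> nat.
Proof. by rewrite /square /= inordK //; move: (ltn_ord (s i)) (ltn_ord (r i)); lia. Qed.

Lemma square_comp l m (s r : mono m 1) (t : mono l m) :
  mono_comp (square s r) t = square (mono_comp s t) (mono_comp r t).
Proof. exact: mono_eq. Qed.

Lemma square_bottom m (s : mono m 1) :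
  square s (mono_const m ord0) = mono_comp (coface (inord 2)) s.
Proof.
apply: mono_ext => i; rewrite squareE coface_compE inordK // /bump /=.
by move: (ltn_ord (s i)); lia.
Qed.

Lemma square_top m (s : mono m 1) :
  square s (mono_const m ord_max) = mono_comp (coface (inord 1)) (mono_const m ord_max).
Proof.
apply: mono_ext => i; rewrite squareE coface_compE inordK // /bump /=.
by move: (ltn_ord (s i)); lia.
Qed.

Lemma square_left m (s : mono m 1) :
  square (mono_const m ord0) s = mono_comp (coface (inord 1)) s.
Proof.
apply: mono_ext => i; rewrite squareE coface_compE inordK // /bump /=.
by move: (ltn_ord (s i)); lia.
Qed.

Lemma square_right m (s : mono m 1) :
  square (mono_const m ord_max) s = mono_comp (coface (inord 0)) s.
Proof.
apply: mono_ext => i; rewrite squareE coface_compE inordK // /bump /=.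
by move: (ltn_ord (s i)); lia.
Qed.

Lemma square_degen m (s r : mono m 1) : mono_comp (codegen ord0) (square s r) = r.
Proof.
apply: mono_ext => i; rewrite codegen_compE squareE /=.
by move: (ltn_ord (s i)) (ltn_ord (r i)); lia.
Qed.

Section LiftingTerminal.
Variables (A B C : sSet) (qA : quasi_category A) (qB : quasi_category B).
Variables (f : smap B A) (g : smap C A) (l : smap C B) (lam : cell (f \c l) g).
Hypothesis lamP : absolute_right_lifting lam.
Variable c : C 0.
Local Notation Q := (comma f (g 0 c)).
Local Notation a := (g 0 c).
Local Notation b0 := (l 0 c).

(** [lamP] is used twice: existence over [Q] for the universal 2-cell [chi], and uniqueness over
    [Simplex 0], which shows that the solution restricts at [t0] to a loop homotopic to the
    identity. *)
Lemma lifting_terminal : exists t : Q 0, terminal t.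
Proof.
have qQ : quasi_category Q by exact: comma_quasi_category.
have [Lam eLam] := hedge_surj (ihom_quasi_category qA) lam.
pose L0 : ihom C A 1 := sval Lam.
pose e0 : A 1 := ev_at A c 1 L0.
have L0E m (t : mono m 1) : L0 m (degen m c) t = act t e0 by exact: hom_at_degen.
have e0_dom m : act (mono_const m ord0) e0 = degen m (f 0 b0).
  by rewrite -L0E (hom_edge_src Lam) !smap_degen.
have e0_cod m : act (mono_const m ord_max) e0 = degen m a.
  by rewrite -L0E (hom_edge_tgt Lam) !smap_degen.
pose h0 : ihom (Simplex 1) A 0 := pcsimp 0 e0.
have h0d : h0 0 (mono_const 0 ord0) (mono_id 0) = f 0 b0.
  by rewrite /= e0_dom degen0.
have h0c : h0 0 (mono_const 0 ord_max) (mono_id 0) = degen 0 a by exact: e0_cod.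
pose t0 : Q 0 := mk_comma h0d h0c.
pose p := comma_base f a.
pose cQ : smap Q C := vertex_map c \c bang Q.
have chi_nat k m (s : mono k m) (q : Q m) (r : mono m 1) :
    act s (comma_path f a m q m r (mono_id m)) =
    comma_path f a k (act s q) k (mono_comp r s) (mono_id k).
  by rewrite smap_act; apply: hom_simp_nat.
pose chi0 : ihom Q A 1 := hom_of chi_nat.
have chi_src m q : chi0 m q (mono_const m ord0) = (f \c p) m q.
  by rewrite /= comma_dom act_id.
have chi_tgt m q : chi0 m q (mono_const m ord_max) = (g \c cQ) m q.
  by rewrite /= comma_cod -smap_degen.
pose chi : cell (f \c p) (g \c cQ) := hedge (hom_edge chi_src chi_tgt).
have [zeta [zetaP _]] := lamP qQ chi.
have [z ez] := hedge_surj (ihom_quasi_category qB) zeta.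
pose z0 : ihom Q B 1 := sval z.
have z0_src m q : z0 m q (mono_const m ord0) = p m q by exact: (hom_edge_src z).
have z0_tgt m q : z0 m q (mono_const m ord_max) = degen m b0.
  by rewrite (hom_edge_tgt z) -smap_degen.
have L0Q : ihom_pre A cQ 1 L0 = csimp Q e0.
  by apply: hom_simp_eq => m q r; apply: L0E.
have tri0 : tri (ihom_post Q f 1 z0) (csimp Q e0) chi0.
  rewrite -L0Q.
  move: zetaP; rewrite /vcomp ez eLam whisk_l_edge whisk_r_edge /chi.
  by move/esym/(hedge_tri (ihom_quasi_category qA)).
pose zt : B 1 := ev_at B t0 1 z0.
have chi_t : ev_at A t0 1 chi0 = e0 by rewrite /= act_id.
have tri_t : tri (f 1 zt) e0 e0.
  have := smap_tri (ev_at A t0) tri0; rewrite chi_t.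
  by have -> : ev_at A t0 1 (csimp Q e0) = e0 by rewrite /= act_id.
have ztE m (r : mono m 1) : act r zt = z0 m (degen m t0) r by rewrite hom_at_degen.
have zt_dom m : act (mono_const m ord0) zt = degen m b0.
  by rewrite ztE z0_src smap_degen.
have zt_cod m : act (mono_const m ord_max) zt = degen m b0 by rewrite ztE z0_tgt.
(* Over t0 both z and the identity solve the same lifting problem. *)
have zt_degen : tri zt (degen 1 b0) (degen 1 b0).
  pose D := Simplex 0.
  have vE (Y : sSet) (y : Y 0) m (s : D m) : act s y = degen m y.
    by congr act; apply: mono_to0.
  have ct0 m (s : D m) : csimp D e0 m s (mono_const m ord0) = (f \c vertex_map b0) m s.
    by rewrite /= e0_dom vE smap_degen.
  have ct1 m (s : D m) : csimp D e0 m s (mono_const m ord_max) = (g \c vertex_map c) m s.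
    by rewrite /= e0_cod vE smap_degen.
  pose chit := hom_edge ct0 ct1.
  have zeP (w : B 1) : (forall m, act (mono_const m ord0) w = degen m b0) ->
      (forall m, act (mono_const m ord_max) w = degen m b0) -> tri (f 1 w) e0 e0 ->
      exists e : edge (name (vertex_map b0 : smap D B)) (name (l \c vertex_map c)),
        sval e = csimp D w /\
        (hedge chit : cell _ _) = vcomp (whisk_r lam (vertex_map c)) (whisk_l f (hedge e)).
    move=> w0 w1 tw.
    have h0' m (s : D m) : (csimp D w) m s (mono_const m ord0) = vertex_map b0 m s.
      by rewrite /= w0 vE.
    have h1' m (s : D m) : (csimp D w) m s (mono_const m ord_max) = (l \c vertex_map c) m s.
      by rewrite /= w1 vE smap_degen.
    exists (hom_edge h0' h1'); split=> //.
    rewrite /vcomp eLam whisk_l_edge whisk_r_edge.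
    apply/esym/(hedge_tri (ihom_quasi_category qA)).
    suff : tri (ihom_post D f 1 (csimp D w)) (ihom_pre A (vertex_map c) 1 L0) (csimp D e0) by [].
    have -> : ihom_post D f 1 (csimp D w) = csimp D (f 1 w).
      by apply: hom_simp_eq => m s r /=; rewrite smap_act.
    have -> : ihom_pre A (vertex_map c) 1 L0 = csimp D e0.
      by apply: hom_simp_eq => m s r /=; rewrite vE L0E.
    exact: (smap_tri (csimp_map D A)).
  have [e1 [e1E e1P]] := zeP zt zt_dom zt_cod tri_t.
  have [||| e2 [e2E e2P]] := zeP (degen 1 b0).
  - by move=> m; apply: act_degen.
  - by move=> m; apply: act_degen.
  - rewrite smap_degen; have := tri_idl e0.
    have -> : src e0 = f 0 b0.
      by have := e0_dom 0; rewrite degen0 -(coface1_const (mono_id 0)).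
    by [].
  have qD := ihom_quasi_category (X := D) qB.
  have [zu [_ zuniq]] := lamP simplex0_quasi_category
    (hedge chit : cell (f \c vertex_map b0) (g \c vertex_map c)).
  have e12 : hedge e1 = hedge e2 by rewrite -(zuniq _ e1P) -(zuniq _ e2P).
  move/(hedge_homotopic qD): e12; rewrite e1E e2E => h.
  have := smap_homotopic (ev_at B (mono_id 0 : D 0)) h.
  have ev w : ev_at B (mono_id 0 : D 0) 1 (csimp D w) = w by rewrite /= act_id.
  rewrite !ev /homotopic.
  have -> // : tgt zt = b0.
  by have := zt_cod 0; rewrite degen0 -(coface0_const (mono_id 0)).
(* First z is changed within its homotopy class to be constant on t0. *)
have [b [b2 b0' b1]] := zt_degen.
have tgt_z : tgt z0 = name (l \c cQ) by apply/hom_tgtP => m q; rewrite z0_tgt -smap_degen.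
have [|||w1 [w1E w1t]] := @extend_faces Q B 0 (inord 1)
  (fun i => if i == 0 :> nat then degen 1 (name (l \c cQ)) else z0) t0 b qB.
- by rewrite inordK.
- move=> [[|[|[|i]]] // li] [[|[|[|j]]] // lj] /=; rewrite ?ord_eqE ?inordK //= => _ _ _.
  by rewrite [in RHS]inord0; apply: (etrans (src_degen _) (esym tgt_z)).
- move=> [[|[|[|i]]] // li]; rewrite ?ord_eqE ?inordK //= => _.
    have -> : Ordinal li = inord 0 by apply: val_inj; rewrite /= inordK.
    by rewrite b0' !smap_degen.
  have -> : Ordinal li = inord 2 by apply: val_inj; rewrite /= inordK.
  by rewrite b2.
pose z1 : ihom Q B 1 := face (inord 1) w1.
have z1t : ev_at B t0 1 z1 = degen 1 b0 by rewrite /z1 /face smap_act w1t -b1.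
have z01 : homotopic z0 z1.
  rewrite /homotopic tgt_z; exists w1; split=> //; rewrite w1E ?ord_eqE ?inordK //.
have triz1 : tri (ihom_post Q f 1 z1) (csimp Q e0) chi0.
  exact: (tri_homotopic_left (ihom_quasi_category qA)) (smap_homotopic (ihom_post Q f) z01) tri0.
(* The triangle then restricts at t0 to a loop gamma of homotopies from e0 to
   itself, which is cancelled by composing with its constant extension. *)
have [w0 [w02 w00 w01]] := triz1.
pose gamma := ev_at A t0 2 w0.
have gE (i : 'I_3) : face i gamma = ev_at A t0 1 (face i w0) by rewrite /face smap_act.
have g0 : face (inord 0) gamma = e0 by rewrite gE w00.
have g1 : face (inord 1) gamma = e0 by rewrite gE w01.
have g2 : face (inord 2) gamma = degen 1 (f 0 b0).
  by rewrite gE w02 -smap_degen -z1t.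
pose fz1 := ihom_post Q f 1 z1.
(* A horn at vertex 2, whose entry there is a dummy. At [t0] it is the horn of the degenerate
   3-simplex [degen_at ord0 gamma]; filling it over that simplex makes the new face
   [degen_at ord0 e0] at [t0], while its edges are still those of [w0]. *)
pose y (i : 'I_4) : ihom Q A 2 :=
  nth w0 [:: csimp Q gamma; w0; w0; degen_at (inord 1) fz1] i.
have csimp_face n (i : 'I_n.+2) (x : A n.+1) : face i (csimp Q x) = csimp Q (face i x).
  exact: (smap_nat (csimp_map Q A) erefl).
have tgt_fz1 : tgt fz1 = name (f \c l \c cQ).
  have [_ e] := homotopic_ends z01.
  have -> : tgt fz1 = ihom_post Q f 0 (tgt z1) by apply: smap_nat.
  by rewrite e tgt_z; apply: hom_simp_eq.
have ord4 (i : 'I_4) (k : nat) : k < 4 -> i = k :> nat -> i = inord k.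
  by move=> k4 e; apply: val_inj; rewrite /= e inordK.
have face0_degen : face (inord 0) (degen_at (inord 1) fz1) = degen 1 (name (f \c l \c cQ)).
  rewrite -tgt_fz1 /tgt /degen /face /degen_at !act_comp; congr act; apply: mono_ext => j.
  by rewrite codegen_compE /= !inordK //= /bump /=; case: j => [[|[|]]].
have F01 : face (inord 0) (csimp Q gamma) = face (inord 0) w0 by rewrite csimp_face g0 w00.
have F03 : face (inord 2) (csimp Q gamma) = face (inord 0) (degen_at (inord 1) fz1).
  rewrite csimp_face g2 face0_degen; apply: hom_simp_eq => m q s.
  have -> : csimp Q (degen 1 (f 0 b0)) m q s = act s (degen 1 (f 0 b0)) by [].
  by rewrite act_degen -!smap_degen.
have F13 : face (inord 2) w0 = face (inord 1) (degen_at (inord 1) fz1).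
  by rewrite w02 face_degen_low ?inordK.
have T0 : ev_at A t0 _ (csimp Q gamma) = face (inord 0) (degen_at ord0 gamma).
  by rewrite face_degen_low ?inordK //= act_id.
have T1 : ev_at A t0 _ w0 = face (inord 1) (degen_at ord0 gamma).
  by rewrite face_degen_high ?inordK.
have T3 : ev_at A t0 _ (degen_at (inord 1) fz1) = face (inord 3) (degen_at ord0 gamma).
  have -> : face (inord 3) (degen_at ord0 gamma) = degen 2 (f 0 b0).
    rewrite -(act_degen (codegen ord0)) -g2 /face /degen_at !act_comp; congr act.
    apply: mono_ext => j; rewrite codegen_compE coface_compE codegenE.
    by rewrite /= /bump !inordK //=; move: (ltn_ord j); lia.
  rewrite /degen_at smap_act.
  have -> : ev_at A t0 1 fz1 = f 1 (ev_at B t0 1 z1) by [].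
  by rewrite z1t smap_degen act_degen.
have [|||w2 [w2E w2t]] := @extend_faces Q A 1 (inord 2) y t0 (degen_at ord0 gamma) qA.
- by rewrite inordK.
- by move=> [[|[|[|[|i]]]] // li] [[|[|[|[|j]]]] // lj]; rewrite ?ord_eqE ?inordK.
- move=> i; rewrite /y; case: i => [[|[|[|[|i]]]] // li]; rewrite ?ord_eqE ?inordK //= => _.
  + have -> : Ordinal li = inord 0 by apply: ord4.
    exact: T0.
  + have -> : Ordinal li = inord 1 by apply: ord4.
    exact: T1.
  + have -> : Ordinal li = inord 3 by apply: ord4.
    exact: T3.
have w2E0 : face (inord 0) w2 = csimp Q gamma by rewrite w2E ?ord_eqE /y ?inordK.
have w2E1 : face (inord 1) w2 = w0 by rewrite w2E ?ord_eqE /y ?inordK.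
have w2E3 : face (inord 3) w2 = degen_at (inord 1) fz1 by rewrite w2E ?ord_eqE /y ?inordK.
have FF (i j : 'I_4) (ij : i < j) := face_face w2 ij.
pose w : ihom Q A 2 := face (inord 2) w2.
have w_0 : face (inord 0) w = csimp Q e0.
  have := FF (inord 0) (inord 2); rewrite !inordK // w2E0 csimp_face g1 => <- //.
have w_1 : face (inord 1) w = chi0.
  by have := FF (inord 1) (inord 2); rewrite !inordK // w2E1 w01 => <-.
have w_2 : face (inord 2) w = fz1.
  have := FF (inord 2) (inord 3); rewrite !inordK // w2E3 => -> //.
  by rewrite face_degen_high ?inordK.
have w_t : ev_at A t0 2 w = degen_at ord0 e0.
  rewrite /w /face smap_act w2t -g1 /face /degen_at !act_comp; congr act.
  apply: mono_ext => j; rewrite codegen_compE coface_compE codegenE.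
  by rewrite /= /bump !inordK //=; move: (ltn_ord j); lia.
have wE (i : 'I_3) m q (s : mono m 1) :
    w m q (mono_comp (coface i) s) = face i w m q s by [].
have z1_src m q : z1 m q (mono_const m ord0) = p m q.
  by rewrite ((hom_srcP _ p).1 _) // (homotopic_ends z01).1; apply/hom_srcP.
have z1_tgt m q : z1 m q (mono_const m ord_max) = degen m b0.
  rewrite ((hom_tgtP _ (l \c cQ)).1 _) ?(homotopic_ends z01).2 //.
  by rewrite -smap_degen.
have hnat m (q : Q m) (s : mono m 1) k k' (r : mono k k') (t : Simplex 1 k') (x : mono k' m) :
    act r (w k' (act x q) (square (mono_comp s x) t)) =
    w k (act (mono_comp x r) q) (square (mono_comp s (mono_comp x r)) (act r t)).
  by apply: hom_simp_nat; rewrite ?act_comp ?square_comp.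
(* Through [square] the triangle [w] becomes a path from [f] of [z1] at parameter [s] to the
   constant [a]: the path component of the homotopy on the comma. *)
pose h m q s : ihom (Simplex 1) A m := hom_of (@hnat m q s).
have hE m (q : Q m) s k (t : Simplex 1 k) (x : mono k m) :
  h m q s k t x = w k (act x q) (square (mono_comp s x) t) by [].
have hd m q s : h m q s m (mono_const m ord0) (mono_id m) = f m (z1 m q s).
  by rewrite hE act_id square_bottom wE w_2.
have hc m q s : h m q s m (mono_const m ord_max) (mono_id m) = degen m a.
  rewrite hE act_id; have -> : square (mono_comp s (mono_id m)) (mono_const m ord_max) =
    mono_comp (coface (inord 0)) (mono_const m ord_max).
    by rewrite square_top; apply: mono_ext => j; rewrite !coface_compE !inordK.
  rewrite wE w_0; exact: e0_cod.
have H0E m q s k t x : comma_path f a m (mk_comma (hd m q s) (hc m q s)) k t x = h m q s k t x.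
  by [].
pose H0 m q s : Q m := mk_comma (hd m q s) (hc m q s).
have Hnat k m (r : mono k m) (q : Q m) (s : mono m 1) :
    act r (H0 m q s) = H0 k (act r q) (mono_comp s r).
  apply: comma_eq => [|k' t x]; first exact: hom_simp_nat.
  have -> : comma_path f a k (act r (H0 m q s)) k' t x = h m q s k' t (mono_comp r x) by [].
  by rewrite H0E !hE act_comp.
pose H : ihom Q Q 1 := hom_of Hnat.
have HE m q s k t x : comma_path f a m (H m q s) k t x =
  w k (act x q) (square (mono_comp s x) t) by [].
have t0E m k t x : comma_path f a m (degen m t0) k t x = act t e0 by [].
exists t0; apply: (@terminal_of_homotopy _ _ H qQ).
- move=> m q; apply: comma_eq => [|k t x]; first exact: z1_src.
  rewrite HE square_left wE w_1.
  have -> : chi0 k (act x q) t = comma_path f a k (act x q) k t (mono_id k) by [].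
  by rewrite smap_act.
- move=> m q; apply: comma_eq => [|k t x]; first exact: z1_tgt.
  by rewrite HE square_right wE w_0 t0E.
- move=> m s; apply: comma_eq => [|k t x].
    have -> : comma_base f a m (H m (degen m t0) s) = z1 m (degen m t0) s by [].
    by rewrite hom_at_degen z1t act_degen smap_degen.
  by rewrite HE t0E act_degen hom_at_degen w_t /degen_at act_comp square_degen.
Qed.

End LiftingTerminal.

(** * Terminal vertices and sphere filling *)

Definition sphere_filling (Q : sSet) (t : Q 0) : Prop :=
  forall n (U : graph (Simplex n) Q), 0 < n -> partial_map U ->
  (forall m (s : mono m n), gdom U s <-> proper s) ->
  U 0 (mono_const 0 ord_max) t ->
  exists w : Q n, forall m (s : mono m n) x, U m s x -> x = act s w.

(** [H] represents the unit, and need not be degenerate at [t]. The 2-simplex [b] comes from the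
    triangle identity evaluated there and exhibits a left inverse of the edge [H] at [t]. *)
Lemma homotopy_of_terminal (Q : sSet) (t : Q 0) : quasi_category Q -> terminal t ->
  exists (H : ihom Q Q 1) (b : Q 2),
    [/\ forall m x, H m x (mono_const m ord0) = x,
        forall m x, H m x (mono_const m ord_max) = degen m t,
        face (inord 2) b = H 1 (degen 1 t) (mono_id 1) &
        face (inord 1) b = degen 1 t].
Proof.
move=> qQ [eta [eps [_ e2]]].
have [H eH] := hedge_surj (ihom_quasi_category qQ) eta.
have [E eE] := hedge_surj (ihom_quasi_category simplex0_quasi_category) eps.
move: e2; rewrite eH eE /vcomp whisk_l_edge whisk_r_edge /cell_id hedge_degen.
move/(hedge_tri (ihom_quasi_category qQ)).
move/(smap_tri (ev_at Q (mono_id 0 : Simplex 0 0))) => [b [b2 _ b1]].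
exists (sval H), b; split=> [m x|m x||].
- exact: (hom_edge_src H).
- exact: (hom_edge_tgt H).
- exact: b2.
- by rewrite b1 smap_degen; congr degen; rewrite -[RHS]act_id; congr act; apply: mono_to0.
Qed.

Lemma mono1_top m (s : mono m 1) : (forall j, s j != ord0) -> s = mono_const m ord_max.
Proof.
move=> h; apply: mono_ext => j /=; move: (h j) (ltn_ord (s j)); rewrite ord_eqE /=; lia.
Qed.

(** [H] applied to the sphere, with the constant [t] on top, is a partial map on the prism. Its edge
    from [(n,0)] to [(n,1)] is [H] at [t], whose left inverse lets [fill_reversal] bypass the outer
    horn. *)
Lemma terminal_sphere_filling (Q : sSet) (t : Q 0) :
  quasi_category Q -> terminal t -> sphere_filling t.
Proof.
move=> qQ tt n U n0 pU dU Ut.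
have [H [b [H0 H1 b2 b1]]] := homotopy_of_terminal qQ tt.
pose G : graph (grid n 1) Q := fun m z x =>
  (exists2 w, U m z.1 w & x = H m w z.2) \/ ((forall j, z.2 j != ord0) /\ x = degen m t).
have pG : partial_map G.
  split=> [l m r [s u] x [[w Uw ->]|[h ->]]
          |m [s u] x y [[w Uw ->]|[h ->]] [[w' Uw' ->]|[h' ->]] //].
  - left; exists (act r w); first exact: (partial_act pU).
    exact: hom_simp_nat.
  - by right; split=> [j|]; [apply: h|apply: act_degen].
  - by rewrite (partial_fun pU Uw Uw').
  - by have /= -> := mono1_top h'; rewrite H1.
  - by have /= -> := mono1_top h; rewrite H1.
have dG m (z : grid n 1 m) : gdom G z <-> proper z.1 \/ (forall j, z.2 j != ord0).
  split=> [[x [[w Uw _]|[h _]]]|[h|h]].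
  - by left; apply/dU; exists w.
  - by right.
  - by have [w Uw] := (dU _ z.1).2 h; exists (H m w z.2); left; exists w.
  - by exists (degen m t); right.
have [V [pV sV dV]] := extend_prism qQ pG dG.
apply: (@fill_reversal Q qQ n n0 U V b t pU pV dU _ _ dV Ut b1).
- by move=> m s x Ux; apply: sV; left; exists x => //=; rewrite H0.
- move=> m z pz; have [x Gx] := (dG m z).2 (or_introl pz); exists x; exact: sV.
- apply: sV; left; exists (degen 1 t) => //.
  have := partial_act pU (mono_const 1 ord0) Ut.
  by have -> : act (mono_const 1 ord0) (mono_const 0 ord_max : Simplex n 0) =
    mono_const 1 ord_max by [].
Qed.

(** * Prisms over a simplex, with terminal value at the last vertex *)

Section FillPrism.
Variables (A B : sSet) (qA : quasi_category A) (f : smap B A) (n : nat).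
Hypothesis n_gt0 : 0 < n.

Lemma push_homo m (s : mono m n) (u : mono m 1) :
  {homo (fun i => if u i == ord0 then s i else ord_max) : i j / i <= j}.
Proof.
move=> i j ij; have := mono_homo u ij; rewrite !ord_eqE /= => h.
case: eqP => ui; case: eqP => uj //=; first exact: mono_homo.
- by rewrite -ltnS.
- lia.
Qed.

(** Paired with [u], this is the endomorphism of the prism that fixes the bottom and collapses the
    top to [(n,1)]. *)
Definition push m (s : mono m n) (u : mono m 1) : mono m n := Mono (@push_homo m s u).

Lemma push_bottom m (s : mono m n) : push s (mono_const m ord0) = s.
Proof. exact: mono_eq. Qed.

Lemma push_top m (s : mono m n) : push s (mono_const m ord_max) = mono_const m ord_max.
Proof. exact: mono_eq. Qed.

Lemma push_last m (u : mono m 1) : push (mono_const m ord_max) u = mono_const m ord_max.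
Proof. by apply: mono_ext => i /=; case: ifP. Qed.

Lemma jump_homo m (s : mono m n.+1) (u : mono m 1) :
  {homo (fun i => if (u i == ord0) && (s i != ord_max) then ord0 else ord_max : 'I_2) :
    i j / i <= j}.
Proof.
move=> i j ij; have := mono_homo u ij; have := mono_homo s ij; rewrite !ord_eqE /=.
by move: (ltn_ord (s i)) (ltn_ord (s j)); case: ifP; case: ifP => //=; lia.
Qed.

Definition jump m (s : mono m n.+1) (u : mono m 1) : mono m 1 := Mono (@jump_homo m s u).

Definition trunc m (s : mono m n.+1) : mono m n := mono_comp (codegen ord_max) s.

(* Vertices (i,0) with i <= n are kept, all others go to (n,1). *)
Definition shear m (s : mono m n.+1) (u : mono m 1) : grid n 1 m :=
  (push (trunc s) (jump s u), jump s u).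

Lemma shear_comp l m (s : mono m n.+1) u (r : mono l m) :
  act r (shear s u) = shear (mono_comp s r) (mono_comp u r).
Proof. by congr pair; apply: mono_eq. Qed.

Lemma truncE m (s : mono m n.+1) i : trunc s i = minn (s i) n :> nat.
Proof. by rewrite codegen_compE /=; move: (ltn_ord (s i)); lia. Qed.

Lemma jump_id m (s : mono m n.+1) u : (forall j, s j != ord_max) -> jump s u = u.
Proof.
move=> h; apply: mono_ext => i /=; rewrite h andbT ord_eqE /=; move: (ltn_ord (u i)).
by case: eqP => /=; lia.
Qed.

Lemma pushE m (s : mono m n) (u : mono m 1) i :
  push s u i = (if u i == 0 :> nat then s i : nat else n) :> nat.
Proof. by rewrite [LHS]/= ord_eqE; case: ifP. Qed.

Lemma jumpE m (s : mono m n.+1) (u : mono m 1) i :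
  jump s u i = ((u i != 0 :> nat) || (s i == n.+1 :> nat)) :> nat.
Proof. by rewrite [LHS]/= !ord_eqE /=; case: eqP; case: eqP. Qed.

Lemma plus_homo m (s : mono m n) (u : mono m 1) :
  {homo (fun i => inord (s i + u i) : 'I_n.+2) : i j / i <= j}.
Proof.
have b i : s i + u i < n.+2 by move: (ltn_ord (s i)) (ltn_ord (u i)); lia.
move=> i j ij; rewrite !inordK //; have := mono_homo u ij; have := mono_homo s ij; lia.
Qed.

Definition plus m (s : mono m n) (u : mono m 1) : mono m n.+1 := Mono (@plus_homo m s u).

Lemma plusE m (s : mono m n) (u : mono m 1) i : plus s u i = s i + u i :> nat.
Proof. by rewrite /= inordK //; move: (ltn_ord (s i)) (ltn_ord (u i)); lia. Qed.

Lemma plus_comp l m (s : mono m n) (u : mono m 1) (r : mono l m) :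
  mono_comp (plus s u) r = plus (mono_comp s r) (mono_comp u r).
Proof. exact: mono_eq. Qed.

(** The condition singles out the join of the bottom with [(n,1)]; there [(plus s u, u)] sends
    [(i,0)] to itself and [(n,1)] to the apex [(n+1,1)], and [shear] undoes it. *)
Lemma shear_plus m (s : mono m n) (u : mono m 1) : (forall j, u j != ord0 -> s j = ord_max) ->
  shear (plus s u) u = (s, u).
Proof.
move=> h; have ej : jump (plus s u) u = u.
  apply: mono_ext => i; move: (h i) (ltn_ord (s i)) (ltn_ord (u i)).
  by rewrite jumpE plusE !ord_eqE /=; lia.
rewrite /shear ej; congr pair; apply: mono_ext => i; rewrite pushE truncE plusE.
case: eqP => [->|/eqP ui]; first by move: (ltn_ord (s i)); lia.
by rewrite h // ord_eqE.
Qed.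

(** A simplex of [B] with a path from its image under [f] to [c]: the comma of [f] with a codomain
    that varies along [c] instead of being a constant vertex. *)
Definition prism_over m (c : A m) (w : sprod B (ihom (Simplex 1) A) m) : Prop :=
  forall l (s : mono l m),
    w.2 l (mono_const l ord0) s = act s (f m w.1) /\
    w.2 l (mono_const l ord_max) s = act s c.

Variables (c : A n) (a : A 0).
Hypothesis ca : act (mono_const 0 ord_max) c = a.
Local Notation Q := (comma f a).
Variable t : Q 0.
Hypothesis tP : sphere_filling t.
Variable U : graph (Simplex n) (sprod B (ihom (Simplex 1) A)).
Hypothesis pU : partial_map U.
Hypothesis dU : forall m (s : mono m n), gdom U s <-> proper s.
Hypothesis Uover : forall m (s : mono m n) w, U s w -> prism_over (act s c) w.
Hypothesis Ut : U (mono_const 0 ord_max) (comma_base f a 0 t, comma_path f a 0 t).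

Lemma act_last m : act (mono_const m ord_max) c = degen m a.
Proof. by rewrite -ca /degen act_comp. Qed.

Definition prism_bdry : graph (grid n 1) A := fun m z x =>
  (exists2 w, U z.1 w & x = w.2 m z.2 (mono_id m)) \/
  ((forall j, z.2 j != ord0) /\ x = act z.1 c).

Lemma partial_prism_bdry : partial_map prism_bdry.
Proof.
split=> [l m r [s u] x [[w Uw ->]|[h ->]]|m [s u] x y [[w Uw ->]|[h ->]] [[w' Uw' ->]|[h' ->]] //].
- left; exists (act r w); first exact: (partial_act pU r Uw).
  exact: hom_simp_nat.
- by right; split=> [j|]; [apply: h|rewrite act_comp].
- by rewrite (partial_fun pU Uw Uw').
- by have /= -> := mono1_top h'; rewrite (Uover Uw _).2 act_id.
- by have /= -> := mono1_top h; rewrite (Uover Uw' _).2 act_id.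
Qed.

Lemma prism_bdry_dom m (z : grid n 1 m) :
  gdom prism_bdry z <-> proper z.1 \/ (forall j, z.2 j != ord0).
Proof.
split=> [[x [[w Uw _]|[h _]]]|[h|h]].
- by left; apply/dU; exists w.
- by right.
- by have [w Uw] := (dU z.1).2 h; exists (w.2 m z.2 (mono_id m)); left; exists w.
- by exists (act z.1 c); right.
Qed.

Section Extended.
Variable G1 : graph (grid n 1) A.
Arguments G1 : clear implicits.
Hypothesis pG1 : partial_map G1.
Hypothesis sG1 : gsub prism_bdry G1.
Hypothesis dG1 : forall m (z : grid n 1 m),
  (forall j, z.2 j = ord0 -> z.1 j != ord_max) -> gdom G1 z.

Lemma G1_proper m (z : grid n 1 m) : proper z.1 -> gdom G1 z.
Proof.
by move=> pz; have [x Gx] := (prism_bdry_dom z).2 (or_introl pz); exists x; apply: sG1.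
Qed.

(** If [s] misses some [i < n], so does [push s u]; if it misses [n], the pushed simplex avoids
    [(n,0)]. *)
Lemma G1_push m (s : mono m n) (u : mono m 1) : proper s -> gdom G1 (push s u, u).
Proof.
move=> [i si]; have [lt|ge] := ltnP i n.
  apply: G1_proper; exists i => j; rewrite ord_eqE pushE; case: ifP => _; last by lia.
  by rewrite -ord_eqE.
apply: dG1 => j /= ->; rewrite eqxx; move: (si j); rewrite !ord_eqE /=.
by move: (ltn_ord i); lia.
Qed.

Lemma G1_bdry m (s : mono m n) (u : mono m 1) w : U s w -> G1 m (s, u) (w.2 m u (mono_id m)).
Proof. by move=> Uw; apply: sG1; left; exists w. Qed.

Lemma G1_top m (s : mono m n) : G1 m (s, mono_const m ord_max) (act s c).
Proof. by apply: sG1; right. Qed.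

(* The filled-in boundary with its top collapsed to the last vertex. *)
Definition comma_sphere : graph (Simplex n) Q := fun m s q =>
  [/\ proper s, exists h, U s (comma_base f a m q, h) &
      forall k t (x : mono k m),
        G1 k (push (mono_comp s x) t, t) (comma_path f a m q k t x)].

Lemma partial_comma_sphere : partial_map comma_sphere.
Proof.
split=> [l m r s q [ps [h Uq] Gq]|m s q q' [_ [h Uq] Gq] [_ [h' Uq'] Gq']].
  split; [exact: proper_comp|exists (act r h)|move=> k u x].
    exact: (partial_act pU r Uq).
  exact: (Gq k u (mono_comp r x)).
apply: comma_eq => [|k u x]; first by have := partial_fun pU Uq Uq' => -[].
exact: (partial_fun pG1 (Gq _ _ _)).
Qed.

Lemma comma_sphere_dom m (s : mono m n) : gdom comma_sphere s <-> proper s.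
Proof.
split=> [[q []//]|ps]; have [[b h] Ub] := (dU s).2 ps.
have ex k (u : Simplex 1 k) (x : mono k m) : exists y, G1 k (push (mono_comp s x) u, u) y.
  exact/G1_push/proper_comp.
pose y k u x := sval (cid (@ex k u x)).
have yP k u x : G1 k (push (mono_comp s x) u, u) (y k u x) by rewrite /y; case: cid.
have ynat l k (r : mono l k) (u : Simplex 1 k) (x : mono k m) :
    act r (y k u x) = y l (act r u) (mono_comp x r).
  apply: (partial_fun pG1 _ (yP _ _ _)); have := partial_act pG1 r (yP k u x).
  by congr G1; congr pair; apply: mono_eq.
pose h' : ihom (Simplex 1) A m := hom_of ynat.
have hd : h' m (mono_const m ord0) (mono_id m) = f m b.
  have := yP m (mono_const m ord0) (mono_id m); rewrite push_bottom => Gy.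
  apply: (etrans (partial_fun pG1 Gy (G1_bdry _ Ub))).
  by rewrite (Uover Ub _).1 act_id.
have hc : h' m (mono_const m ord_max) (mono_id m) = degen m a.
  have := yP m (mono_const m ord_max) (mono_id m); rewrite push_top => Gy.
  by apply: (etrans (partial_fun pG1 Gy (G1_top _))); rewrite act_last.
by exists (mk_comma hd hc); split=> //; exists h.
Qed.

Lemma comma_sphere_last : comma_sphere (mono_const 0 ord_max) t.
Proof.
split; [exact/dU/(ex_intro _ _ Ut)|by exists (comma_path f a 0 t)|move=> k u x].
have Ux := partial_act pU x Ut.
rewrite [X in push X _](_ : _ = mono_const k ord_max); last exact: mono_eq.
rewrite push_last; exact: (G1_bdry _ Ux).
Qed.

Lemma comma_filler : exists q : Q n, forall m (s : mono m n), proper s ->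
  (exists h, U s (act s (comma_base f a n q), h)) /\
  forall u, G1 m (push s u, u) (comma_path f a n q m u s).
Proof.
have [q qP] := tP n_gt0 partial_comma_sphere comma_sphere_dom comma_sphere_last.
exists q => m s ps; have [y Sy] := (comma_sphere_dom s).2 ps.
have := Sy; rewrite (qP _ _ _ Sy) => -[_ Uq Gq]; split=> // u.
exact: (Gq m u (mono_id m)).
Qed.

Section Cap.
Variables (b : B n) (q : Q n).
Hypothesis qb : comma_base f a n q = b.
Hypothesis qP : forall m (s : mono m n), proper s ->
  forall u, G1 m (push s u, u) (comma_path f a n q m u s).

(* The cone on Delta^n x Delta^1, whose apex is encoded as the vertex (n+1,1)
   of the grid; the cap below the vertex (n,1) of the prism is a face of it. *)
Definition cap_bdry : graph (grid n.+1 1) A := fun m z x =>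
  [\/ (forall j, z.1 j != ord_max) /\ x = comma_path f a n q m z.2 (trunc z.1),
      (exists2 i : nat, i <= n & forall j, z.1 j != i :> nat) /\ G1 m (shear z.1 z.2) x |
      (forall j, z.2 j != ord0) /\ x = degen m a].

Lemma trunc_proper m (s : mono m n.+1) (i : nat) : i <= n ->
  (forall j, s j != ord_max) -> (forall j, s j != i :> nat) -> proper (trunc s).
Proof.
move=> lt h1 h2; exists (Ordinal (lt : i < n.+1)) => j; rewrite ord_eqE truncE /=.
by move: (h1 j) (h2 j) (ltn_ord (s j)); rewrite ord_eqE /=; lia.
Qed.

Lemma partial_cap_bdry : partial_map cap_bdry.
Proof.
have h12 m (s : mono m n.+1) (u : mono m 1) x : (forall j, s j != ord_max) ->
    (exists2 i : nat, i <= n & forall j, s j != i :> nat) -> G1 m (shear s u) x ->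
    x = comma_path f a n q m u (trunc s).
  move=> h1 [i lt h2]; rewrite /shear jump_id // => Gx.
  exact: (partial_fun pG1 Gx (qP (trunc_proper lt h1 h2) u)).
have h23 m (s : mono m n.+1) (u : mono m 1) x : (forall j, u j != ord0) ->
    G1 m (shear s u) x -> x = degen m a.
  move=> h Gx; rewrite -act_last; apply: (partial_fun pG1 Gx).
  have ej : jump s u = mono_const m ord_max.
    by apply: mono1_top => j; have := h j; rewrite !ord_eqE jumpE /= => ->.
  by rewrite /shear ej push_top; apply: G1_top.
split=> [l m r [s u] x|m [s u] x y].
  case=> [[h ->]|[[i lt h] Gx]|[h ->]].
  - by apply: Or31; split=> [j|]; [apply: h|apply: hom_simp_nat].
  - apply: Or32; split; first by exists i => // j; apply: h.
    by rewrite -shear_comp; apply: (partial_act pG1).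
  - by apply: Or33; split=> [j|]; [apply: h|apply: act_degen].
case=> [[h ->]|[h Gx]|[h ->]]; case=> [[h' ->]|[h' Gy]|[h' ->]] //.
- by symmetry; apply: h12 Gy.
- by have /= -> := mono1_top h'; rewrite comma_cod.
- exact: h12 Gx.
- exact: (partial_fun pG1 Gx).
- exact: h23 Gx.
- by have /= -> := mono1_top h; rewrite comma_cod.
- by symmetry; apply: h23 Gy.
Qed.

Lemma cap_bdry_dom m (z : grid n.+1 1 m) :
  gdom cap_bdry z <-> proper z.1 \/ (forall j, z.2 j != ord0).
Proof.
case: z => s u; split=> [[x [[h _]|[[i lt h] _]|[h _]]]|[[i h]|h]] /=.
- by left; exists ord_max.
- by left; exists (Ordinal (leqW lt : i < n.+2)) => j; rewrite ord_eqE; apply: h.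
- by right.
- have [lt|ge] := ltnP i n.+1; last first.
    exists (comma_path f a n q m u (trunc s)); apply: Or31; split=> // j /=.
    by move: (h j) (ltn_ord i); rewrite !ord_eqE /=; lia.
  suff [x Gx] : gdom G1 (shear s u).
    by exists x; apply: Or32; split=> //; exists i => // j; rewrite -ord_eqE; apply: h.
  have [lt'|ge'] := ltnP i n.
    apply: G1_proper; exists (Ordinal lt) => j.
    rewrite ord_eqE [X in nat_of_ord X](_ : _ = push (trunc s) (jump s u) j) // pushE truncE /=.
    by case: ifP => _; move: (h j); rewrite ord_eqE /=; lia.
  apply: dG1 => j /(congr1 (@nat_of_ord _)); rewrite jumpE ord_eqE => e.
  rewrite [X in nat_of_ord X](_ : _ = push (trunc s) (jump s u) j) // pushE jumpE truncE /=.
  move: e (h j) (ltn_ord (s j)); rewrite ord_eqE /=.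
  by case: ifP; lia.
- by exists (degen m a); apply: Or33.
Qed.

Variable G3 : graph (grid n.+1 1) A.
Arguments G3 : clear implicits.
Hypothesis pG3 : partial_map G3.
Hypothesis sG3 : gsub cap_bdry G3.
Hypothesis dG3 : forall m (z : grid n.+1 1 m),
  (forall j, z.2 j = ord0 -> z.1 j != ord_max) -> gdom G3 z.

(* Only simplices through (n,0) are missing from G1; those lie in the join of
   Delta^n x {0} with (n,1), and are taken from the cone. *)
Definition prism_graph : graph (grid n 1) A := fun m z x =>
  (proper z.1 \/ forall j, z.2 j = ord0 -> z.1 j != ord_max) /\ G1 m z x \/
  (forall j, z.2 j != ord0 -> z.1 j = ord_max) /\ G3 m (plus z.1 z.2, z.2) x.

Lemma partial_prism_graph : partial_map prism_graph.
Proof.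
have h12 m (s : mono m n) (u : mono m 1) x y :
    (proper s \/ forall j, u j = ord0 -> s j != ord_max) -> G1 m (s, u) x ->
    (forall j, u j != ord0 -> s j = ord_max) -> G3 m (plus s u, u) y -> x = y.
  move=> h Gx h' Gy; apply: (partial_fun pG3 _ Gy); apply: sG3; apply: Or32.
  rewrite /= (shear_plus h'); split=> //.
  have avoid : (forall j, u j = ord0 -> s j != ord_max) ->
      exists2 i : nat, i <= n & forall j, plus s u j != i :> nat.
    move=> hh; exists n => // j; rewrite plusE.
    have [e|ne] := eqVneq (u j) ord0.
      by have := hh j e; rewrite e ord_eqE /= addn0.
    by rewrite h' //=; move: ne; rewrite ord_eqE /=; lia.
  case: h => [[i si]|]; last exact: avoid.
  have [lt|ge] := ltnP i n.
    exists i; first exact: ltnW.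
    move=> j; rewrite plusE; have [e|ne] := eqVneq (u j) ord0.
      by have := si j; rewrite e ord_eqE /= addn0.
    by rewrite h' //=; lia.
  apply: avoid => j _; move: (si j) (ltn_ord i); rewrite !ord_eqE /=; lia.
split=> [l m r [s u] x [[h Gx]|[h Gx]]|m [s u] x y [[h Gx]|[h Gx]] [[h' Gy]|[h' Gy]]].
- left; split; last exact: (partial_act pG1 r Gx).
  by case: h => h; [left; apply: proper_comp|right=> j; apply: h].
- right; split=> [j|]; first exact: h.
  by rewrite -plus_comp; apply: (partial_act pG3 r Gx).
- exact: (partial_fun pG1 Gx).
- exact: h12 Gy.
- by symmetry; apply: h12 Gx.
- exact: (partial_fun pG3 Gx).
Qed.

(** Once a simplex has passed through [(n,0)], its first coordinate stays [n], so it lies in the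
    join of the bottom with [(n,1)]. *)
Lemma prism_graph_dom m (z : grid n 1 m) : gdom prism_graph z.
Proof.
case: z => s u.
have [av|nav] := EM (forall j, u j = ord0 -> s j != ord_max).
  by have [x Gx] := dG1 (z := (s, u)) av; exists x; left; split=> //; right.
have [k [uk sk]] : exists k, u k = ord0 /\ s k = ord_max.
  apply: contrapT => nk; apply: nav => j uj; apply/eqP=> sj; by apply: nk; exists j.
have h j : u j != ord0 -> s j = ord_max.
  move=> uj; have lt : k < j.
    rewrite ltnNge; apply/negP=> jk; have := mono_homo u jk; rewrite uk leqn0 => /eqP e.
    by move: uj; rewrite ord_eqE e.
  apply: val_inj => /=; have := mono_homo s (ltnW lt); rewrite sk /=; move: (ltn_ord (s j)); lia.
have [|x Gx] := dG3 (z := (plus s u, u)); last by exists x; right.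
move=> j /= uj; rewrite ord_eqE plusE uj /= addn0; move: (ltn_ord (s j)); lia.
Qed.

Lemma prism_of_cap : exists w : ihom (Simplex 1) A n, prism_over c (b, w) /\
  forall m (s : mono m n) y, U s y -> y.2 = act s w.
Proof.
have [h hP] := partial_total partial_prism_graph prism_graph_dom.
have hw l m (r : mono l m) (u : Simplex 1 m) (s : mono m n) :
    act r (h m (s, u)) = h l (mono_comp s r, act r u) by apply: smap_nat.
pose w := hom_of hw.
have hE m z x : prism_graph z x -> h m z = x.
  by move=> Gx; apply: (partial_fun partial_prism_graph (hP _ _) Gx).
exists w; split=> [m s|m s y Uy].
  split; apply: hE.
    right; split=> //=; apply: sG3; apply: Or31.
    split=> [j|].
      rewrite ord_eqE (plusE s (mono_const m ord0)) /= addn0; move: (ltn_ord (s j)); lia.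
    have -> : trunc (plus s (mono_const m ord0)) = s.
      by apply: mono_ext => j; rewrite truncE plusE /= addn0; move: (ltn_ord (s j)); lia.
    by rewrite comma_dom qb.
  by left; split; [right|apply: G1_top].
apply: hom_simp_eq => k u r; symmetry; apply: hE; left.
have ps : proper s by apply/dU; exists y.
split; first by left; apply: proper_comp.
exact: (G1_bdry u (partial_act pU r Uy)).
Qed.

End Cap.
End Extended.

(** The filler [q] agrees with [G1] only over proper faces of the [n]-simplex. Its own simplex on
    the bottom and [(n,1)] therefore need not have the face opposite [(n,0)] that [G1] prescribes,
    and the cone [G3] provides a replacement with the same bottom. *)
Lemma fill_prism : exists2 w, prism_over c w &
  forall m (s : mono m n) y, U s y -> y = act s w.
Proof.
have [G1 [pG1 sG1 dG1]] := extend_prism qA partial_prism_bdry prism_bdry_dom.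
have [q qP] := comma_filler pG1 sG1 dG1.
have qP2 m (s : mono m n) (ps : proper s) := (qP m s ps).2.
have [G3 [pG3 sG3 dG3]] :=
  extend_prism qA (partial_cap_bdry pG1 sG1 qP2) (cap_bdry_dom sG1 dG1 q).
have [w [wo wU]] := prism_of_cap pG1 sG1 dG1 (erefl (comma_base f a n q)) pG3 sG3 dG3.
exists (comma_base f a n q, w) => // m s y Uy.
have [[h Uh] _] := qP m s ((dU s).1 (ex_intro _ y Uy)).
have e1 := congr1 fst (partial_fun pU Uy Uh).
by case: y Uy e1 => y1 y2 Uy /= ->; congr pair; apply: wU Uy.
Qed.

End FillPrism.

(** * Pointwise terminal objects give a lifting *)

(* Both triangles of the square S share its diagonal; the second one is a
   homotopy since the top side is degenerate. *)
Lemma square_tri (X A : sSet) (S : forall m, X m -> mono m 1 -> mono m 1 -> A m)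
    (k : smap X A) (e1 e2 e3 : ihom X A 1) : quasi_category A ->
  (forall l m (r : mono l m) x s u,
     act r (S m x s u) = S l (act r x) (mono_comp s r) (mono_comp u r)) ->
  (forall m x s, S m x s (mono_const m ord0) = e1 m x s) ->
  (forall m x u, S m x (mono_const m ord_max) u = e2 m x u) ->
  (forall m x u, S m x (mono_const m ord0) u = e3 m x u) ->
  (forall m x s, S m x s (mono_const m ord_max) = k m x) ->
  tri e1 e2 e3.
Proof.
move=> qA Snat S1 S2 S3 S4; have qI := ihom_quasi_category (X := X) qA.
pose c0 : mono 2 1 := codegen ord0; pose c1 : mono 2 1 := codegen ord_max.
have nat1 l m (r : mono l m) x (s : mono m 2) :
    act r (S m x (mono_comp c1 s) (mono_comp c0 s)) =
    S l (act r x) (mono_comp c1 (mono_comp s r)) (mono_comp c0 (mono_comp s r)) by rewrite Snat.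
have nat2 l m (r : mono l m) x (s : mono m 2) :
    act r (S m x (mono_comp c0 s) (mono_comp c1 s)) =
    S l (act r x) (mono_comp c0 (mono_comp s r)) (mono_comp c1 (mono_comp s r)) by rewrite Snat.
have natd l m (r : mono l m) x (s : mono m 1) :
    act r (S m x s s) = S l (act r x) (mono_comp s r) (mono_comp s r) by rewrite Snat.
have cE (c : 'I_2) (i : 'I_3) m (s : mono m 1) (u : mono m 1) :
    (forall j, bump i (s j) - (c < bump i (s j)) = u j) ->
    mono_comp (codegen c) (mono_comp (coface i) s) = u.
  by move=> h; apply: mono_ext => j; rewrite codegen_compE coface_compE h.
have b m (s : mono m 1) j : s j <= 1 by rewrite -ltnS.
have t1 : tri e1 e2 (hom_of natd).
  exists (hom_of nat1); split; apply: hom_simp_eq => m x s /=.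
  - rewrite (cE ord_max _ _ _ s) ?(cE ord0 _ _ _ (mono_const m ord0)) //;
      move=> j; rewrite inordK // /bump /=; move: (b _ s j); lia.
  - rewrite (cE ord_max _ _ _ (mono_const m ord_max)) ?(cE ord0 _ _ _ s) //;
      move=> j; rewrite inordK // /bump /=; move: (b _ s j); lia.
  - rewrite (cE ord_max _ _ _ s) ?(cE ord0 _ _ _ s) //;
      move=> j; rewrite inordK // /bump /=; move: (b _ s j); lia.
have t2 : homotopic e3 (hom_of natd).
  have -> : homotopic e3 (hom_of natd) = tri e3 (degen 1 (name k)) (hom_of natd).
    rewrite /homotopic; have -> // : tgt e3 = name k.
    by apply/hom_tgtP => m x; rewrite -S3 S4.
  exists (hom_of nat2); split; apply: hom_simp_eq => m x s /=.
  - rewrite (cE ord_max _ _ _ s) ?(cE ord0 _ _ _ (mono_const m ord0)) //;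
      move=> j; rewrite inordK // /bump /=; move: (b _ s j); lia.
  - rewrite (cE ord_max _ _ _ (mono_const m ord_max)) ?(cE ord0 _ _ _ s) //;
      move=> j; rewrite inordK // /bump /=; move: (b _ s j); lia.
  - rewrite (cE ord_max _ _ _ s) ?(cE ord0 _ _ _ s) //;
      move=> j; rewrite inordK // /bump /=; move: (b _ s j); lia.
exact: (tri_homotopic qI) t1 (homotopic_sym qI t2).
Qed.

Section Construction.
Variables (A B C : sSet) (qA : quasi_category A) (qB : quasi_category B).
Variables (f : smap B A) (g : smap C A).
Variable T : forall c : C 0, comma f (g 0 c) 0.
Hypothesis TP : forall c, terminal (T c).
Local Notation W := (sprod B (ihom (Simplex 1) A)).

Definition wvert (c : C 0) : W 0 := (comma_base f _ 0 (T c), comma_path f _ 0 (T c)).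

Section Lift.
Variables (Z : sSet) (q : smap Z C) (G0 : graph Z W).
Arguments G0 : clear implicits.

Definition lies_over : graph Z W := fun n z w => prism_over f (g n (q n z)) w.

Lemma lies_over_act m n (s : mono m n) z w :
  lies_over z w -> lies_over (act s z) (act s w).
Proof.
move=> h l r; rewrite !smap_act !act_comp; have [h1 h2] := h l (mono_comp s r).
by split; [rewrite -h1|rewrite -h2].
Qed.

Hypothesis pG0 : partial_map G0.
Hypothesis G0_over : gsub G0 lies_over.
Hypothesis G0_vert : forall z : Z 0, gdom G0 z.
Hypothesis G0_last : forall n (z : Z n), ~ gdom G0 z ->
  G0 0 (act (mono_const 0 ord_max) z) (wvert (q 0 (act (mono_const 0 ord_max) z))).

(** The instances are [Z = C], and [X] times a 1- or 2-simplex. Vertices are all prescribed, so new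
    simplices have positive dimension; the terminal value at the last vertex then lets [fill_prism]
    extend over them. *)
Lemma extend_lift : exists h : smap Z W,
  (forall n z, prism_over f (g n (q n z)) (h n z)) /\ (forall n z w, G0 n z w -> h n z = w).
Proof.
apply: (skeletal_extension (@lies_over_act) pG0 G0_over) => n z U nz [pU dU Uo UG].
have n0 : 0 < n by case: n z nz U pU dU Uo UG => // z [].
have ez : act (mono_const 0 ord_max) (g n (q n z)) =
    g 0 (q 0 (act (mono_const 0 ord_max) z)) by rewrite !smap_act.
have qQ := @comma_quasi_category A B f (g 0 (q 0 (act (mono_const 0 ord_max) z))) qA qB.
apply: (@fill_prism A B qA f n n0 (g n (q n z)) _ ez _ (terminal_sphere_filling qQ (TP _)) U pU dU).
- by move=> m s w /Uo; rewrite /lies_over !smap_act.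
- apply: UG (G0_last nz); exists ord0 => j; rewrite ord_eqE /=; lia.
Qed.

End Lift.

Lemma lifting_exists : exists h : smap C W,
  (forall n c, prism_over f (g n c) (h n c)) /\ (forall c, h 0 c = wvert c).
Proof.
pose G0 : graph C W := fun n z w => exists c, z = degen n c /\ w = degen n (wvert c).
have pG0 : partial_map G0.
  split=> [l m s z w [c [-> ->]]|m z w w' [c [-> ->]] [c' [e ->]]].
    by exists c; split; apply: act_degen.
  have /= := congr1 (act (mono_const 0 ord0)) e.
  by rewrite !act_degen !degen0 => ->.
have wv c : prism_over f (g 0 c) (wvert c).
  move=> l s; split; first exact: comma_dom.
  by rewrite /= comma_cod; congr act; apply: mono_to0.
have G0_over : gsub G0 (lies_over (sid C)).
  by move=> n z w [c [-> ->]]; apply: lies_over_act; apply: wv.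
have Gv (c : C 0) : G0 0 c (wvert c) by exists c; rewrite !degen0.
have [|h [h1 h2]] := extend_lift pG0 G0_over (fun z => ex_intro _ _ (Gv z)).
  by move=> n z _; apply: Gv.
by exists h; split=> // c; apply: h2.
Qed.

(** * Universal property of the constructed lifting *)

Section Universal.
Variable h : smap C W.
Hypothesis h_over : forall n c, prism_over f (g n c) (h n c).
Hypothesis h_vert : forall c, h 0 c = wvert c.

Definition lift_map : smap C B.
Proof.
exists (fun n c => (h n c).1) => m n s x y e.
by rewrite -(smap_nat h e).
Defined.

Lemma lift_cell_nat l m (r : mono l m) (c : C m) (s : mono m 1) :
  act r ((h m c).2 m s (mono_id m)) = (h l (act r c)).2 l (mono_comp s r) (mono_id l).
Proof. by rewrite -(smap_nat h (erefl (act r c))); apply: hom_simp_nat. Qed.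

Definition lift_simp : ihom C A 1 := hom_of lift_cell_nat.

Lemma lift_simp_src m c : lift_simp m c (mono_const m ord0) = (f \c lift_map) m c.
Proof. by rewrite /= (h_over c _).1 act_id. Qed.

Lemma lift_simp_tgt m c : lift_simp m c (mono_const m ord_max) = g m c.
Proof. by rewrite /= (h_over c _).2 act_id. Qed.

Definition lift_cell : cell (f \c lift_map) g := hedge (hom_edge lift_simp_src lift_simp_tgt).

Variables (X : sSet) (b : smap X B) (c : smap X C).
Variable e : edge (name (f \c b)) (name (g \c c)).
Let e0 : ihom X A 1 := sval e.

Lemma path_nat m (x : X m) k l (r : mono k l) (u : Simplex 1 l) (s : mono l m) :
  act r (e0 l (act s x) u) = e0 k (act (mono_comp s r) x) (act r u).
Proof. by apply: hom_simp_nat; rewrite ?act_comp. Qed.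

Definition path_at m (x : X m) : ihom (Simplex 1) A m := hom_of (path_nat x).

Lemma h_path m (x : X m) k (u : Simplex 1 k) (s : mono k m) :
  (h m (c m x)).2 k u s = ihom_pre A c 1 lift_simp k (act s x) u.
Proof. by rewrite /= smap_act -(smap_nat h (erefl (act s (c m x)))). Qed.

Section Existence.

(** The 2-cell to be factored sits at the end 0, the restricted lifting at the end 1; an extension
    over [C] is a homotopy in [B] together with a square in [A]. *)
Definition side_graph : graph (sprod X (Simplex 1)) W := fun m z w =>
  z.2 = mono_const m ord0 /\ w = (b m z.1, path_at z.1) \/
  z.2 = mono_const m ord_max /\ w = h m (c m z.1).

Definition base_proj n : smap (sprod X (Simplex n)) C.
Proof. by exists (fun m z => c m z.1) => l m s z y <-; rewrite smap_act. Defined.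

Lemma const_neq m : mono_const m ord0 = mono_const m ord_max :> mono m 1 -> False.
Proof. by move/(congr1 (fun s : mono m 1 => s ord0 : nat)). Qed.

Lemma partial_side_graph : partial_map side_graph.
Proof.
split=> [l m r [x s] w [[/= -> ->]|[/= -> ->]]|m [x s] w w'].
- left; split=> //; congr pair; first by rewrite smap_act.
  by apply: hom_simp_eq => k u t /=; rewrite act_comp.
- by right; split=> //; rewrite /= !smap_act.
- case=> [[/= -> ->]|[/= -> ->]]; case=> [[/= es ->]|[/= es ->]] //.
    by case: (const_neq es).
  by case: (const_neq (esym es)).
Qed.

Lemma side_graph_over : gsub side_graph (lies_over (base_proj 1)).
Proof.
move=> m [x s] w [[/= _ ->]|[/= _ ->]]; last exact: h_over.
move=> k r /=; split; first by rewrite (hom_edge_src e) /= !smap_act.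
by rewrite (hom_edge_tgt e) /= !smap_act.
Qed.

Lemma mono01 (s : mono 0 1) : s = mono_const 0 ord0 \/ s = mono_const 0 ord_max.
Proof.
have [e1|ne] := eqVneq (s ord0) ord0; [left|right]; apply: mono_ext => j; rewrite ord1.
  by rewrite e1.
by move: ne (ltn_ord (s ord0)); rewrite ord_eqE /=; lia.
Qed.

Lemma lift_cell_exists : exists z : edge (name b) (name (lift_map \c c)),
  hedge e = vcomp (whisk_r lift_cell c) (whisk_l f (hedge z)) :> cell (f \c b) (g \c c).
Proof.
have [||H [H1 H2]] := @extend_lift _ (base_proj 1) side_graph partial_side_graph side_graph_over.
- move=> [x s]; have [es|es] := mono01 s.
    by exists (b 0 x, path_at x); left.
  by exists (h 0 (c 0 x)); right.
(* A simplex outside both sides is not constant at 0, hence its last vertex lies at the end 1. *)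
- move=> n [x s] nz; right; split; last by rewrite /= smap_act h_vert.
  apply: mono_ext => j /=; move: (ltn_ord (s ord_max)); case E: (val (s ord_max)) => [|[|k]] //= _.
  case: nz; exists (b n x, path_at x); left; split=> //; apply: mono_ext => i /=.
  have := mono_homo s (leq_ord i : i <= (ord_max : 'I_n.+1)); rewrite [X in _ <= X]E; lia.
have Hsrc m x : H m (x, mono_const m ord0) = (b m x, path_at x) by apply: H2; left.
have Htgt m x : H m (x, mono_const m ord_max) = h m (c m x) by apply: H2; right.
have znat k m (r : mono k m) (x : X m) (s : mono m 1) :
    act r (H m (x, s)).1 = (H k (act r x, mono_comp s r)).1.
  by rewrite -(smap_nat H (erefl (act r ((x, s) : sprod X (Simplex 1) m)))).
pose z0 : ihom X B 1 := hom_of znat.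
have zs m x : z0 m x (mono_const m ord0) = b m x by rewrite /= Hsrc.
have zt m x : z0 m x (mono_const m ord_max) = (lift_map \c c) m x by rewrite /= Htgt.
exists (hom_edge zs zt).
rewrite /vcomp /lift_cell whisk_l_edge whisk_r_edge; symmetry.
apply/(hedge_tri (ihom_quasi_category qA)).
(* The sides of the square are [f] of the new homotopy at [u = 0], the restricted lifting cell at
   [s = 1], the given cell at [s = 0], and the constant side [g \c c] at [u = 1]. *)
pose S m (x : X m) (s u : mono m 1) : A m := (H m (x, s)).2 m u (mono_id m).
apply: (@square_tri X A S (g \c c)) => //.
- move=> l m r x s u.
  rewrite /S -(smap_nat H (erefl (act r ((x, s) : sprod X (Simplex 1) m)))).
  exact: hom_simp_nat.
- by move=> m x s; rewrite /S (H1 m (x, s) m _).1 act_id.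
- by move=> m x u; rewrite /S Htgt h_path act_id.
- by move=> m x u; rewrite /S Hsrc /= act_id.
- by move=> m x s; rewrite /S (H1 m (x, s) m _).2 act_id.
Qed.

End Existence.

Section Uniqueness.

Definition compatible (z : ihom X B 1) (w : ihom X A 2) : Prop :=
  [/\ face (inord 2) w = ihom_post X f 1 z,
      face (inord 0) w = ihom_pre A c 1 lift_simp & face (inord 1) w = e0].

Lemma wedge_nat (w : ihom X A 2) m (x : X m) (s : mono m 1) k l (r : mono k l)
    (u : Simplex 1 l) (t : mono l m) :
  act r (w l (act t x) (square (mono_comp s t) u)) =
  w k (act (mono_comp t r) x) (square (mono_comp s (mono_comp t r)) (act r u)).
Proof. by apply: hom_simp_nat; rewrite ?act_comp ?square_comp. Qed.

(** Reading the triangle [w] as a square with one constant side turns a solution with its witness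
    into a homotopy of simplices of [W] over [C], the form that [extend_lift] can handle. *)
Definition wedge (z : ihom X B 1) (w : ihom X A 2) m (x : X m) (s : mono m 1) : W m :=
  (z m x s, hom_of (wedge_nat w x s)).

Lemma wedge_act (z : ihom X B 1) (w : ihom X A 2) l m (r : mono l m) x s :
  act r (wedge z w x s) = wedge z w (act r x) (mono_comp s r).
Proof.
congr pair; first exact: hom_simp_nat.
by apply: hom_simp_eq => k u t /=; rewrite act_comp.
Qed.

Variables (z : edge (name b) (name (lift_map \c c))) (w : ihom X A 2).
Let z0 : ihom X B 1 := sval z.
Hypothesis zw : compatible z0 w.

Lemma wedge_bottom m (x : X m) : wedge z0 w x (mono_const m ord0) = (b m x, path_at x).
Proof.
have [_ _ w1] := zw; congr pair; first exact: (hom_edge_src z).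
apply: hom_simp_eq => k u t /=.
rewrite (_ : mono_comp _ t = mono_const k ord0) // square_left.
by rewrite -w1.
Qed.

Lemma wedge_top m (x : X m) : wedge z0 w x (mono_const m ord_max) = h m (c m x).
Proof.
have [_ w0 _] := zw.
rewrite [RHS]surjective_pairing; congr pair; first exact: (hom_edge_tgt z).
apply: hom_simp_eq => k u t.
rewrite h_path -w0 [LHS]/= (_ : mono_comp _ t = mono_const k ord_max) // square_right.
by [].
Qed.

Lemma wedge_over m (x : X m) s : prism_over f (g m (c m x)) (wedge z0 w x s).
Proof.
have [w2 w0 _] := zw; move=> k t; split.
  have -> : (wedge z0 w x s).2 k (mono_const k ord0) t =
      face (inord 2) w k (act t x) (mono_comp s t) by rewrite [LHS]/= square_bottom.
  rewrite w2 /= -smap_act; congr (f k _); symmetry; exact: hom_simp_nat.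
have -> : (wedge z0 w x s).2 k (mono_const k ord_max) t =
    face (inord 0) w k (act t x) (mono_const k ord_max).
  rewrite [LHS]/= square_top; congr (w k _ _); apply: mono_ext => j.
  by rewrite !coface_compE !inordK.
by rewrite w0; apply: etrans (lift_simp_tgt _) _; rewrite !smap_act.
Qed.

End Uniqueness.

Section UniquenessProof.
Variables (z z' : edge (name b) (name (lift_map \c c))) (w w' : ihom X A 2).
Let z0 : ihom X B 1 := sval z.
Let z0' : ihom X B 1 := sval z'.
Hypothesis zw : compatible z0 w.
Hypothesis zw' : compatible z0' w'.

Let proj m (s : mono m 2) : mono m 1 := mono_comp (codegen ord0) s.

(** The two solutions are placed on the edges of the 2-simplex ending at vertex 2, and the constant
    homotopy of their common source on the edge from 0 to 1. Every missing simplex ends at vertex 2,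
    where the values are terminal. *)
Definition triangle_graph : graph (sprod X (Simplex 2)) W := fun m y v =>
  [\/ (forall j, y.2 j != 0 :> nat) /\ v = wedge z0' w' y.1 (proj y.2),
      (forall j, y.2 j != 1 :> nat) /\ v = wedge z0 w y.1 (proj y.2) |
      (forall j, y.2 j != 2 :> nat) /\ v = (b m y.1, path_at y.1)].

Lemma partial_triangle_graph : partial_map triangle_graph.
Proof.
have projE m (s : mono m 2) j : proj s j = s j - (0 < s j) :> nat by rewrite codegen_compE.
have h01 m (x : X m) (s : mono m 2) : (forall j, s j != 0 :> nat) -> (forall j, s j != 1 :> nat) ->
    wedge z0' w' x (proj s) = wedge z0 w x (proj s).
  move=> h1 h2; have -> : proj s = mono_const m ord_max.
    by apply: mono_ext => j; rewrite projE /=; move: (h1 j) (h2 j) (ltn_ord (s j)); lia.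
  by rewrite (wedge_top zw) (wedge_top zw').
have h02 m (x : X m) (s : mono m 2) : (forall j, s j != 0 :> nat) -> (forall j, s j != 2 :> nat) ->
    wedge z0' w' x (proj s) = (b m x, path_at x).
  move=> h1 h2; have -> : proj s = mono_const m ord0.
    by apply: mono_ext => j; rewrite projE /=; move: (h1 j) (h2 j) (ltn_ord (s j)); lia.
  exact: wedge_bottom.
have h12 m (x : X m) (s : mono m 2) : (forall j, s j != 1 :> nat) -> (forall j, s j != 2 :> nat) ->
    wedge z0 w x (proj s) = (b m x, path_at x).
  move=> h1 h2; have -> : proj s = mono_const m ord0.
    by apply: mono_ext => j; rewrite projE /=; move: (h1 j) (h2 j) (ltn_ord (s j)); lia.
  exact: wedge_bottom.
split=> [l m r [x s] v|m [x s] v v'].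
  case=> [[h1 ->]|[h1 ->]|[h1 ->]].
  - by apply: Or31; split=> [j|]; [apply: h1|rewrite wedge_act].
  - by apply: Or32; split=> [j|]; [apply: h1|rewrite wedge_act].
  - apply: Or33; split=> [j|]; first exact: h1.
    congr pair; first by rewrite smap_act.
    by apply: hom_simp_eq => k u t /=; rewrite act_comp.
case=> [[h1 ->]|[h1 ->]|[h1 ->]]; case=> [[h2 ->]|[h2 ->]|[h2 ->]] //.
- exact: h01.
- exact: h02.
- by symmetry; apply: h01.
- exact: h12.
- by symmetry; apply: h02.
- by symmetry; apply: h12.
Qed.

Lemma triangle_graph_over : gsub triangle_graph (lies_over (base_proj 2)).
Proof.
move=> m [x s] v [[_ ->]|[_ ->]|[_ ->]].
- exact: wedge_over.
- exact: wedge_over.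
- move=> k r /=; split; first by rewrite (hom_edge_src e) /= !smap_act.
  by rewrite (hom_edge_tgt e) /= !smap_act.
Qed.

Lemma lift_cell_unique : homotopic z0 z0'.
Proof.
have [||H [_ H2]] :=
  @extend_lift _ (base_proj 2) triangle_graph partial_triangle_graph triangle_graph_over.
- move=> [x s]; have [e1|ne] := eqVneq (s ord0 : nat) 1.
    exists (b 0 x, path_at x); apply: Or33; split=> // j; by rewrite ord1 e1.
  by exists (wedge z0 w x (proj s)); apply: Or32; split=> // j; rewrite ord1.
- move=> n [x s] nz; have e2 : s ord_max = 2 :> nat.
    have [//|ne] := eqVneq (s ord_max : nat) 2.
    case: nz; exists (b n x, path_at x); apply: Or33; split=> // j /=.
    have := mono_homo s (leq_ord j : j <= (ord_max : 'I_n.+1)).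
    by move: ne (ltn_ord (s ord_max)); lia.
  apply: Or31; split=> [j|]; first by rewrite /= e2.
  rewrite /= (_ : proj _ = mono_const 0 ord_max).
    by rewrite (wedge_top zw') h_vert.
  by apply: mono_ext => j; rewrite codegen_compE /= e2.
have knat k m (r : mono k m) (x : X m) (s : mono m 2) :
    act r (H m (x, s)).1 = (H k (act r x, mono_comp s r)).1.
  by rewrite -(smap_nat H (erefl (act r ((x, s) : sprod X (Simplex 2) m)))).
have pE (i : 'I_3) m (s : mono m 1) : i < 2 -> proj (mono_comp (coface i) s) = s.
  move=> i2; apply: mono_ext => j; rewrite codegen_compE coface_compE /bump /=.
  by move: (ltn_ord (s j)); lia.
(* The filled triangle exhibits [z0] as a composite of the identity with [z0'], and so does the
   degenerate triangle for [z0'] itself. *)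
have t : tri (degen 1 (name b)) z0' z0.
  exists (hom_of knat); split; apply: hom_simp_eq => m x s /=.
  - rewrite (H2 _ _ (b m x, path_at x)) //; apply: Or33; split=> // j.
    by rewrite coface_compE inordK // /bump; move: (ltn_ord (s j)); lia.
  - rewrite (H2 _ _ (wedge z0' w' x s)) //; apply: Or31; split=> [j|].
      by rewrite coface_compE inordK // /bump; move: (ltn_ord (s j)); lia.
    by rewrite pE ?inordK.
  - rewrite (H2 _ _ (wedge z0 w x s)) //; apply: Or32; split=> [j|].
      by rewrite coface_compE inordK // /bump; move: (ltn_ord (s j)); lia.
    by rewrite pE ?inordK.
have := tri_idl z0'; rewrite (svalP z').1 => t'.
exact: (tri_uniq (ihom_quasi_category qB)) t t'.
Qed.

End UniquenessProof.
End Universal.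

Lemma pointwise_lifting : exists (l : smap C B) (lam : cell (f \c l) g),
  absolute_right_lifting lam.
Proof.
have [h [h1 h2]] := lifting_exists.
exists (lift_map h), (lift_cell h1) => X qX b c chi.
have qIA := ihom_quasi_category (X := X) qA; have qIB := ihom_quasi_category (X := X) qB.
have [e ->] := hedge_surj qIA chi.
have [z ez] := lift_cell_exists h1 h2 e.
exists (hedge z); split=> // zeta' ez'.
have [z' e'] := hedge_surj qIB zeta'; subst zeta'.
move: ez ez'; rewrite /vcomp /lift_cell !whisk_l_edge !whisk_r_edge.
move=> /esym/(hedge_tri qIA)[w [w2 w0 w1]] /esym/(hedge_tri qIA)[w' [w2' w0' w1']].
apply/(hedge_homotopic qIB).
by apply: (@lift_cell_unique h h1 h2 X b c e z z' w w').
Qed.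

End Construction.

Theorem theorem6p1p4 (A B C : sSet) (hA : quasi_category A)
    (hB : quasi_category B) (hC : quasi_category C)
    (f : smap B A) (g : smap C A) :
  (exists (l : smap C B) (lam : cell (f \c l) g), absolute_right_lifting lam)
  <->
  (forall c : C 0, exists t : comma f (g 0 c) 0, terminal t).
Proof.
split=> [[l [lam lamP]] c|h]; first exact: (lifting_terminal hA hB lamP c).
pose T c := sval (boolp.cid (h c)).
by apply: (@pointwise_lifting A B C hA hB f g T) => c; rewrite /T; case: boolp.cid.
Qed.
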